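(* Let $M^3$ be a $3$-dimensional Riemannian space form (a Riemannian manifold of constant sectional curvature) and let $\Sigma^2\subset M^3$ be a surface with $K_{ext}=0$. If $p_0\in\Sigma^2$ is a parabolic point or an interior point of the set of planar points of $\Sigma^2$, then $\Sigma^2$ is a ruled surface in an open neighborhood of $p_0$.
   Context: For a surface $\Sigma^2\subset M^3$ with unit normal $\xi$, the shape operator is $S_p(X)=-(\nabla_X\xi)(p)$, where $\nabla$ is the Levi-Civita connection of $M^3$; its eigenvalues $\kappa_1,\kappa_2$ are the principal curvatures, and $K_{ext}=\kappa_1\kappa_2$ is the extrinsic Gaussian curvature. A point of $\Sigma^2$ is parabolic if exactly one of the principal curvatures vanishes there, and planar if both principal curvatures vanish there. A surface is ruled if it is foliated by geodesics of the ambient manifold $M^3$. *)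

(* Defs.v *)
From HB Require Import structures.
From mathcomp Require Import all_boot all_order all_algebra.
From mathcomp Require Import all_classical all_reals all_analysis.
Set Implicit Arguments.
Unset Strict Implicit.
Unset Printing Implicit Defensive.
Import Order.TTheory GRing.Theory Num.Theory.
Import numFieldNormedType.Exports.
Local Open Scope classical_set_scope.
Local Open Scope ring_scope.

(* Tangent vectors are row vectors of components in a chart, linear maps act on
   the right, and [delta_mx 0 i] is the i-th coordinate vector. *)

Section smooth_maps.
Context {R : realType} {V W : normedModType R}.

Fixpoint Ck (k : nat) (U : set V) (h : V -> W) : Prop :=
  if k is k'.+1 then
    (forall x, U x -> differentiable h x) /\ (forall v, Ck k' U ('D_v h))
  else forall x, U x -> {for x, continuous h}.

(* Meant for open U and finite-dimensional V and W, where it is C^infinity. *)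
Definition smooth_on (U : set V) (h : V -> W) : Prop := forall k, Ck k U h.

End smooth_maps.

(* The inverse [cinv] is only meaningful on the open image [cimg] of the chart. *)
Record chart (R : realType) (n : nat) (M : topologicalType) := Chart {
  cdom : set M;
  cmap :> M -> 'rV[R]_n;
  cinv : 'rV[R]_n -> M;
  open_cdom : open cdom;
  open_cimg : open (cmap @` cdom);
  cmapK : forall p, cdom p -> cinv (cmap p) = p;
  cmap_continuous : forall p, cdom p -> {for p, continuous cmap};
  cinv_continuous : forall x, (cmap @` cdom) x -> {for x, continuous cinv} }.

Definition cimg (R : realType) (n : nat) (M : topologicalType)
  (a : chart R n M) : set 'rV[R]_n := a @` cdom a.

Definition smooth_transition (R : realType) (n : nat) (M : topologicalType)
    (a b : chart R n M) : Prop :=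
  smooth_on (a @` (cdom a `&` cdom b)) (b \o cinv a).

Record manifold (R : realType) (n : nat) := Manifold {
  mcarrier :> topologicalType;
  manifold_hausdorff : hausdorff_space mcarrier;
  manifold_second_countable : @second_countable mcarrier;
  atlas : set (chart R n mcarrier);
  atlas_cover : forall p, exists2 a, atlas a & cdom a p;
  atlas_smooth : forall a b, atlas a -> atlas b -> smooth_transition a b }.
Arguments atlas {R n} _.

Definition admissible_chart (R : realType) (n : nat) (M : manifold R n)
    (h : chart R n M) : Prop :=
  forall a, atlas M a -> smooth_transition a h /\ smooth_transition h a.

Definition inner (R : realType) (n : nat) (G : 'M[R]_n) (u v : 'rV[R]_n) : R :=
  (u *m G *m v^T) 0 0.

(* [gmx a x] is the matrix of components, in the chart a of the atlas, of the
   metric at the point with coordinates x; the last field is the tensor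
   transformation law. *)
Record metric (R : realType) (n : nat) (M : manifold R n) := Metric {
  gmx : chart R n M -> 'rV[R]_n -> 'M[R]_n;
  gmx_smooth : forall a, atlas M a -> smooth_on (cimg a) (gmx a);
  gmx_sym : forall a x, atlas M a -> cimg a x -> (gmx a x)^T = gmx a x;
  gmx_pos : forall a x v, atlas M a -> cimg a x -> v != 0 ->
    0 < inner (gmx a x) v v;
  gmx_change : forall a b p, atlas M a -> atlas M b -> cdom a p -> cdom b p ->
    gmx a (a p) = jacobian (b \o cinv a) (a p) *m gmx b (b p)
                    *m (jacobian (b \o cinv a) (a p))^T }.

Section local_geometry.
Context {R : realType} {n : nat}.
Variable g : 'rV[R]_n -> 'M[R]_n.

(* Gamma^k_(i j) of the Levi-Civita connection of g. *)
Definition christoffel (k i j : 'I_n) (x : 'rV[R]_n) : R :=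
  2^-1 * \sum_(l < n) invmx (g x) k l *
    ('D_(delta_mx 0 i) (fun y => g y j l) x
     + 'D_(delta_mx 0 j) (fun y => g y i l) x
     - 'D_(delta_mx 0 l) (fun y => g y i j) x).

(* The l-th component of R(d_i, d_j) d_k, where
   R(X, Y) Z = nabla_X nabla_Y Z - nabla_Y nabla_X Z - nabla_[X, Y] Z. *)
Definition riemann (l i j k : 'I_n) (x : 'rV[R]_n) : R :=
  'D_(delta_mx 0 i) (christoffel l j k) x
  - 'D_(delta_mx 0 j) (christoffel l i k) x
  + \sum_(m < n) (christoffel l i m x * christoffel m j k x
                  - christoffel l j m x * christoffel m i k x).

Definition curvature (x u v w : 'rV[R]_n) : 'rV[R]_n :=
  \row_l \sum_(i < n) \sum_(j < n) \sum_(k < n)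
    u 0 i * v 0 j * w 0 k * riemann l i j k x.

Definition sectional (x u v : 'rV[R]_n) : R :=
  inner (g x) (curvature x u v v) u
  / (inner (g x) u u * inner (g x) v v - inner (g x) u v ^+ 2).

(* nabla_X N at x, for a vector field N along the map F (V is the parameter
   space: 'rV_2 for a surface, R for a curve). *)
Definition covariant (V : normedModType R) (F N : V -> 'rV[R]_n) (X x : V) :
    'rV[R]_n :=
  'D_X N x + \row_k \sum_(i < n) \sum_(j < n)
    christoffel k i j (F x) * ('D_X F x) 0 i * (N x) 0 j.

End local_geometry.

Definition constant_curvature (R : realType) (n : nat) (M : manifold R n)
    (g : metric M) (c : R) : Prop :=
  forall a p (u v : 'rV[R]_n), atlas M a -> cdom a p -> row_free (col_mx u v) ->
    sectional (gmx g a) (a p) u v = c.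

Definition space_form (R : realType) (n : nat) (M : manifold R n)
    (g : metric M) : Prop :=
  exists c, constant_curvature g c.

(* gamma need only be defined on the open interval I.  The geodesic equation is
   coordinate-independent, so one chart around each point is enough. *)
Definition geodesic (R : realType) (n : nat) (M : manifold R n) (g : metric M)
    (I : set R) (gamma : R -> M) : Prop :=
  (forall t, I t -> {for t, continuous gamma}) /\
  forall t, I t -> exists b, [/\ atlas M b, cdom b (gamma t),
    exists2 J, open_nbhs t J & smooth_on J (b \o gamma) &
    covariant (gmx g b) (b \o gamma) ('D_1 (b \o gamma)) 1 t = 0].

Section maps.
Context {R : realType} {m n : nat} {S : manifold R m} {M : manifold R n}.
Variable f : S -> M.

Definition in_charts (a : chart R m S) (b : chart R n M) :
  'rV[R]_m -> 'rV[R]_n := b \o f \o cinv a.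

Definition charts_dom (a : chart R m S) (b : chart R n M) : set 'rV[R]_m :=
  a @` (cdom a `&` f @^-1` cdom b).

Definition immersion : Prop :=
  continuous f /\
  forall a b, atlas S a -> atlas M b ->
    smooth_on (charts_dom a b) (in_charts a b) /\
    forall x, charts_dom a b x -> row_free (jacobian (in_charts a b) x).

End maps.

Section surfaces.
Context {R : realType} {S : manifold R 2} {M : manifold R 3}.
Variables (g : metric M) (f : S -> M).

(* N expresses, in the charts a and b, a smooth unit normal field of the surface
   near p.  Such fields exist around every point and are unique up to sign; no
   global one is assumed. *)
Definition unit_normal (a : chart R 2 S) (b : chart R 3 M)
    (N : 'rV[R]_2 -> 'rV[R]_3) (p : S) : Prop :=
  [/\ atlas S a, atlas M b, cdom a p, cdom b (f p) &
   exists U, [/\ open_nbhs (a p) U, U `<=` charts_dom f a b, smooth_on U N &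
     forall x, U x -> let F := in_charts f a b in
       inner (gmx g b (F x)) (N x) (N x) = 1 /\
       forall X, inner (gmx g b (F x)) ('D_X F x) (N x) = 0]].

(* A is the matrix of the shape operator at p: df(A X) = - nabla_X N. *)
Definition shape_operator (a : chart R 2 S) (b : chart R 3 M)
    (N : 'rV[R]_2 -> 'rV[R]_3) (p : S) (A : 'M[R]_2) : Prop :=
  forall X : 'rV[R]_2, 'D_(X *m A) (in_charts f a b) (a p)
    = - covariant (gmx g b) (in_charts f a b) N X (a p).

(* k1, k2 are the eigenvalues, with multiplicity, of the shape operator. *)
Definition principal_curvatures (a : chart R 2 S) (b : chart R 3 M)
    (N : 'rV[R]_2 -> 'rV[R]_3) (p : S) (k1 k2 : R) : Prop :=
  exists2 A, shape_operator a b N p A &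
    char_poly A = ('X - k1%:P) * ('X - k2%:P).

(* N is only determined up to sign, and N |-> -N changes the sign of both
   principal curvatures; this does not affect the following three notions. *)
Definition extrinsic_curvature (p : S) (K : R) : Prop :=
  forall a b N, unit_normal a b N p ->
    exists k1 k2, principal_curvatures a b N p k1 k2 /\ K = k1 * k2.

Definition parabolic (p : S) : Prop :=
  forall a b N, unit_normal a b N p ->
    exists k1 k2, principal_curvatures a b N p k1 k2 /\ (k1 == 0) (+) (k2 == 0).

Definition planar (p : S) : Prop :=
  forall a b N, unit_normal a b N p -> principal_curvatures a b N p 0 0.

(* F is the set of leaves of a one-dimensional foliation of U.  The norm of
   'rV_2 is the sup norm, so that [ball 0 1] is the open square ]-1, 1[^2. *)
Definition foliation (U : set S) (F : set (set S)) : Prop :=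
  [/\ \bigcup_(L in F) L = U,
      forall L, F L -> L !=set0 /\ connected L,
      forall L L', F L -> F L' -> L `&` L' !=set0 -> L = L' &
      forall q, U q -> exists h : chart R 2 S,
        [/\ admissible_chart h, cdom h q, cdom h `<=` U, cimg h = ball 0 1 &
         forall L r, F L -> (L `&` cdom h) r ->
           connected_component (L `&` cdom h) r
             = [set s | cdom h s /\ h s 0 0 = h r 0 0]]].

(* Constant geodesics are excluded by the last clause of [foliation]. *)
Definition ruled (U : set S) : Prop :=
  exists F, foliation U F /\
    forall L, F L -> exists (I : set R) (c : R -> S),
      [/\ open I, is_interval I, forall t, I t -> {for t, continuous c},
          L = c @` I & geodesic g I (f \o c)].

End surfaces.

(* Main.v *)
(* In curvature c the total system nabla_X V = - c s dF(X), X s = <dF(X), V> on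
   the surface F is flat, so it has local solutions with any initial (V, s):
   s is the restriction of an ambient function with Hessian - c s g, and V its
   gradient.  Let N be a unit normal.  At a parabolic point x0 choose
   V(x0) = nabla_{X0} N <> 0 and put h = <N, V>: since dh(X) = <nabla_X N, V>,
   the level curves of h follow the kernel of the shape operator, and
   W = nabla_{e_i} N stays orthogonal to them.  Near an interior planar point N
   is parallel; take two solutions, h = s / s' and W = V - h V'.  In both cases
   the acceleration of a level curve of h, parametrized by arclength, is
   orthogonal to its velocity, to N and to W, so the level curve is a geodesic;
   the chart (h, x_j) foliates a neighborhood. *)
Require Import Defs.
From HB Require Import structures.
From mathcomp Require Import all_boot all_order all_algebra.
From mathcomp Require Import ring lra.
From mathcomp Require Import all_classical all_reals all_analysis.
Set Implicit Arguments.
Unset Strict Implicit.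
Unset Printing Implicit Defensive.
Import Order.TTheory GRing.Theory Num.Theory.
Import numFieldNormedType.Exports.
Local Open Scope classical_set_scope.
Local Open Scope ring_scope.

(** * Smooth maps *)

(** For c > 0 a pair (V, s) is a constant vector of the Euclidean 4-space around the sphere, split
    into its tangential part and, up to scale, its radial component; for c = 0 it is a constant
    vector field with an affine function. The system is flat because the curvature term c (<Y, V> X
    - <X, V> Y) is cancelled by what comes from differentiating s in - c s dF. Taking the leaves as
    level sets, and not as integral curves of the kernel field, avoids the smooth dependence of a
    flow on its initial point: what remains is a linear total system in two variables and the
    inverse of a map that is monotone along lines. The acceleration is orthogonal to W because
    nabla_T W is a multiple of W for T tangent to a leaf. In the parabolic case this comes from the
    Codazzi equation nabla_e nabla_f N = nabla_f nabla_e N, applied to nabla_f N = m nabla_e N; in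
    the planar case nabla_T W = - c (s - h s') dF(T) = 0. Smoothness of the solutions, of the
    inverse map and of the arclength parameter is always a bootstrap: an equation expresses the
    first derivatives of the unknown through the unknown itself and smooth data. *)

Section matrix_valued_maps.
Context {R : realType} {V : normedModType R} {m n : nat}.

Lemma norm_mx_le (A : 'M[R]_(m, n)) (e : R) : 0 <= e ->
  (forall i j, `|A i j| <= e) -> `|A| <= e.
Proof.
move=> e0 Ae; rewrite [leLHS]/Num.Def.normr/= mx_normrE.
by apply: bigmax_le => // -[i j] _; exact: Ae.
Qed.

Lemma norm_entry_le (A : 'M[R]_(m, n)) i j : `|A i j| <= `|A|.
Proof.
rewrite [leRHS]/Num.Def.normr/= mx_normrE.
exact: (@le_bigmax _ _ _ _ (fun i : 'I_m * 'I_n => `|A i.1 i.2|) (i, j)).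
Qed.

Lemma derive_entry (h : V -> 'M[R]_(m, n)) v x i j : differentiable h x ->
  'D_v h x i j = 'D_v (fun y => h y i j) x.
Proof. by move=> dh; rewrite derive_mx ?mxE//; exact: diff_derivable. Qed.

Lemma differentiable_entry (h : V -> 'M[R]_(m, n)) x i j :
  differentiable h x -> differentiable (fun y => h y i j) x.
Proof.
move=> dh.
apply: (@differentiable_comp _ _ _ _ h (fun A : 'M[R]_(m, n) => A i j)) => //.
exact: differentiable_coord.
Qed.

Lemma differentiable_mx (h : V -> 'M[R]_(m, n)) x :
  (forall i j, differentiable (fun y => h y i j) x) -> differentiable h x.
Proof.
move=> dh.
have -> : h = \sum_i \sum_j (fun y => h y i j *: delta_mx i j).
  apply/funext => y; rewrite fct_sumE [LHS]matrix_sum_delta.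
  by apply: eq_bigr => i _; rewrite fct_sumE.
apply: differentiable_sum => i; apply: differentiable_sum => j.
exact: differentiableZl.
Qed.

End matrix_valued_maps.

Section frechet.
Context {R : realType} {V W : normedModType R}.

Lemma diff_norm_le (f : V -> W) x (e : R) : differentiable f x -> 0 < e ->
  \forall y \near x, `|f y - f x - 'd f x (y - x)| <= e * `|y - x|.
Proof.
move=> /diff_locallyP[_ /eqaddoP fx] e0.
rewrite (near_shift 0) /= subr0; near=> h.
by rewrite /= addrK -addrA -opprD; near: h; exact: fx.
Unshelve. all: by end_near. Qed.

Lemma is_diff_norm (f : V -> W) x (L : {linear V -> W}) : continuous L ->
  (forall e, 0 < e -> \forall y \near x, `|f y - f x - L (y - x)| <= e * `|y - x|) ->
  is_diff x f L.
Proof.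
move=> cL fL.
have fxL : f \o shift x = cst (f x) + L +o_ 0 id.
  apply/eqaddoP => e e0; have := fL e e0.
  rewrite (near_shift 0) /= subr0; apply: filterS => h /=.
  by rewrite addrK -addrA -opprD.
have dE := diff_unique cL fxL.
by apply: DiffDef => //; apply/diff_locallyP; rewrite dE.
Qed.

Lemma near_eq_differentiable (f g : V -> W) (x : V) :
  (\near x, f x = g x) -> differentiable f x -> differentiable g x.
Proof.
move=> fg df.
have [] // := @is_diff_norm g x ('d f x) (diff_continuous df) _ => e e0.
near=> y; rewrite -(nbhs_singleton fg) -(near fg y)//.
by near: y; exact: diff_norm_le.
Unshelve. all: by end_near. Qed.

End frechet.

Section Ck_calculus.
Context {R : realType}.
Implicit Types (V W : normedModType R) (k : nat).

Lemma open_near (T : topologicalType) (U : set T) x (P : T -> Prop) :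
  open U -> U x -> (forall y, U y -> P y) -> \forall y \near x, P y.
Proof. by move=> oU Ux UP; apply: filterS UP _; exact: open_nbhs_nbhs. Qed.

Lemma Ck_subset V W k (U U' : set V) (h : V -> W) :
  U' `<=` U -> Ck k U h -> Ck k U' h.
Proof.
move=> UU'; elim: k h => [|k IH] h /=; first by move=> ch x /UU' /ch.
by move=> [dh Dh]; split=> [x /UU' /dh//|v]; exact/IH/Dh.
Qed.

Lemma Ck_eq V W k (U : set V) (h h' : V -> W) : open U ->
  {in U, h =1 h'} -> Ck k U h -> Ck k U h'.
Proof.
move=> oU; elim: k h h' => [|k IH] h h' /= hh'.
  move=> ch x Ux; have hx : h x = h' x by apply: hh'; rewrite inE.
  have e : \forall y \near x, h y = h' y.
    by apply: open_near oU Ux _ => y Uy; apply: hh'; rewrite inE.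
  rewrite /prop_for /continuous_at -hx; apply: cvg_trans (ch x Ux).
  by apply: near_eq_cvg; apply: filterS e => y ->.
have e x : U x -> \forall y \near x, h y = h' y.
  by move=> Ux; apply: open_near oU Ux _ => y Uy; apply: hh'; rewrite inE.
move=> [dh Dh]; split=> [x Ux|v].
  by apply: near_eq_differentiable (dh x Ux); exact: e.
apply: IH (Dh v) => x; rewrite inE => Ux; apply: near_eq_derive; exact: e.
Qed.

Lemma CkW V W k (U : set V) (h : V -> W) : Ck k.+1 U h -> Ck k U h.
Proof.
elim: k h => [|k IH] h /=; first by move=> [dh _] x /dh /differentiable_continuous.
by move=> [dh Dh]; split=> // v; exact/IH/Dh.
Qed.

Lemma Ck_cst V W k (U : set V) (a : W) : open U -> Ck k U (cst a).
Proof.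
move=> oU; elim: k a => [|k IH] a /=; first by move=> *; exact: cst_continuous.
split=> [x _|v]; first exact: differentiable_cst.
by apply: Ck_eq (IH 0) => // x _; rewrite derive_cst.
Qed.

Lemma Ck_linear V W k (U : set V) (L : {linear V -> W}) : open U ->
  continuous L -> Ck k U L.
Proof.
case: k => [|k] oU cL /=; first by move=> x _; exact: cL.
split=> [x _|v]; first exact: linear_differentiable.
apply: Ck_eq (@Ck_cst _ _ k _ (L v) oU) => // x _.
by rewrite deriveE ?diff_lin//; exact: linear_differentiable.
Qed.

Lemma Ck_add V W k (U : set V) (f g : V -> W) : open U ->
  Ck k U f -> Ck k U g -> Ck k U (fun x => f x + g x).
Proof.
move=> oU; elim: k f g => [|k IH] f g /=.
  by move=> cf cg x Ux; apply: cvgD; [exact: cf|exact: cg].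
move=> [df Df] [dg Dg]; split=> [x Ux|v].
  by apply: differentiableD; [exact: df|exact: dg].
apply: Ck_eq (IH _ _ (Df v) (Dg v)) => // x; rewrite inE => Ux.
by rewrite [RHS]deriveD//; apply: diff_derivable; [exact: df|exact: dg].
Qed.

Lemma Ck_opp V W k (U : set V) (f : V -> W) : open U ->
  Ck k U f -> Ck k U (fun x => - f x).
Proof.
move=> oU; elim: k f => [|k IH] f /=.
  by move=> cf x Ux; apply: cvgN; exact: cf.
move=> [df Df]; split=> [x Ux|v]; first by apply: differentiableN; exact: df.
apply: Ck_eq (IH _ (Df v)) => // x; rewrite inE => Ux.
by rewrite [RHS]deriveN//; exact/diff_derivable/df.
Qed.

Lemma Ck_mul V k (U : set V) (f g : V -> R) : open U ->
  Ck k U f -> Ck k U g -> Ck k U (fun x => f x * g x).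
Proof.
move=> oU; elim: k f g => [|k IH] f g.
  by move=> cf cg x Ux; apply: cvgM; [exact: cf|exact: cg].
move=> cf cg; have [[df Df] [dg Dg]] := (cf, cg); split=> [x Ux|v].
  by apply: differentiableM; [exact: df|exact: dg].
have := Ck_add oU (IH _ _ (CkW cf) (Dg v)) (IH _ _ (CkW cg) (Df v)).
apply: Ck_eq => // x; rewrite inE => Ux.
by rewrite [RHS]deriveM//; apply: diff_derivable; [exact: df|exact: dg].
Qed.

Lemma Ck_sum V W k (U : set V) n (f : 'I_n -> V -> W) : open U ->
  (forall i, Ck k U (f i)) -> Ck k U (fun x => \sum_(i < n) f i x).
Proof.
move=> oU cf; elim: n f cf => [|n IH] f cf.
  by apply: Ck_eq (@Ck_cst _ _ k _ 0 oU) => // x _; rewrite big_ord0.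
apply: Ck_eq (Ck_add oU (IH (fun i => f (widen_ord (leqnSn n) i)) _) (cf ord_max)) => //.
by move=> x _; rewrite big_ord_recr.
Qed.

Lemma Ck_entry V m n k (U : set V) (h : V -> 'M[R]_(m, n)) i j : open U ->
  Ck k U h -> Ck k U (fun x => h x i j).
Proof.
move=> oU; elim: k h => [|k IH] h /=.
  move=> ch x Ux.
  apply: (@continuous_comp _ _ _ h (fun A : 'M[R]_(m, n) => A i j)).
    exact: ch.
  exact: coord_continuous.
move=> [dh Dh]; split=> [x Ux|v]; first exact/differentiable_entry/dh.
apply: Ck_eq (IH _ (Dh v)) => // x; rewrite inE => Ux.
by rewrite derive_entry//; exact: dh.
Qed.

Lemma Ck_mx V m n k (U : set V) (h : V -> 'M[R]_(m, n)) : open U ->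
  (forall i j, Ck k U (fun x => h x i j)) -> Ck k U h.
Proof.
move=> oU; elim: k h => [|k IH] h /= ch.
  move=> x Ux; apply/cvgrPdist_le => e e0; near=> y.
  apply: norm_mx_le => [|i j]; first exact: ltW.
  move: i j; near: y; apply: filter_forall => i; apply: filter_forall => j.
  by have /cvgrPdist_le/(_ e e0) := ch i j x Ux; apply: filterS => z; rewrite !mxE.
have dh x : U x -> differentiable h x.
  by move=> Ux; apply: differentiable_mx => i j; have [+ _] := ch i j; apply.
split=> // v; apply: IH => i j; have [_ /(_ v)] := ch i j.
by apply: Ck_eq => // x; rewrite inE => Ux; rewrite derive_entry//; exact: dh.
Unshelve. all: by end_near. Qed.

Lemma derive_comp V (V1 : normedModType R) W (f : V -> V1) (g : V1 -> W) x v :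
  differentiable f x -> differentiable g (f x) ->
  'D_v (g \o f) x = 'D_('D_v f x) g (f x).
Proof.
move=> df dg; rewrite deriveE; last exact: differentiable_comp.
by rewrite diff_comp//= [RHS]deriveE// [in RHS]deriveE.
Qed.

Lemma derive_rV_sum W n (g : 'rV[R]_n -> W) (y w : 'rV[R]_n) :
  differentiable g y ->
  'D_w g y = \sum_(i < n) w 0 i *: 'D_(delta_mx 0 i) g y.
Proof.
move=> dg; rewrite deriveE// [in LHS](row_sum_delta w) linear_sum.
by apply: eq_bigr => i _; rewrite linearZ deriveE.
Qed.

(** The chain rule writes the derivative of [g \o f] as a finite sum of products of components of
    the derivative of [f] with partials of [g] composed with [f]. The induction thus needs only
    sums, products and the same statement one order lower for each partial. *)
Lemma Ck_comp V n k (U : set V) (B : set 'rV[R]_n) (f : V -> 'rV[R]_n)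
    (g : 'rV[R]_n -> R) : open U -> (forall x, U x -> B (f x)) ->
  Ck k U f -> Ck k B g -> Ck k U (g \o f).
Proof.
move=> oU UB; elim: k g => [|k IH] g.
  move=> cf cg x Ux; apply: continuous_comp; first exact: cf.
  exact/cg/UB.
move=> cf cg; have [[df Df] [dg Dg]] := (cf, cg); split=> [x Ux|v].
  by apply: differentiable_comp; [exact: df|exact/dg/UB].
suff : Ck k U (fun x => \sum_(i < n) 'D_v f x 0 i * ('D_(delta_mx 0 i) g \o f) x).
  apply: Ck_eq => // x; rewrite inE => Ux.
  by rewrite [RHS]derive_comp ?derive_rV_sum//; do ?[exact: df|exact/dg/UB].
apply: Ck_sum => // i; apply: Ck_mul => //; first exact/Ck_entry/Df.
by apply: IH; [exact: CkW|exact: Dg].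
Qed.

Lemma derive_comp_R V W (f : V -> R) (g : R -> W) x v :
  differentiable f x -> differentiable g (f x) ->
  'D_v (g \o f) x = 'D_v f x *: 'D_1 g (f x).
Proof.
move=> df dg; rewrite deriveE; last exact: differentiable_comp.
rewrite diff_comp//= -[X in 'd g _ X]mulr1 [LHS]linearZ/= [in RHS]deriveE//.
by rewrite [in RHS]deriveE.
Qed.

Lemma Ck_comp_R V k (U : set V) (B : set R) (f : V -> R) (g : R -> R) :
  open U -> (forall x, U x -> B (f x)) ->
  Ck k U f -> Ck k B g -> Ck k U (g \o f).
Proof.
move=> oU UB; elim: k g => [|k IH] g.
  move=> cf cg x Ux; apply: continuous_comp; first exact: cf.
  exact/cg/UB.
move=> cf cg; have [[df Df] [dg Dg]] := (cf, cg); split=> [x Ux|v].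
  by apply: differentiable_comp; [exact: df|exact/dg/UB].
suff : Ck k U (fun x => 'D_v f x * ('D_1 g \o f) x).
  apply: Ck_eq => // x; rewrite inE => Ux.
  by rewrite derive_comp_R//; [exact: df|exact/dg/UB].
by apply: (Ck_mul oU (Df v)); apply: IH; [exact: CkW|exact: Dg].
Qed.

(** Bootstrap: the derivative is - f^-1 f^-1 D f, so order k of the inverse itself yields order k +
    1. The square root below works in the same way, from D f / (2 sqrt f). *)
Lemma Ck_inv V k (U : set V) (f : V -> R) : open U ->
  (forall x, U x -> f x != 0) -> Ck k U f -> Ck k U (fun x => (f x)^-1).
Proof.
move=> oU f0; elim: k => [|k IH]; first by move=> cf x Ux; apply: cvgV; [exact: f0|exact: cf].
move=> cf; have [df Df] := cf; split=> [x Ux|v].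
  by apply: differentiableV; [exact: df|exact: f0].
have cV := IH (CkW cf).
have := Ck_opp oU (Ck_mul oU (Ck_mul oU cV cV) (Df v)).
apply: Ck_eq => // x; rewrite inE => Ux.
rewrite [RHS]deriveV; [|exact: f0|exact/diff_derivable/df].
by rewrite -exprVn expr2 scaleNr.
Qed.

Lemma Ck_sqrt V k (U : set V) (f : V -> R) : open U ->
  (forall x, U x -> 0 < f x) -> Ck k U f -> Ck k U (fun x => Num.sqrt (f x)).
Proof.
move=> oU f0; elim: k => [|k IH].
  move=> cf x Ux; apply: (@continuous_comp _ _ _ f Num.sqrt); first exact: cf.
  exact: sqrt_continuous.
move=> cf; have [df Df] := cf.
have ds x : U x -> differentiable Num.sqrt (f x).
  by move=> /f0 fx0; apply/derivable1_diffP; have [] := is_derive1_sqrt fx0.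
split=> [x Ux|v]; first exact: (differentiable_comp (df x Ux) (ds x Ux)).
have s0 x : U x -> 2 * Num.sqrt (f x) != 0.
  by move=> /f0 fx0; rewrite mulf_neq0// gt_eqF// sqrtr_gt0.
have c2 := Ck_mul oU (@Ck_cst _ _ k _ (2 : R) oU) (IH (CkW cf)).
have := Ck_mul oU (Df v) (Ck_inv oU s0 c2).
apply: Ck_eq => // x; rewrite inE => Ux.
rewrite -[RHS]/('D_v (Num.sqrt \o f) x) derive_comp_R; [|exact: df|exact: ds].
by rewrite derive_sqrt//; exact: f0.
Qed.

End Ck_calculus.

Section mean_value.
Context {R : realType}.
Implicit Types V W : normedModType R.

Lemma is_derive_line V W (f : V -> W) (y u : V) (t : R) :
  differentiable f (y + t *: u) ->
  is_derive t 1 (fun s => f (y + s *: u)) ('D_u f (y + t *: u)).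
Proof.
move=> df.
have dl : is_diff t (fun s : R => y + s *: u) ( *:%R^~ u).
  have := @is_diffD R R V (cst y) ( *:%R^~ u) 0 ( *:%R^~ u) t _ _.
  by rewrite add0r; apply.
have dc : differentiable (f \o (fun s : R => y + s *: u)) t.
  by apply: differentiable_comp => //; have [] := dl.
apply: DeriveDef; first exact: diff_derivable.
rewrite -[LHS]/('D_1 (f \o (fun s : R => y + s *: u)) t).
rewrite [LHS]derive_comp// (_ : 'D_1 _ t = u)//.
by rewrite deriveE//; have [_ ->] := dl; rewrite scale1r.
Qed.

(** The norm is the sup norm of the entries, so the scalar mean value theorem applied to each entry
    loses no constant. *)
Lemma mean_value_norm n (f f' : R -> 'rV[R]_n) (a b M : R) : 0 <= M ->
  (forall t, a <= t <= b -> is_derive t 1 f (f' t)) ->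
  (forall t, a <= t <= b -> `|f' t| <= M) ->
  forall s t, a <= s <= b -> a <= t <= b -> `|f t - f s| <= M * `|t - s|.
Proof.
move=> M0 df f'M s t; wlog st : s t / s <= t.
  move=> H; have [st|/ltW ts] := leP s t; first exact: H.
  by move=> sab tab; rewrite distrC (distrC t); exact: H.
move=> /andP[sa sb] /andP[ta tb]; apply: norm_mx_le => [|i j].
  by rewrite mulr_ge0.
have di z : s <= z <= t -> is_derive z 1 (fun z => f z i j) (f' z i j).
  move=> /andP[sz zt]; have zab : a <= z <= b.
    by rewrite (le_trans sa sz) (le_trans zt tb).
  have dz := df z zab; have dfz : differentiable f z.
    by apply/derivable1_diffP; have [] := dz.
  apply: DeriveDef; first exact/diff_derivable/differentiable_entry.
  by rewrite -derive_entry// derive_val.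
rewrite !mxE; have [z|z|c ci ->] := @MVT_segment R (fun z => f z i j) (fun z => f' z i j) s t st.
- by rewrite in_itv/= => /andP[/ltW sz /ltW zt]; apply: di; rewrite sz.
- apply: derivable_within_continuous => {}z; rewrite in_itv/= => zi.
  by have [] := di z zi.
- rewrite normrM ler_wpM2r// (le_trans (norm_entry_le _ _ _))// f'M//.
  by move: ci; rewrite in_itv/= => /andP[sc ct]; rewrite (le_trans sa sc) (le_trans ct tb).
Qed.

End mean_value.

Lemma scaled_half_lt (R : realType) (a b : R) :
  0 < a -> 0 <= b -> a / (b + 1) / 2 * b < a.
Proof.
move=> a0 b0; have b1 : b + 1 != 0 by rewrite gt_eqF// ltr_wpDl.
rewrite -[ltRHS](_ : a / (b + 1) / 2 * (2 * (b + 1)) = a); last by field.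
by rewrite ltr_pM2l ?divr_gt0// ?ltr_wpDl//; lra.
Qed.

(** * Symmetry of mixed second derivatives *)

Section schwarz.
Context {R : realType} {V : normedModType R}.

(** The mean value theorem in the direction u turns the second difference into h times a difference
    of two values of D_u f, each of which is then replaced by its first-order expansion at x. *)
Let double_difference (f : V -> R) (U : set V) (x u v : V) (e : R) :
  open U -> U x -> (forall y, U y -> differentiable f y) ->
  differentiable ('D_u f) x -> 0 < e ->
  \forall h \near 0^'+, `|f (x + h *: v + h *: u) - f (x + h *: u)
     - f (x + h *: v) + f x - h ^+ 2 * 'D_v ('D_u f) x|
     <= e * (2 * `|u| + `|v|) * h ^+ 2.
Proof.
move=> oU Ux df ddf e0.
have /nbhs_ballP[d /= d0 dU] : \forall y \near x, U y /\
    `|'D_u f y - 'D_u f x - 'd ('D_u f) x (y - x)| <= e * `|y - x|.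
  near=> y; split; last by near: y; exact: diff_norm_le.
  by near: y; exact: open_nbhs_nbhs.
have c0 : 0 < 2 * `|u| + `|v| + 1 by rewrite ltr_wpDl// addr_ge0// mulr_ge0.
near=> h; have h0 : 0 < h by near: h; exact: nbhs_right_gt.
have hd : h * (2 * `|u| + `|v| + 1) < d.
  by rewrite -ltr_pdivlMr//; near: h; apply: nbhs_right_lt; exact: divr_gt0.
have small (s t : R) : 0 <= s <= h -> 0 <= t <= h -> U (x + t *: v + s *: u) /\
    `|'D_u f (x + t *: v + s *: u) - 'D_u f x - 'd ('D_u f) x (t *: v + s *: u)|
      <= e * (h * `|u| + t * `|v|).
  move=> /andP[s0 sh] /andP[t0 th].
  have le1 : `|t *: v + s *: u| <= h * `|u| + t * `|v|.
    rewrite (le_trans (ler_normD _ _))// !normrZ !ger0_norm// addrC.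
    by rewrite lerD// ler_wpM2r.
  have [|Uy +] := dU (x + t *: v + s *: u).
    rewrite -ball_normE/= -addrA opprD addNKr normrN.
    rewrite (le_lt_trans le1)// (le_lt_trans _ hd)// mulrDr mulr1 mulrDr.
    rewrite (@le_trans _ _ (h * (2 * `|u|) + h * `|v|)) ?lerDl ?(ltW h0)// lerD//.
      by rewrite ler_wpM2l ?(ltW h0)// ler_peMl// ler1n.
    by rewrite ler_wpM2r.
  rewrite (_ : x + _ + _ - x = t *: v + s *: u) => [le2|]; last first.
    by rewrite -(addrA x) [LHS]addrC addKr.
  by split=> //; rewrite (le_trans le2)// ler_wpM2l// ltW.
have dl (s t : R) : 0 <= s <= h -> 0 <= t <= h ->
    is_derive s 1 (fun s => f (x + t *: v + s *: u)) ('D_u f (x + t *: v + s *: u)).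
  by move=> sh th; apply: is_derive_line; apply: df; have [] := small s t sh th.
have h0h : 0 <= h <= h by rewrite (ltW h0) lexx.
have z0h : 0 <= (0 : R) <= h by rewrite (ltW h0) lexx.
pose g s := f (x + h *: v + s *: u) - f (x + 0 *: v + s *: u).
pose g' s := 'D_u f (x + h *: v + s *: u) - 'D_u f (x + 0 *: v + s *: u).
have dg s : 0 <= s <= h -> is_derive s 1 g (g' s).
  by move=> sh; apply: is_deriveB; exact: dl.
have [s|s|c ci] := @MVT_segment R g g' 0 h (ltW h0).
- by rewrite in_itv/= => /andP[/ltW s0 /ltW sh]; apply: dg; rewrite s0.
- apply: derivable_within_continuous => {}s; rewrite in_itv/= => sh.
  by have [] := dg s sh.
rewrite in_itv/= in ci; have [_ r1] := small c h ci h0h; have [_ r2] := small c 0 ci z0h.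
rewrite /g /g' subr0 !scale0r !addr0 => E.
have -> : f (x + h *: v + h *: u) - f (x + h *: u) - f (x + h *: v) + f x =
    ('D_u f (x + h *: v + c *: u) - 'D_u f (x + c *: u)) * h.
  by rewrite -E opprB addrA (addrAC _ (f x)).
move: r1 r2; rewrite !scale0r !addr0 add0r mul0r addr0 linearD => r1 r2.
have dv : 'd ('D_u f) x (h *: v) = h * 'D_v ('D_u f) x by rewrite linearZ deriveE.
rewrite (_ : _ - _ = h * (('D_u f (x + h *: v + c *: u) - 'D_u f x
    - ('d ('D_u f) x (h *: v) + 'd ('D_u f) x (c *: u)))
    - ('D_u f (x + c *: u) - 'D_u f x - 'd ('D_u f) x (c *: u)))); last first.
  by rewrite dv; ring.
rewrite normrM (gtr0_norm h0) expr2 mulrA [leRHS]mulrC ler_wpM2l ?(ltW h0)//.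
rewrite (le_trans (ler_normB _ _))// (le_trans (lerD r1 r2))//.
by rewrite -mulrDr -mulrA ler_wpM2l ?(ltW e0)// le_eqVlt; apply/orP; left; apply/eqP; ring.
Unshelve. all: by end_near. Qed.

(** The second difference is symmetric in u and v, so its two expansions bound h^2 |D_u D_v f - D_v
    D_u f| by 3 e (|u| + |v|) h^2 for every e > 0. *)
Lemma derive_comm_R (f : V -> R) (U : set V) (x u v : V) : open U -> U x ->
  Ck 2 U f -> 'D_u ('D_v f) x = 'D_v ('D_u f) x.
Proof.
move=> oU Ux [df Df]; apply/eqP; rewrite -subr_eq0 -normr_le0.
set c := `|u| + `|v|; have c0 : 0 <= 3 * c by rewrite mulr_ge0// addr_ge0.
rewrite leNgt; apply/negP => n0; set N := `|_| in n0.
(* Chosen so that 3 c e < N; the + 1 covers the case u = v = 0. *)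
pose e := N / (3 * c + 1) / 2.
have e0 : 0 < e by rewrite divr_gt0// divr_gt0// ltr_wpDl.
have d1 := double_difference v oU Ux df ((Df u).1 x Ux) e0.
have d2 := double_difference u oU Ux df ((Df v).1 x Ux) e0.
have [h [h0 E1 E2]] : exists h, [/\ 0 < h, `|f (x + h *: v + h *: u) - f (x + h *: u)
     - f (x + h *: v) + f x - h ^+ 2 * 'D_v ('D_u f) x|
     <= e * (2 * `|u| + `|v|) * h ^+ 2 & `|f (x + h *: u + h *: v) - f (x + h *: v)
     - f (x + h *: u) + f x - h ^+ 2 * 'D_u ('D_v f) x|
     <= e * (2 * `|v| + `|u|) * h ^+ 2].
  apply: (@filter_ex _ (0:R)^'+); near=> h; split; near: h => //.
  exact: nbhs_right_gt.
have h2 : 0 < h ^+ 2 by rewrite exprn_gt0.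
have := le_trans (ler_normB _ _) (lerD E1 E2).
have difference (p q r s a b k : R) :
  p - q - r + s - k * a - (p - r - q + s - k * b) = k * (b - a) by ring.
rewrite (addrAC x (h *: u)) difference.
rewrite normrM (gtr0_norm h2) -/N.
rewrite -mulrDl [leRHS]mulrC ler_pM2l// -mulrDr.
have -> : 2 * `|u| + `|v| + (2 * `|v| + `|u|) = 3 * c by rewrite /c; ring.
rewrite leNgt => /negP; apply.
exact: scaled_half_lt.
Unshelve. all: by end_near. Qed.

Lemma derive_comm m n (f : V -> 'M[R]_(m, n)) (U : set V) (x u v : V) :
  open U -> U x -> Ck 2 U f -> 'D_u ('D_v f) x = 'D_v ('D_u f) x.
Proof.
move=> oU Ux Cf; have [df Df] := Cf.
have E w z i j : 'D_w ('D_z f) x i j = 'D_w ('D_z (fun y => f y i j)) x.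
  rewrite derive_entry; last exact: (Df z).1.
  by apply: near_eq_derive; apply: open_near oU Ux _ => y Uy; rewrite derive_entry//; exact: df.
have C i j : Ck 2 U (fun y => f y i j) by exact: (@Ck_entry _ _ _ _ 2).
apply/matrixP => i j.
have := derive_comm_R u v oU Ux (C i j).
rewrite -(E u v i j).
rewrite -(E v u i j).
by [].
Qed.

End schwarz.

Section smooth_maps.
Context {R : realType} {V : normedModType R} (U : set V) (oU : open U).
Implicit Types W : normedModType R.

Lemma smooth_differentiable W (h : V -> W) x :
  smooth_on U h -> U x -> differentiable h x.
Proof. by move=> /(_ 1)[dh _] /dh. Qed.

Lemma smooth_continuous W (h : V -> W) x :
  smooth_on U h -> U x -> {for x, continuous h}.
Proof. by move=> /(_ 0) ch /ch. Qed.

Lemma smooth_derive W (h : V -> W) v : smooth_on U h -> smooth_on U ('D_v h).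
Proof. by move=> sh k; have [_] := sh k.+1; apply. Qed.

Lemma smooth_subset W (U' : set V) (h : V -> W) :
  U' `<=` U -> smooth_on U h -> smooth_on U' h.
Proof. by move=> UU' sh k; exact: Ck_subset (sh k). Qed.

Lemma smooth_eq W (h h' : V -> W) : {in U, h =1 h'} ->
  smooth_on U h -> smooth_on U h'.
Proof. by move=> hh' sh k; exact: Ck_eq (sh k). Qed.

Lemma smooth_cst W (a : W) : smooth_on U (cst a).
Proof. by move=> k; exact: Ck_cst. Qed.

Lemma smooth_linear W (L : {linear V -> W}) : continuous L -> smooth_on U L.
Proof. by move=> cL k; exact: Ck_linear. Qed.

Lemma smoothD W (f g : V -> W) : smooth_on U f -> smooth_on U g ->
  smooth_on U (fun x => f x + g x).
Proof. by move=> sf sg k; exact: Ck_add. Qed.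

Lemma smoothN W (f : V -> W) : smooth_on U f -> smooth_on U (fun x => - f x).
Proof. by move=> sf k; exact: Ck_opp. Qed.

Lemma smoothB W (f g : V -> W) : smooth_on U f -> smooth_on U g ->
  smooth_on U (fun x => f x - g x).
Proof. by move=> sf /smoothN; exact: smoothD. Qed.

Lemma smoothM (f g : V -> R) : smooth_on U f -> smooth_on U g ->
  smooth_on U (fun x => f x * g x).
Proof. by move=> sf sg k; exact: Ck_mul. Qed.

Lemma smooth_sum W n (f : 'I_n -> V -> W) : (forall i, smooth_on U (f i)) ->
  smooth_on U (fun x => \sum_(i < n) f i x).
Proof. by move=> sf k; apply: Ck_sum => // i; exact: sf. Qed.

Lemma smooth_entry m n (h : V -> 'M[R]_(m, n)) i j : smooth_on U h ->
  smooth_on U (fun x => h x i j).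
Proof. by move=> sh k; exact: Ck_entry. Qed.

Lemma smooth_mx m n (h : V -> 'M[R]_(m, n)) :
  (forall i j, smooth_on U (fun x => h x i j)) -> smooth_on U h.
Proof. by move=> sh k; apply: Ck_mx => // i j; exact: sh. Qed.

Lemma smooth_comp m n p (B : set 'rV[R]_n) (f : V -> 'rV[R]_n)
    (g : 'rV[R]_n -> 'M[R]_(m, p)) : open B -> (forall x, U x -> B (f x)) ->
  smooth_on U f -> smooth_on B g -> smooth_on U (g \o f).
Proof.
move=> oB UB sf sg; apply: smooth_mx => i j k.
apply: (@Ck_comp _ V n k U B f (fun y => g y i j)) => //.
exact: Ck_entry.
Qed.

Lemma smooth_comp_scalar n (B : set 'rV[R]_n) (f : V -> 'rV[R]_n)
    (g : 'rV[R]_n -> R) : (forall x, U x -> B (f x)) ->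
  smooth_on U f -> smooth_on B g -> smooth_on U (g \o f).
Proof. by move=> UB sf sg k; exact: Ck_comp (sf k) (sg k). Qed.

Lemma smooth_comp_curve m p (B : set R) (f : V -> R) (g : R -> 'M[R]_(m, p)) :
  open B -> (forall x, U x -> B (f x)) ->
  smooth_on U f -> smooth_on B g -> smooth_on U (g \o f).
Proof.
move=> oB UB sf sg; apply: smooth_mx => i j k.
apply: (@Ck_comp_R _ V k U B f (fun y => g y i j)) => //.
exact: Ck_entry.
Qed.

Lemma smoothV (f : V -> R) : (forall x, U x -> f x != 0) -> smooth_on U f ->
  smooth_on U (fun x => (f x)^-1).
Proof. by move=> f0 sf k; exact: Ck_inv. Qed.

Lemma smooth_sqrt (f : V -> R) : (forall x, U x -> 0 < f x) -> smooth_on U f ->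
  smooth_on U (fun x => Num.sqrt (f x)).
Proof. by move=> f0 sf k; exact: Ck_sqrt. Qed.

Lemma smoothZ m n (f : V -> R) (g : V -> 'M[R]_(m, n)) : smooth_on U f ->
  smooth_on U g -> smooth_on U (fun x => f x *: g x).
Proof.
move=> sf sg; apply: smooth_mx => i j.
apply: smooth_eq (smoothM sf (smooth_entry i j sg)).
by move=> x _; rewrite mxE.
Qed.

Lemma smooth_mulmx m n p (A : V -> 'M[R]_(m, n)) (B : V -> 'M[R]_(n, p)) :
  smooth_on U A -> smooth_on U B -> smooth_on U (fun x => A x *m B x).
Proof.
move=> sA sB; apply: smooth_mx => i j.
apply: smooth_eq (smooth_sum (fun l => smoothM (smooth_entry i l sA) (smooth_entry l j sB))).
by move=> x _; rewrite mxE.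
Qed.

Lemma smooth_trmx m n (A : V -> 'M[R]_(m, n)) :
  smooth_on U A -> smooth_on U (fun x => (A x)^T).
Proof.
move=> sA; apply: smooth_mx => i j; apply: smooth_eq (smooth_entry j i sA).
by move=> x _; rewrite mxE.
Qed.

Lemma smooth_minor m n (A : V -> 'M[R]_(m, n)) i j : smooth_on U A ->
  smooth_on U (fun x => row' i (col' j (A x))).
Proof.
move=> sA; apply: smooth_mx => k l.
apply: smooth_eq (smooth_entry (lift i k) (lift j l) sA).
by move=> x _; rewrite !mxE.
Qed.

(** Expansion along the first row reduces to minors, by induction on the size; through the adjugate
    this also gives the smoothness of the inverse matrix. *)
Lemma smooth_det n (A : V -> 'M[R]_n) : smooth_on U A ->
  smooth_on U (fun x => \det (A x)).
Proof.
elim: n A => [|n IH] A sA.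
  by apply: smooth_eq (smooth_cst (1 : R)) => x _; rewrite det_mx00.
have sC j : smooth_on U (fun x => A x ord0 j * cofactor (A x) ord0 j).
  apply: smoothM; first exact: smooth_entry.
  by apply: (smoothM (smooth_cst _)); apply: IH; exact: smooth_minor.
apply: smooth_eq (smooth_sum sC) => x _.
by rewrite (expand_det_row _ ord0).
Qed.

Lemma smooth_invmx n (A : V -> 'M[R]_n) : (forall x, U x -> A x \in unitmx) ->
  smooth_on U A -> smooth_on U (fun x => invmx (A x)).
Proof.
move=> uA sA.
have sadj : smooth_on U (fun x => \adj (A x)).
  apply: smooth_mx => i j.
  apply: smooth_eq (smoothM (smooth_cst ((-1) ^+ (j + i) : R))
    (smooth_det (smooth_minor j i sA))).
  by move=> x _; rewrite mxE.
apply: smooth_eq (smoothZ (smoothV _ (smooth_det sA)) sadj).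
  by move=> x; rewrite inE => Ux; rewrite /invmx uA.
by move=> x Ux; rewrite -unitfE -unitmxE uA.
Qed.

End smooth_maps.

(** * Linear differential equations and flat systems *)

Section one_variable.
Context {R : realType}.

Lemma is_derive_mx (V : normedModType R) m n (h : V -> 'M[R]_(m, n)) x v
    (d : 'M[R]_(m, n)) :
  (forall i j, is_derive x v (fun y => h y i j) (d i j)) -> is_derive x v h d.
Proof.
move=> dh; have dv : derivable h x v.
  by apply/derivable_mxP => i j; have [] := dh i j.
apply: DeriveDef => //; rewrite derive_mx//; apply/matrixP => i j; rewrite mxE.
by have [_ ->] := dh i j.
Qed.

Lemma is_derive_entry (V : normedModType R) m n (h : V -> 'M[R]_(m, n)) x v
    (d : 'M[R]_(m, n)) i j :
  is_derive x v h d -> is_derive x v (fun y => h y i j) (d i j).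
Proof.
move=> [dh <-]; apply: DeriveDef; first by move/derivable_mxP: dh.
by rewrite derive_mx// mxE.
Qed.

Lemma is_derive_mulmx (V : normedModType R) m n p (A : V -> 'M[R]_(m, n))
    (B : V -> 'M[R]_(n, p)) x v A' B' :
  is_derive x v A A' -> is_derive x v B B' ->
  is_derive x v (fun y => A y *m B y) (A' *m B x + A x *m B').
Proof.
move=> dA dB; apply: is_derive_mx => i j.
have -> : (fun y => (A y *m B y) i j) = \sum_k ((fun y => A y i k) * (fun y => B y k j)).
  by apply/funext => y; rewrite mxE fct_sumE.
have -> : (A' *m B x + A x *m B') i j =
    \sum_k (A x i k *: B' k j + B x k j *: A' i k).
  rewrite !mxE -big_split/=; apply: eq_bigr => k _.
  by rewrite addrC; congr (_ + _); rewrite mulrC.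
apply: is_derive_sum => k; apply: is_deriveM; exact: is_derive_entry.
Qed.

Lemma is_derive_norm (W : normedModType R) (f : R -> W) (x : R) (d : W) :
  (forall e, 0 < e -> \forall y \near x, `|f y - f x - (y - x) *: d| <= e * `|y - x|) ->
  is_derive x 1 f d.
Proof.
move=> fd.
have fx : (fun h => h^-1 *: (f (h *: 1 + x) - f x)) @ 0^' --> d.
  apply/cvgrPdist_le => e e0.
  have := fd e e0; rewrite (near_shift 0)/= subr0 => {}fd.
  near=> h; have h0 : h != 0 by near: h; exact: nbhs_dnbhs_neq.
  rewrite [h *: 1]mulr1 -[X in X - _](scalerK h0) -scalerBr normrZ normfV.
  rewrite ler_pdivrMl ?normr_gt0// distrC mulrC.
  have : `|(h + x - x)| = `|h| by rewrite addrK.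
  move=> <-; rewrite -[X in _ - X *: _](addrK x h).
  by near: h; apply: nbhs_dnbhs; exact: fd.
apply: DeriveDef; first by apply/cvg_ex; exists d.
exact: cvg_lim fx.
Unshelve. all: by end_near. Qed.

Lemma mean_value_norm0 n (f f' : R -> 'rV[R]_n) (x M : R) : 0 <= M ->
  (forall t : R, `|t| <= `|x| -> is_derive t 1 f (f' t)) ->
  (forall t : R, `|t| <= `|x| -> `|f' t| <= M) -> `|f x - f 0| <= M * `|x|.
Proof.
move=> M0 df f'M; rewrite -[in leRHS](subr0 x).
apply: (@mean_value_norm _ _ f f' (- `|x|) `|x|) => //.
- by move=> t; rewrite -ler_norml; exact: df.
- by move=> t; rewrite -ler_norml; exact: f'M.
- by rewrite -ler_norml normr0.
- by rewrite -ler_norml.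
Qed.

Lemma zero_derive0 n (f : R -> 'rV[R]_n) (x : R) :
  (forall t : R, `|t| <= `|x| -> is_derive t 1 f 0) -> f x = f 0.
Proof.
move=> df; apply/subr0_eq/eqP; rewrite -normr_le0 -[leRHS](mul0r `|x|).
by apply: (@mean_value_norm0 _ f (fun=> 0)) => // ? _; rewrite normr0.
Qed.

(** Starting the integral at - K makes every x with |x| < K, negative ones included, an interior
    upper endpoint, as the fundamental theorem of calculus requires; the value at 0 is subtracted
    afterwards. *)
Let local_primitive (f : R -> R) (K : R) : continuous f ->
  exists2 F : R -> R, F 0 = 0 & forall x : R, `|x| < K -> is_derive x 1 F (f x).
Proof.
move=> cf; pose F x := \int[lebesgue_measure]_(t in `[- K, x]) f t.
exists (fun x => F x - F 0); first by rewrite subrr.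
move=> x xK; have [Kx xK'] : - K < x /\ x < K by apply/andP; rewrite -ltr_norml.
have fi : lebesgue_measure.-integrable `[- K, K] (EFin \o f).
  apply: continuous_compact_integrable; first exact: segment_compact.
  exact: continuous_subspaceT.
have [dF EF] := continuous_FTC1_closed xK' fi Kx (cf x).
rewrite -[f x]subr0; apply: is_deriveB.
by apply: DeriveDef => //; rewrite -derive1E.
Qed.

Lemma exists_primitive n (f : R -> 'rV[R]_n) : continuous f ->
  exists F : R -> 'rV[R]_n, F 0 = 0 /\ forall x : R, is_derive x 1 F (f x).
Proof.
move=> cf.
have cfi i : continuous (fun x => f x 0 i).
  move=> x; apply: (@continuous_comp _ _ _ f (fun A : 'rV[R]_n => A 0 i)).
    exact: cf.
  exact: coord_continuous.
have /choice[G HG] : forall K : R, exists F : R -> 'rV[R]_n,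
    F 0 = 0 /\ forall x : R, `|x| < K -> is_derive x 1 F (f x).
  move=> K; pose G i := sval (cid2 (local_primitive K (cfi i))).
  exists (fun x => \row_i G i x); split.
    by apply/rowP => i; rewrite !mxE /G; case: cid2.
  move=> x xK; apply: is_derive_mx => i j.
  rewrite (_ : (fun y => _) = G j) ?ord1; last by apply/funext => y; rewrite mxE.
  by rewrite /G; case: cid2 => //= F _; apply.
(* Gluing: the bound |x| + 1 varies with x, but two primitives that vanish at 0 agree wherever both
   are valid, so near x this is the single function [G (|x| + 2)]. *)
exists (fun x => G (`|x| + 1) x); split; first by have [] := HG (`|(0:R)| + 1).
move=> x; have [_ dGx] := HG (`|x| + 2).
apply: (@near_eq_is_derive _ _ _ (G (`|x| + 2))); last first.
  by apply: dGx; rewrite ltrDl.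
near=> y; have [G0 dG] := HG (`|y| + 1); have [Gx0 _] := HG (`|x| + 2).
have yx : `|y| <= `|x| + 1.
  by rewrite -lerBlDl (le_trans (lerB_dist _ _)).

pose D z := G (`|x| + 2) z - G (`|y| + 1) z.
have : D y = D 0.
  apply: zero_derive0 => t ty; rewrite -(subrr (f t)); apply: is_deriveB.
    by apply: dGx; rewrite (le_lt_trans ty)// (le_lt_trans yx)// ltrD2l ltr1n.
  by apply: dG; rewrite (le_lt_trans ty)// ltrDl.
by rewrite /D Gx0 G0 subrr => /subr0_eq.
Unshelve. all: by end_near. Qed.

(** A total choice, so that it can be applied at every stage of an iteration. It is the zero map
    when [f] has no primitive. *)
Definition primitive n (f : R -> 'rV[R]_n) : R -> 'rV[R]_n :=
  xget (cst 0) [set F | F 0 = 0 /\ forall x : R, is_derive x 1 F (f x)].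

Lemma primitiveP n (f : R -> 'rV[R]_n) : continuous f ->
  primitive f 0 = 0 /\ forall x : R, is_derive x 1 (primitive f) (f x).
Proof.
by move=> /exists_primitive[F FP]; rewrite /primitive; case: xgetP => [G _ //|/(_ F)/(_ FP)].
Qed.

Lemma primitive0 n (f : R -> 'rV[R]_n) : continuous f -> primitive f 0 = 0.
Proof. by move=> /primitiveP[]. Qed.

Lemma is_derive_primitive n (f : R -> 'rV[R]_n) (x : R) : continuous f ->
  is_derive x 1 (primitive f) (f x).
Proof. by move=> /primitiveP[]. Qed.

Lemma primitive_dist n (f g : R -> 'rV[R]_n) (x e : R) : continuous f ->
  continuous g -> 0 <= e -> (forall t : R, `|t| <= `|x| -> `|f t - g t| <= e) ->
  `|primitive f x - primitive g x| <= e * `|x|.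
Proof.
move=> cf cg e0 fg; have := @mean_value_norm0 _ (fun t => primitive f t - primitive g t)
  (fun t => f t - g t) x e e0.
rewrite !primitive0// !subr0; apply => // t _.
by apply: is_deriveB; exact: is_derive_primitive.
Qed.

Lemma primitive_norm n (f : R -> 'rV[R]_n) (x e : R) : continuous f ->
  0 <= e -> (forall t : R, `|t| <= `|x| -> `|f t| <= e) -> `|primitive f x| <= e * `|x|.
Proof.
move=> cf e0 fe; have := @mean_value_norm0 _ (primitive f) f x e e0.
by rewrite primitive0// subr0; apply => // t _; exact: is_derive_primitive.
Qed.

End one_variable.

Section parameters.
Context {R : realType} {T : topologicalType}.
Implicit Types W : normedModType R.

Lemma uncurried_continuous_r W (f : T -> R -> W) t :
  continuous (fun z : T * R => f z.1 z.2) -> continuous (f t).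
Proof.
move=> cf y; apply: (@continuous_comp _ _ _ (fun y : R => (t, y)) (fun z => f z.1 z.2)).
  apply: (@cvg_pair _ _ _ (nbhs y) (nbhs t) (nbhs y) _ _ _ (fun=> t) id).
    exact: cvg_cst.
  exact: cvg_id.
exact: cf.
Qed.

(** Compactness of [- r, r] makes the continuity at [t0] uniform in y, as in the tube lemma; this is
    what lets limits in the parameter pass under primitives. *)
Lemma tube_uniform W (f : T -> R -> W) (t0 : T) (r e : R) : 0 < e ->
  continuous (fun z : T * R => f z.1 z.2) ->
  \forall t \near t0, forall y, `|y| <= r -> `|f t y - f t0 y| <= e.
Proof.
move=> e0 cf; have e2 : 0 < e / 2 by rewrite divr_gt0.
have /compact_near_coveringP := @segment_compact R (- r) r.
move=> /(_ T (nbhs t0) (fun t y => `|f t y - f t0 y| <= e) _) H.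
have {}H := H _; apply: filterS (H _) => [t tP y yr|y _].
  by apply: tP; rewrite /= in_itv/= -ler_norml.
have /cvgrPdist_le/(_ _ e2)[[A B] /= [At By] AB] := cf (t0, y).
exists (B, A); first by split.
move=> [y' t] /= [By' At'].
have h1 := AB (t, y') (conj At' By').
have h2 := AB (t0, y') (conj (nbhs_singleton At) By').
rewrite -(subrKA (f t0 y)) (splitr e) (le_trans (ler_normD _ _))// lerD//.
by rewrite distrC.
Qed.

Lemma primitive_param_continuous n (f : T -> R -> 'rV[R]_n) :
  continuous (fun z : T * R => f z.1 z.2) ->
  continuous (fun z : T * R => primitive (f z.1) z.2).
Proof.
move=> cf [t0 y0]; apply/cvgrPdist_le => e e0 /=.
have cft t := @uncurried_continuous_r _ f t cf.
have r0 : 0 < `|y0| + 1 by rewrite ltr_wpDl.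
pose e1 := e / 2 / (`|y0| + 1); have e10 : 0 < e1 by rewrite !divr_gt0.
near=> z.
have y1 : `|z.2| <= `|y0| + 1.
  rewrite -lerBlDl (le_trans (lerB_dist _ _))// distrC.
  near: z; apply: (@cvgr_dist_le _ _ _ _ _ (fun z : T * R => z.2) y0) => //.
  exact: cvg_snd.
rewrite -(subrKA (primitive (f t0) z.2)) (splitr e) (le_trans (ler_normD _ _))//.
rewrite lerD//.
  near: z; apply: (@cvgr_dist_le _ _ _ _ _ (fun z : T * R => primitive (f t0) z.2) (primitive (f t0) y0)) => //; last by rewrite divr_gt0.
  apply: (@continuous_comp _ _ _ snd (primitive (f t0)) (t0, y0)); first exact: cvg_snd.
  apply/differentiable_continuous/derivable1_diffP.
  by have [] := @is_derive_primitive _ _ _ y0 (cft t0).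
rewrite distrC (@le_trans _ _ (e1 * `|z.2|))//; last first.
  rewrite (@le_trans _ _ (e1 * (`|y0| + 1)))// ?ler_wpM2l ?(ltW e10)//.
  by rewrite /e1 divfK// gt_eqF.
apply: primitive_dist => //; first exact: ltW.
move=> t tz; have : `|t| <= `|y0| + 1 by exact: le_trans tz y1.
move: t {tz}; near: z.
exact: (@cvg_fst _ _ (nbhs t0) (nbhs y0) _ _ (tube_uniform t0 (`|y0| + 1) e10 cf)).
Unshelve. all: by end_near. Qed.

End parameters.

Section clamp.
Context {R : realType}.

(** For r >= 0, the nearest point of [- r, r]; the form with absolute values makes continuity
    immediate. *)
Definition clamp (r y : R) : R := (`|y + r| - `|y - r|) / 2.

Lemma clamp_id r y : `|y| <= r -> clamp r y = y.
Proof.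
rewrite ler_norml /clamp => /andP[h1 h2].
have ry : 0 <= y + r by rewrite -lerBlDr sub0r.
by rewrite ger0_norm// ler0_norm ?subr_le0//; field.
Qed.

Lemma clamp_norm r y : 0 <= r -> `|clamp r y| <= r.
Proof.
move=> r0; rewrite /clamp normrM [`|2^-1|]ger0_norm// ler_pdivrMr//.
rewrite (le_trans (ler_dist_dist _ _))// (_ : _ - _ = r * 2); last by ring.
by rewrite ger0_norm// mulr_ge0.
Qed.

Lemma clamp_continuous r : continuous (clamp r).
Proof.
move=> y; apply: cvgMl; apply: cvgB; apply: cvg_norm; apply: cvgD.
- exact: cvg_id.
- exact: cvg_cst.
- exact: cvg_id.
- exact: cvg_cst.
Qed.

End clamp.

Lemma lt_half_pow (R : realType) (B e : R) : 0 < e -> exists k, B / 2 ^+ k < e.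
Proof.
move=> e0; exists (Num.truncn (B / e)).+1; rewrite ltr_pdivrMr ?exprn_gt0//.
rewrite -ltr_pdivrMl// mulrC (lt_le_trans (truncnS_gt _))//.
by rewrite -natrX ler_nat ltnW// ltn_expl.
Qed.

(** The distances form a geometric series with tail B / 2 ^ k, so the sequence is Cauchy. The
    explicit tail is kept because it is what later makes a pointwise limit of functions uniform. *)
Lemma geometric_limit (R : realType) n (u : nat -> 'rV[R]_n) (B : R) :
  (forall k, `|u k.+1 - u k| <= B / 2 ^+ k.+1) ->
  exists l, forall k, `|l - u k| <= B / 2 ^+ k.
Proof.
move=> uB.
have B0 : 0 <= B.
  have := le_trans (normr_ge0 _) (uB 0%N).
  by rewrite pmulr_lge0 // invr_gt0 exprn_gt0.
have tail k m : `|u (k + m)%N - u k| <= B / 2 ^+ k * (1 - (2 ^+ m)^-1).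
  elim: m => [|m IH]; first by rewrite addn0 subrr normr0 expr0 invr1 subrr mulr0.
  rewrite addnS -(subrKA (u (k + m)%N)) (le_trans (ler_normD _ _))//.
  rewrite (le_trans (lerD (uB _) IH))// le_eqVlt; apply/orP; left; apply/eqP.
  rewrite -addnS exprD exprS.
  have k2 : (2 ^+ k : R) != 0 by rewrite expf_neq0.
  have m2 : (2 ^+ m : R) != 0 by rewrite expf_neq0.
  by field; rewrite k2 m2.
have tail' k m : (k <= m)%N -> `|u m - u k| <= B / 2 ^+ k.
  move=> km; rewrite -(subnKC km) (le_trans (tail _ _))//.
  rewrite ler_piMr ?divr_ge0 ?exprn_ge0// gerBl invr_ge0 exprn_ge0//.
have uc : cvgn u.
  apply/cauchy_cvgP/cauchyP => e e0; have [k ke] := lt_half_pow B e0.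
  exists (u k); suff : \forall m \near \oo, ball (u k) e (u m) by [].
  near=> m; rewrite -ball_normE/= distrC (le_lt_trans _ ke)//.
  by apply: tail'; near: m; exact: nbhs_infty_ge.
exists (lim (u @ \oo)) => k.
apply: (@cvgr_to_le nat \oo _ R (fun m => `|u m - u k|)).
  by apply: cvg_norm; apply: cvgB => //; exact: cvg_cst.
by near=> m; apply: tail'; near: m; exact: nbhs_infty_ge.
Unshelve. all: by end_near. Qed.

Lemma mulmx_continuous_at (R : realType) m n p (T : topologicalType)
    (P : T -> 'M[R]_(m, n)) (W : T -> 'M[R]_(n, p)) z :
  {for z, continuous P} -> {for z, continuous W} ->
  {for z, continuous (fun z => P z *m W z)}.
Proof.
move=> cP cW; apply/cvgrPdist_le => e e0; near=> z'.
apply: norm_mx_le => [|i j]; first exact: ltW.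
rewrite !mxE; move: i j; near: z'.
apply: filter_forall => i; apply: filter_forall => j.
have : (\sum_k P z' i k * W z' k j) @[z' --> z] --> (\sum_k P z i k * W z k j).
  apply: cvg_big => [|k _].
    exact: add_continuous.
  apply: cvgM.
    apply: (@continuous_comp _ _ _ P (fun A : 'M[R]_(m, n) => A i k)); first exact: cP.
    exact: coord_continuous.
  apply: (@continuous_comp _ _ _ W (fun A : 'M[R]_(n, p) => A k j)); first exact: cW.
  exact: coord_continuous.
by move=> /cvgrPdist_le/(_ e e0).
Unshelve. all: by end_near. Qed.

Lemma mulmx_continuous (R : realType) m n p (T : topologicalType)
    (P : T -> 'M[R]_(m, n)) (W : T -> 'M[R]_(n, p)) :
  continuous P -> continuous W -> continuous (fun z => P z *m W z).
Proof. by move=> cP cW z; apply: mulmx_continuous_at; [exact: cP|exact: cW]. Qed.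

(** * Linear ordinary differential equations with a parameter *)

Section linear_system.
Context {R : realType} {N : nat}.
Variables (C r : R).
Hypotheses (C0 : 0 <= C) (r0 : 0 < r) (Cr : C * r <= 1 / 2).

(* Picard iteration; clamping the upper bound to [-r, r] makes every iterate
   globally defined and bounded. *)
Lemma linear_ode_param (T : topologicalType) (w : T -> R -> 'M[R]_N)
    (q : T -> 'rV[R]_N) (B : R) :
  continuous (fun z : T * R => w z.1 z.2) -> continuous q ->
  (forall t, `|q t| <= B) ->
  (forall t y (v : 'rV[R]_N), `|v *m w t y| <= C * `|v|) ->
  exists P : T -> R -> 'rV[R]_N,
    [/\ continuous (fun z : T * R => P z.1 z.2), forall t, P t 0 = q t,
        forall t y, `|P t y| <= 2 * B &
        forall t (y : R), `|y| < r -> is_derive y 1 (P t) (P t y *m w t y)].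
Proof.
move=> cw cq qB wC.
pose step (P : T -> R -> 'rV[R]_N) t y :=
  q t + primitive (fun s => P t s *m w t s) (clamp r y).
pose P k := iter k step (fun t _ => q t).
have cstep (Q : T -> R -> 'rV[R]_N) : continuous (fun z : T * R => Q z.1 z.2) ->
    continuous (fun z : T * R => step Q z.1 z.2).
  move=> cQ [t y]; apply: cvgD.
    apply: (@continuous_comp _ _ _ fst q); first exact: cvg_fst.
    exact: cq.
  have cz : {for (t, y), continuous (fun z : T * R => (z.1, clamp r z.2))}.
    apply: (@cvg_pair _ _ _ (nbhs (t, y)) (nbhs t) (nbhs (clamp r y)) _ _ _ fst (clamp r \o snd)).
      exact: cvg_fst.
    apply: (@continuous_comp _ _ _ snd (clamp r) (t, y)); first exact: cvg_snd.
    exact: clamp_continuous.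
  apply: (@continuous_comp _ _ _ _ (fun z : T * R => primitive (fun s => Q z.1 s *m w z.1 s) z.2) (t, y) cz).
  apply: (@primitive_param_continuous _ _ _ (fun t s => Q t s *m w t s)).
  exact: mulmx_continuous.
have cP k : continuous (fun z : T * R => P k z.1 z.2).
  elim: k => [|k IH]; last exact: cstep.
  move=> [t y]; apply: (@continuous_comp _ _ _ fst q); first exact: cvg_fst.
  exact: cq.
have cPw (Q : T -> R -> 'rV[R]_N) t : continuous (fun z : T * R => Q z.1 z.2) ->
    continuous (fun s => Q t s *m w t s).
  by move=> cQ; apply: mulmx_continuous; [exact: (@uncurried_continuous_r _ _ _ Q t cQ)|exact: (@uncurried_continuous_r _ _ _ w t cw)].
have B0 (t : T) : 0 <= B by exact: le_trans (normr_ge0 _) (qB t).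
(* As |clamp r y| <= r, the primitive of a difference bounded by C e is at most C r e <= e / 2: the
   clamped step is a contraction on the whole line. *)
have contract (Q Q' : T -> R -> 'rV[R]_N) t y e : continuous (fun z : T * R => Q z.1 z.2) ->
    continuous (fun z : T * R => Q' z.1 z.2) -> 0 <= e ->
    (forall s, `|Q t s - Q' t s| <= e) -> `|step Q t y - step Q' t y| <= e / 2.
  move=> cQ cQ' e0 QQ'; rewrite /step opprD addrACA subrr add0r.
  have Ce0 : 0 <= C * e by rewrite mulr_ge0.
  rewrite (le_trans (primitive_dist (cPw _ _ cQ) (cPw _ _ cQ') Ce0 _))//.
    by move=> s _; rewrite -mulmxBl (le_trans (wC _ _ _))// ler_wpM2l.
  rewrite mulrAC [leRHS]mulrC -div1r ler_wpM2r// (le_trans _ Cr)// ler_wpM2l//.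
  exact/clamp_norm/ltW.
have Pstep t y k : `|P k.+1 t y - P k t y| <= B / 2 ^+ k.+1.
  elim: k t y => [|k IH] t y.
    rewrite /= {1}/step addrAC subrr add0r expr1.
    have CB0 : 0 <= C * B by rewrite mulr_ge0// (B0 t).
    rewrite (le_trans (primitive_norm (cPw _ _ (cP 0%N)) CB0 _))//.
      by move=> s _; rewrite (le_trans (wC _ _ _))// ler_wpM2l//; exact: qB.
    rewrite mulrAC [leRHS]mulrC -div1r ler_wpM2r ?(B0 t)// (le_trans _ Cr)// ler_wpM2l//.
    exact/clamp_norm/ltW.
  rewrite [in leRHS]exprSr invfM mulrA.
  apply: contract; [exact: (cP k.+1)|exact: (cP k)| |by move=> s; exact: IH].
  by rewrite divr_ge0 ?exprn_ge0// (B0 t).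
have /choice[L HL] (z : T * R) : exists l, forall k, `|l - P k z.1 z.2| <= B / 2 ^+ k.
  by apply: geometric_limit => k; exact: Pstep.
pose Q t y := L (t, y).
have QP t y k : `|Q t y - P k t y| <= B / 2 ^+ k by exact: HL.
have cQ : continuous (fun z : T * R => Q z.1 z.2).
  move=> z; apply/cvgrPdist_le => e e0.
  have e3 : 0 < e / 3 by rewrite divr_gt0.
  have [k ke] := lt_half_pow B e3.
  have /cvgrPdist_le/(_ _ e3) := cP k z; apply: filterS => z' Pz'.
  rewrite -(subrKA (P k z.1 z.2)) -[X in _ + X](subrKA (P k z'.1 z'.2)).
  rewrite (le_trans (ler_normD _ _))// (_ : e = e / 3 + (e / 3 + e / 3)); last by field.
  rewrite lerD//; first exact: le_trans (QP _ _ k) (ltW ke).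
  rewrite (le_trans (ler_normD _ _))// lerD//.
  by rewrite distrC; exact: le_trans (QP _ _ k) (ltW ke).
(* [Q] is within B / 2 ^ k.+1 of the iterate [P k.+1], which by contraction is within half of B / 2
   ^ k of [step Q]; together this is B / 2 ^ k, for every k. *)
have fixQ t y : Q t y = step Q t y.
  apply/subr0_eq/eqP; rewrite -normr_le0 leNgt; apply/negP => n0.
  have [k] := lt_half_pow B n0; rewrite ltNge => /negP; apply.
  rewrite -(subrKA (P k.+1 t y)) (le_trans (ler_normD _ _))//.
  rewrite (_ : B / 2 ^+ k = B / 2 ^+ k.+1 + B / 2 ^+ k / 2); last first.
    by rewrite exprSr; field; rewrite expf_neq0.
  rewrite lerD// distrC.
  apply: contract; [exact: cQ|exact: (cP k)| |by move=> s; exact: QP].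
  by rewrite divr_ge0 ?exprn_ge0// (B0 t).
exists Q; split=> // [t|t y|t y yr].
- rewrite fixQ /step clamp_id ?normr0 ?(ltW r0)// primitive0 ?addr0//.
  exact: cPw.
- rewrite -(subrK (P 0%N t y) (Q t y)) (le_trans (ler_normD _ _))// mulrDl !mul1r.
  by rewrite lerD//= (le_trans (QP _ _ 0%N))// expr0 divr1.
- apply: (@near_eq_is_derive _ _ _ (fun y => q t + primitive (fun s => Q t s *m w t s) y)).
    near=> z; rewrite fixQ /step clamp_id//; near: z.
    apply: (@cvgr_le R _ _ _ (fun z : R => `|z|) `|y|) => //.
    by apply: cvg_norm; exact: cvg_id.
  rewrite -[X in is_derive _ _ _ X]add0r; apply: is_deriveD.
  by apply: is_derive_primitive; exact: cPw.
Unshelve. all: by end_near. Qed.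

End linear_system.

(** * Flat total systems in two variables *)

Section flat_system.
Context {R : realType}.

Lemma is_derive_translate (W : normedModType R) (f : R -> W) (c s : R) d :
  is_derive (c + s) 1 f d -> is_derive s 1 (fun s => f (c + s)) d.
Proof.
move=> [df <-].
have E : (fun h : R => h^-1 *: (((fun s => f (c + s)) \o shift s) (h *: 1) - f (c + s)))
    = (fun h : R => h^-1 *: ((f \o shift (c + s)) (h *: 1) - f (c + s))).
  by apply/funext => h /=; rewrite addrCA.
by apply: DeriveDef; [rewrite /derivable E|rewrite /derive E].
Qed.

Lemma is_derive_scale (W : normedModType R) (v : W) (s : R) :
  is_derive s 1 (fun s : R => s *: v) v.
Proof.
have := @is_derive_line _ _ _ (@id W) 0 v s _; rewrite derive_id.
rewrite (_ : (fun s => id (0 + s *: v)) = fun s => s *: v); first by apply.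
by apply/funext => t; rewrite add0r.
Qed.

(** Differentiation under the integral sign by two mean value estimates: one in y for fixed t, where
    [g y] is uniformly close to [g y0], and one in t for the remainder. *)
Lemma primitive_param_derive n (f g : R -> R -> 'rV[R]_n) (r x y0 : R) :
  continuous (fun z : R * R => f z.1 z.2) ->
  continuous (fun z : R * R => g z.1 z.2) ->
  (forall y t : R, `|y| < r -> `|t| < r -> is_derive y 1 (f ^~ t) (g y t)) ->
  `|x| < r -> `|y0| < r ->
  is_derive y0 1 (fun y => primitive (f y) x) (primitive (g y0) x).
Proof.
move=> cf cg dfg xr yr; apply: is_derive_norm => e e0.
pose e1 := e / (`|x| + 1).
have x1 : 0 < `|x| + 1 by rewrite ltr_wpDl.
have e10 : 0 < e1 by rewrite divr_gt0.
have cft t := @uncurried_continuous_r _ _ _ f t cf.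
have cgt t := @uncurried_continuous_r _ _ _ g t cg.
have [d d0 dP] : exists2 d, 0 < d & forall y, `|y - y0| < d ->
    `|y| < r /\ forall t, `|t| <= `|x| -> `|g y t - g y0 t| <= e1.
  have : \forall y \near y0, `|y| < r /\ forall t, `|t| <= `|x| -> `|g y t - g y0 t| <= e1.
    near=> y; split; last by near: y; exact: (tube_uniform y0 `|x| e10 cg).
    near: y; apply: (@cvgr_lt R _ _ _ (fun z : R => `|z|) `|y0|) => //.
    by apply: cvg_norm; exact: cvg_id.
  move=> /nbhs_ballP[d /= d0 dP]; exists d => // y yd; apply: dP.
  by rewrite -ball_normE/= distrC.
near=> y.
have yd : `|y - y0| < d by rewrite distrC; near: y; apply: cvgr_dist_lt => //; exact: cvg_id.
have taylor t : `|t| <= `|x| -> `|f y t - f y0 t - (y - y0) *: g y0 t| <= e1 * `|y - y0|.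
  move=> tx; have tr := le_lt_trans tx xr.
  have := @mean_value_norm0 _ _ (fun s => f (y0 + s) t - s *: g y0 t)
    (fun s => g (y0 + s) t - g y0 t) (y - y0) e1 (ltW e10).
  rewrite addr0 scale0r subr0 subrKC addrAC; apply => s sy.
    have sd : `|y0 + s - y0| < d by rewrite addrAC subrr add0r (le_lt_trans sy).
    apply: is_deriveB; last exact: is_derive_scale.
    exact: (@is_derive_translate _ (f ^~ t) y0 s _ (dfg _ _ (dP _ sd).1 tr)).
  have sd : `|y0 + s - y0| < d by rewrite addrAC subrr add0r (le_lt_trans sy).
  by have [_] := dP _ sd; apply.
have Bnd : 0 <= e1 * `|y - y0| by rewrite mulr_ge0// ltW.
have := @mean_value_norm0 _ _ (fun t => primitive (f y) t - primitive (f y0) t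
   - (y - y0) *: primitive (g y0) t)
  (fun t => f y t - f y0 t - (y - y0) *: g y0 t) x _ Bnd.
rewrite !primitive0// scaler0 !subr0 => H.
apply: le_trans (H _ taylor) _.
  move=> t _; apply: is_deriveB.
    by apply: is_deriveB; exact: is_derive_primitive.
  by apply: is_deriveZ; exact: is_derive_primitive.
rewrite mulrAC ler_wpM2r// /e1 mulrAC ler_pdivrMr// ler_wpM2l ?(ltW e0)//.
by rewrite lerDl.
Unshelve. all: by end_near. Qed.

Variables (N : nat) (C r : R) (w1 w2 w : R -> R -> 'M[R]_N).
Hypotheses (C0 : 0 <= C) (r0 : 0 < r) (r1 : r <= 1) (Cr : C * r <= 1 / 4).
Hypotheses (cw1 : continuous (fun z : R * R => w1 z.1 z.2))
  (cw2 : continuous (fun z : R * R => w2 z.1 z.2))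
  (cw : continuous (fun z : R * R => w z.1 z.2)).
Hypotheses (w1C : forall x y (v : 'rV[R]_N), `|v *m w1 x y| <= C * `|v|)
  (w2C : forall x y (v : 'rV[R]_N), `|v *m w2 x y| <= C * `|v|)
  (wC : forall x y (v : 'rV[R]_N), `|v *m w x y| <= C * `|v|).
Hypothesis dw2 : forall x y : R, `|x| < r -> `|y| < r ->
  is_derive x 1 (w2 ^~ y) (w x y).
Hypothesis dw1 : forall x y : R, `|x| < r -> `|y| < r ->
  is_derive y 1 (w1 x) (w x y + w1 x y *m w2 x y - w2 x y *m w1 x y).

(* P solves the system along the axis y = 0 and then along every vertical line;
   E measures the failure of the equation in x, and flatness turns its
   y-derivative into E w2 - int_0^x E w, so that E = 0 on a small square. *)
Lemma flat_system (p : 'rV[R]_N) : exists P : R -> R -> 'rV[R]_N,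
  [/\ P 0 0 = p, continuous (fun z : R * R => P z.1 z.2) &
    forall x y : R, `|x| < r -> `|y| < r ->
      is_derive x 1 (P ^~ y) (P x y *m w1 x y) /\
      is_derive y 1 (P x) (P x y *m w2 x y)].
Proof.
have Cr2 : C * r <= 1 / 2 by rewrite (le_trans Cr)// ler_pM2l// lef_pV2 ?posrE// ler_nat.
have swap (W : normedModType R) (f : R -> R -> W) : continuous (fun z : R * R => f z.1 z.2) ->
    continuous (fun z : R * R => f z.2 z.1).
  move=> cf [x y]; apply: (@continuous_comp _ _ _ (fun z : R * R => (z.2, z.1)) (fun z : R * R => f z.1 z.2) (x, y)).
    by apply: (@cvg_pair _ _ _ (nbhs (x, y)) (nbhs y) (nbhs x) _ _ _ snd fst); [exact: cvg_snd|exact: cvg_fst].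
  exact: cf.
have cw1x : continuous (fun z : R * R => w1 z.2 0).
  move=> z; apply: (@continuous_comp _ _ _ snd (w1 ^~ 0)); first exact: cvg_snd.
  exact: (@uncurried_continuous_r _ _ _ (fun y x => w1 x y) 0 (swap _ _ cw1)).
(* Along the axis the parameter is a dummy. The solution [P1 0] found there is the initial value,
   continuous in x, of the equations on the vertical lines. *)
have [P1 [cP1 P10 P1p dP1]] := @linear_ode_param _ _ C r C0 r0 Cr2 R
  (fun _ x => w1 x 0) (fun=> p) `|p| cw1x (@cst_continuous _ _ _) (fun _ => lexx _)
  (fun _ x v => w1C x 0 v).
have [P [cP P0 Pp dP]] := @linear_ode_param _ _ C r C0 r0 Cr2 R w2 (P1 0) (2 * `|p|) cw2
  (@uncurried_continuous_r _ _ _ P1 0 cP1) (P1p 0) w2C.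
exists P; split; [by rewrite P0 P10|exact: cP|].
pose Q y x := P x y *m w1 x y.
pose S y x := P x y *m (w1 x y *m w2 x y + w x y).
have cPs : continuous (fun z : R * R => P z.2 z.1) by exact: swap.
have cQ : continuous (fun z : R * R => Q z.1 z.2).
  by apply: mulmx_continuous => //; exact: (swap _ w1).
have cS : continuous (fun z : R * R => S z.1 z.2).
  rewrite (_ : (fun z => _) = fun z : R * R => P z.2 z.1 *m w1 z.2 z.1 *m w2 z.2 z.1
    + P z.2 z.1 *m w z.2 z.1); last by apply/funext => z; rewrite /S mulmxDr mulmxA.
  move=> z; apply: cvgD.
    apply: (mulmx_continuous cQ); exact: (swap _ w2).
  apply: mulmx_continuous => //; exact: (swap _ w).
have cQy y : continuous (Q y) by exact: (@uncurried_continuous_r _ _ _ Q y cQ).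
have cSy y : continuous (S y) by exact: (@uncurried_continuous_r _ _ _ S y cS).
(* The hypothesis [dw1] replaces the y-derivative of [w1]; the terms P w2 w1 then cancel and P (w1
   w2 + w) is left. *)
have dQ (y x : R) : `|y| < r -> `|x| < r -> is_derive y 1 (Q ^~ x) (S y x).
  move=> yr xr; have := is_derive_mulmx (dP x y yr) (dw1 xr yr).
  by rewrite -mulmxA -mulmxDr [X in _ *m X]addrC subrK (addrC (w x y)).
pose A y x := primitive (Q y) x; pose B y x := primitive (S y) x.
have dA (x y : R) : `|x| < r -> `|y| < r -> is_derive y 1 (A ^~ x) (B y x).
  by move=> xr yr; apply: (@primitive_param_derive _ Q S r).
pose E x y := P x y - P 0 y - A y x.
have cE y : continuous (fun x => E x y *m w x y).
  have cPy : continuous (P ^~ y) by exact: (@uncurried_continuous_r _ _ _ (fun y x => P x y) y cPs).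
  apply: mulmx_continuous; last first.
    exact: (@uncurried_continuous_r _ _ _ (fun y x => w x y) y (swap _ _ cw)).
  move=> x; apply: cvgB; last first.
    apply/differentiable_continuous/derivable1_diffP.
    by have [] := @is_derive_primitive _ _ _ x (cQy y).
  by apply: cvgB; [exact: cPy|exact: cvg_cst].
have E0 (x : R) : `|x| < r -> E x 0 = 0.
  move=> xr; have -> : 0 = E 0 0 by rewrite /E /A primitive0// subr0 subrr.
  apply: (@zero_derive0 _ _ (E ^~ 0)) => t tx.
  rewrite -(subrr (Q 0 t)) -[X in is_derive _ _ _ (X - _)]subr0.
  apply: is_deriveB; last exact: is_derive_primitive.
  apply: is_deriveB; rewrite /Q.
  rewrite (_ : P ^~ 0 = P1 0) ?P0; last by apply/funext => z; rewrite P0.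
  by apply: dP1; exact: le_lt_trans xr.
pose F y x := primitive (fun x => E x y *m w x y) x.
have dE (x y : R) : `|x| < r -> `|y| < r ->
    is_derive y 1 (E x) (E x y *m w2 x y - F y x).
  move=> xr yr.
  (* Integration by parts in x: the derivative of (P 0 y + A) w2 is Q w2 + (P - E) w = S - E w, and
     both sides vanish at x = 0. *)
  have BE : B y x = (P 0 y + A y x) *m w2 x y - P 0 y *m w2 0 y + F y x.
    pose D t := (P 0 y + A y t) *m w2 t y - P 0 y *m w2 0 y + F y t - B y t.
    have : D x = D 0.
      apply: zero_derive0 => t tx; have tr := le_lt_trans tx xr.
      have dPA : is_derive t 1 (fun t => P 0 y + A y t) (0 + Q y t).
        by apply: is_deriveD; exact: is_derive_primitive.
      have := is_deriveB (is_deriveD (is_deriveB (is_derive_mulmx dPA (dw2 tr yr))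
        (is_derive_cst (P 0 y *m w2 0 y) t 1)) (is_derive_primitive t (cE y)))
        (is_derive_primitive t (cSy y)).
      rewrite subr0 add0r [X in is_derive _ _ _ X](_ : _ - _ = 0)//.
      have -> : P 0 y + A y t = P t y - E t y by rewrite /E -addrA !opprD !opprK addrA subrr add0r.
      by rewrite mulmxBl addrA subrK /S /Q mulmxDr mulmxA subrr.
    have -> : D 0 = 0.
      rewrite /D /A /F /B (primitive0 (cQy y)) (primitive0 (cE y)) (primitive0 (cSy y)).
      by rewrite !addr0 subrr subrr.
    by move=> /subr0_eq <-.
  have -> : E x y *m w2 x y - F y x = P x y *m w2 x y - P 0 y *m w2 0 y - B y x.
    rewrite BE opprD opprB !addrA subrK -mulmxBl.
    by rewrite /E opprD addrA.
  apply: is_deriveB; last exact: dA.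
  apply: is_deriveB; first exact: dP.
  exact: dP.
(* If |E| <= M, then |E w2| <= C M and, as |x| < r <= 1, also |F| <= C M. Since E = 0 for y = 0,
   integrating 2 C M over |y| < r and using C r <= 1 / 4 halves the bound. *)
have half M : 0 <= M -> (forall x y, `|x| < r -> `|y| < r -> `|E x y| <= M) ->
    forall x y, `|x| < r -> `|y| < r -> `|E x y| <= M / 2.
  move=> M0 EM x y xr yr; rewrite -[E x y]subr0 -(E0 x xr).
  have CM0 : 0 <= C * M by rewrite mulr_ge0.
  have K0 : 0 <= 2 * (C * M) by rewrite mulr_ge0.
  apply: (@le_trans _ _ (2 * (C * M) * `|y|)); last first.
    rewrite (@le_trans _ _ (2 * (C * M) * r))// ?ler_wpM2l ?(ltW yr)//.
    rewrite (_ : _ * r = 2 * M * (C * r)); last by ring.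
    rewrite (_ : M / 2 = 2 * M * (1 / 4)); last by field.
    by rewrite ler_wpM2l// mulr_ge0.
  apply: (mean_value_norm0 K0 (fun t ty => dE x t xr (le_lt_trans ty yr))).
  move=> t ty; have tr := le_lt_trans ty yr.
  rewrite (le_trans (ler_normB _ _))// mulrDl mul1r lerD//.
    by rewrite (le_trans (w2C _ _ _))// ler_wpM2l// EM.
  rewrite (le_trans (primitive_norm (cE t) CM0 _))//.
    move=> s sx; rewrite (le_trans (wC _ _ _))// ler_wpM2l// EM//.
    exact: le_lt_trans xr.
  by rewrite ler_piMr// (le_trans (ltW xr)).
(* The start 9 |p| is 4 |p| + 4 |p| + |p|: solving twice doubles the bound twice, which gives |P| <=
   4 |p|, and the primitive is at most C r 4 |p| <= |p|. *)
have E_le k x y : `|x| < r -> `|y| < r -> `|E x y| <= 9 * `|p| / 2 ^+ k.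
  elim: k x y => [|k IH] x y xr yr.
    have P4 s t : `|P s t| <= 4 * `|p|.
      by rewrite (le_trans (Pp s t))// mulrA -natrM.
    have CP0 : 0 <= C * (4 * `|p|) by rewrite !mulr_ge0.
    rewrite expr0 divr1 (_ : 9 * `|p| = 4 * `|p| + 4 * `|p| + `|p|); last by ring.
    rewrite (le_trans (ler_normB _ _))// lerD//.
      by rewrite (le_trans (ler_normB _ _))// lerD.
    rewrite (le_trans (primitive_norm (cQy y) CP0 _))//.
      by move=> t _; rewrite (le_trans (w1C _ _ _))// ler_wpM2l.
    rewrite (@le_trans _ _ (C * (4 * `|p|) * r))// ?ler_wpM2l ?(ltW xr)//.
    rewrite mulrAC -[leRHS]mul1r mulrA ler_wpM2r//.
    by rewrite -ler_pdivlMr.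
  by rewrite exprSr invfM mulrA half// divr_ge0 ?exprn_ge0// mulr_ge0.
have Ez x y : `|x| < r -> `|y| < r -> E x y = 0.
  move=> xr yr; apply/eqP; rewrite -normr_le0 leNgt; apply/negP => n0.
  have [k] := lt_half_pow (9 * `|p|) n0; rewrite ltNge => /negP; apply.
  exact: E_le.
move=> x y xr yr; split; last exact: dP.
(* Since E = 0, the function P is P 0 y plus a primitive in x of P w1. *)
apply: (@near_eq_is_derive _ _ _ (fun x => P 0 y + A y x)).
  near=> z; have zr : `|z| < r.
    near: z; apply: (@cvgr_lt R _ _ _ (fun z : R => `|z|) `|x|) => //.
    by apply: cvg_norm; exact: cvg_id.
  by have /subr0_eq <- := Ez z y zr yr; rewrite addrC subrK.
rewrite -[X in is_derive _ _ _ X]add0r.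
by apply: is_deriveD; exact: is_derive_primitive.
Unshelve. all: by end_near. Qed.

End flat_system.

Section local_flat_system.
Context {R : realType}.

Lemma rV2_sum (W : zmodType) (f : 'I_2 -> W) : \sum_(i < 2) f i = f 0 + f ord_max.
Proof.
by rewrite big_ord_recl big_ord1; congr (_ + f _); exact: val_inj.
Qed.

Lemma rV2_decomp (v : 'rV[R]_2) :
  v = v 0 0 *: delta_mx 0 0 + v 0 ord_max *: delta_mx 0 ord_max.
Proof. by rewrite [LHS]row_sum_delta rV2_sum. Qed.

Lemma norm_delta_mx m n i j : `|delta_mx i j : 'M[R]_(m, n)| <= 1.
Proof.
apply: norm_mx_le => // k l; rewrite mxE.
by case: (_ && _); rewrite ?normr1 ?normr0.
Qed.

Lemma mulmx_norm m n (v : 'rV[R]_m) (A : 'M[R]_(m, n)) :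
  `|v *m A| <= m%:R * `|A| * `|v|.
Proof.
apply: norm_mx_le => [|i j]; first by rewrite !mulr_ge0.
rewrite mxE (le_trans (ler_norm_sum _ _ _))//.
rewrite (@le_trans _ _ (\sum_(k < m) `|A| * `|v|))//.
  apply: ler_sum => k _; rewrite normrM mulrC.
  by rewrite ler_pM// norm_entry_le.
by rewrite sumr_const card_ord -mulrA mulr_natl.
Qed.

Lemma is_derive_along (V W : normedModType R) (f : V -> W) (c v : V) (s : R) d :
  is_derive (c + s *: v) v f d -> is_derive s 1 (fun s => f (c + s *: v)) d.
Proof.
move=> [df <-].
have E : (fun h : R => h^-1 *: (((fun s => f (c + s *: v)) \o shift s) (h *: 1) - f (c + s *: v)))
    = (fun h : R => h^-1 *: ((f \o shift (c + s *: v)) (h *: v) - f (c + s *: v))).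
  by apply/funext => h /=; rewrite [h *: 1]mulr1 scalerDl addrCA.
by apply: DeriveDef; [rewrite /derivable E|rewrite /derive E].
Qed.

Lemma is_derive_of_line (V W : normedModType R) (f : V -> W) (c v : V) d :
  is_derive (0 : R) 1 (fun s => f (c + s *: v)) d -> is_derive c v f d.
Proof.
move=> [df <-].
have E : (fun h : R => h^-1 *: (((fun s => f (c + s *: v)) \o shift 0) (h *: 1) - f (c + 0 *: v)))
    = (fun h : R => h^-1 *: ((f \o shift c) (h *: v) - f c)).
  by apply/funext => h /=; rewrite [h *: 1]mulr1 addr0 scale0r addr0 (addrC c).
by apply: DeriveDef; [rewrite /derivable -E|rewrite [LHS]/derive -E].
Qed.

(** Going from x to a nearby point along two coordinate segments, the mean value estimate compares
    each partial with its value at x. It is what turns the partial equations solved by a flat system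
    into differentiability. *)
Lemma differentiable_partials n (f : 'rV[R]_2 -> 'rV[R]_n)
    (d : 'I_2 -> 'rV[R]_2 -> 'rV[R]_n) (U : set 'rV[R]_2) x :
  open U -> U x ->
  (forall i y, U y -> is_derive y (delta_mx 0 i) f (d i y)) ->
  (forall i, {for x, continuous (d i)}) -> differentiable f x.
Proof.
move=> oU Ux df dc.
pose D : 'M[R]_(2, n) := \matrix_(i, j) d i x 0 j.
have DE v : v *m D = v 0 0 *: d 0 x + v 0 ord_max *: d ord_max x.
  by rewrite mulmx_sum_row rV2_sum; congr (_ *: _ + _ *: _); apply/rowP => j; rewrite !mxE.
have cD : continuous (mulmxr D : 'rV[R]_2 -> 'rV[R]_n).
  apply: (@mulmx_continuous R 1 2 n _ id (cst D)); last exact: cst_continuous.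
  by move=> z; exact: cvg_id.
have [] // := @is_diff_norm _ _ _ f x (mulmxr D) cD _ => e e0.
have e2 : 0 < e / 2 by rewrite divr_gt0.
have /nbhs_ballP[r /= r0 rP] : \forall y \near x, [/\ U y,
    `|d 0 x - d 0 y| <= e / 2 & `|d ord_max x - d ord_max y| <= e / 2].
  near=> y; split.
  - by near: y; exact: open_nbhs_nbhs.
  - by near: y; apply: cvgr_dist_le e2; exact: dc.
  - by near: y; apply: cvgr_dist_le e2; exact: dc.
near=> y; set h := y - x.
have hr : `|h| < r.
  by rewrite /h distrC; near: y; apply: (@cvgr_dist_lt _ _ _ (nbhs x) _ id x).
have segment (i : 'I_2) (z : 'rV[R]_2) (t : R) : `|z| < r ->
    (forall s : R, `|s| <= `|t| -> `|z + s *: delta_mx 0 i| < r) ->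
    `|f (x + z + t *: delta_mx 0 i) - f (x + z) - t *: d i x| <= e / 2 * `|t|.
  move=> zr tr.
  have sP (s : R) : `|s| <= `|t| -> ball x r (x + z + s *: delta_mx 0 i).
    by move=> st; rewrite -ball_normE/= -addrA opprD addNKr normrN tr.
  have := @mean_value_norm0 _ _ (fun s : R => f (x + z + s *: delta_mx 0 i) - s *: d i x)
    (fun s => d i (x + z + s *: delta_mx 0 i) - d i x) t (e / 2) (ltW e2).
  rewrite !scale0r subr0 addr0 addrAC; apply => s st.
    apply: is_deriveB; last exact: is_derive_scale.
    apply: is_derive_along; apply: df; by have [] := rP _ (sP s st).
  have [_ d0 d1] := rP _ (sP s st).
  rewrite distrC; case: i {tr st sP} d0 d1 => [[|[|//]] i2].
    by rewrite (_ : Ordinal i2 = 0)//; exact: val_inj.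
  by rewrite (_ : Ordinal i2 = ord_max)//; exact: val_inj.
rewrite DE; set h0 := h 0 0; set h1 := h 0 ord_max.
have hE : h = h0 *: delta_mx 0 0 + h1 *: delta_mx 0 ord_max by exact: rV2_decomp.
have h0h : `|h0| <= `|h| by exact: norm_entry_le.
have h1h : `|h1| <= `|h| by exact: norm_entry_le.
have s0 := @segment 0 0 h0 _ _.
have s1 := @segment ord_max (h0 *: delta_mx 0 0) h1 _ _.
have yE : y = x + h0 *: delta_mx 0 0 + h1 *: delta_mx 0 ord_max.
  by rewrite -addrA -hE /h addrC subrK.
have le_h (u v : R) : `|u| <= `|h| -> `|v| <= `|h| ->
    `|u *: delta_mx 0 0 + v *: delta_mx 0 ord_max : 'rV[R]_2| < r.
  move=> uh vh; apply: le_lt_trans hr; apply: norm_mx_le => // i j.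
  rewrite !mxE !ord1 /=; case: j => [[|[|//]] j2] /=.
    by rewrite mulr1 mulr0 addr0.
  by rewrite mulr1 mulr0 add0r.
have telescope (W : zmodType) (u v z p q : W) :
    u - z - (p + q) = (u - v - q) + (v - z - p).
  by rewrite addrACA subrKA opprD [- q - p]addrC.
rewrite [X in f X](yE) (telescope _ _ (f (x + h0 *: delta_mx 0 0))).
rewrite addr0 in s0.
rewrite (le_trans (ler_normD _ _))// (splitr e) mulrDl lerD//.
  rewrite (le_trans (s1 _ _))// ?ler_wpM2l ?(ltW e2)//.
    by rewrite -[X in `|X|]addr0 -(scale0r (delta_mx 0 ord_max)) le_h ?normr0.
  by move=> s st; rewrite le_h// (le_trans st).
rewrite (le_trans (s0 _ _))// ?ler_wpM2l ?(ltW e2)// ?normr0//.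
move=> s st; rewrite add0r -[X in `|X|]addr0 -(scale0r (delta_mx 0 ord_max)) le_h ?normr0//.
exact: le_trans h0h.
Unshelve. all: by end_near. Qed.

(** Bootstrap: the derivatives of [P] are linear in [P] with smooth coefficients, so order k yields
    order k + 1. *)
Lemma flat_system_smooth N (U : set 'rV[R]_2) (w : 'I_2 -> 'rV[R]_2 -> 'M[R]_N)
    (P : 'rV[R]_2 -> 'rV[R]_N) : open U ->
  (forall i, smooth_on U (w i)) -> (forall x, U x -> differentiable P x) ->
  (forall i x, U x -> 'D_(delta_mx 0 i) P x = P x *m w i x) -> smooth_on U P.
Proof.
move=> oU sw dP DP; elim=> [|k IH].
  by move=> x /dP /differentiable_continuous.
split=> // v; suff : Ck k U (fun x => \sum_(i < 2) v 0 i *: (P x *m w i x)).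
  apply: Ck_eq => // x; rewrite inE => Ux.
  by rewrite derive_rV_sum; [apply: eq_bigr => i _; rewrite DP|exact: dP].
apply: Ck_sum => // i; apply: Ck_mx => // a b.
apply: (@Ck_eq _ _ _ _ _ (fun x => v 0 i * \sum_c P x a c * w i x c b)) => //.
  by move=> x _; rewrite !mxE.
apply: Ck_mul => //; first exact: Ck_cst.
apply: Ck_sum => // c; apply: Ck_mul => //; apply: Ck_entry => //.
exact: sw.
Qed.

(** Composing the coefficients with clamped coordinates centred at [x0] makes them defined and
    bounded on the whole plane and leaves them unchanged on a small square; derivatives are only
    taken inside that square. *)
Lemma local_flat_system N (U : set 'rV[R]_2) (w : 'I_2 -> 'rV[R]_2 -> 'M[R]_N)
    (x0 : 'rV[R]_2) (p : 'rV[R]_N) : open U -> U x0 ->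
  (forall i, smooth_on U (w i)) ->
  (forall x, U x -> 'D_(delta_mx 0 0) (w ord_max) x + w 0 x *m w ord_max x =
     'D_(delta_mx 0 ord_max) (w 0) x + w ord_max x *m w 0 x) ->
  exists U' (P : 'rV[R]_2 -> 'rV[R]_N), [/\ open_nbhs x0 U', U' `<=` U,
    smooth_on U' P, P x0 = p &
    forall i x, U' x -> 'D_(delta_mx 0 i) P x = P x *m w i x].
Proof.
move=> oU Ux0 sw flat.
pose dw := 'D_(delta_mx 0 0) (w ord_max).
have sdw : smooth_on U dw by exact/smooth_derive.
pose K := `|w 0 x0| + `|w ord_max x0| + `|dw x0| + 1.
have K0 : 0 < K by rewrite ltr_wpDl// !addr_ge0.
have bound (A : 'rV[R]_2 -> 'M[R]_N) : smooth_on U A -> `|A x0| < K ->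
    \forall x \near x0, `|A x| <= K.
  move=> sA AK; apply: (@cvgr_le R _ (nbhs x0) _ (fun x => `|A x|) `|A x0|) => //.
  by apply: cvg_norm; exact: (smooth_continuous sA Ux0).
have sum3 : [/\ `|w 0 x0| < K, `|w ord_max x0| < K & `|dw x0| < K].
  rewrite /K; move: `|w 0 x0| `|w ord_max x0| `|dw x0| (normr_ge0 (w 0 x0))
    (normr_ge0 (w ord_max x0)) (normr_ge0 (dw x0)) => a b c a0 b0 c0.
  by split; lra.
have /nbhs_ballP[d /= d0 dP] : \forall x \near x0, [/\ U x, `|w 0 x| <= K,
    `|w ord_max x| <= K & `|dw x| <= K].
  near=> x; split.
  - by near: x; exact: open_nbhs_nbhs.
  - by near: x; apply: bound => //; case: sum3.
  - by near: x; apply: bound => //; case: sum3.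
  - by near: x; apply: bound => //; case: sum3.
pose C := N%:R * K; have C0 : 0 <= C by rewrite mulr_ge0// ltW.
(* The three bounds give r <= 1, a square inside the ball of radius d, and C r <= 1 / 4; the + 1
   avoids a division by 0. *)
pose r := Num.min (Num.min 1 (d / 2)) (1 / 4 / (C + 1)).
have C1 : 0 < C + 1 by rewrite ltr_wpDl.
have r0 : 0 < r by rewrite !lt_min ltr01 !divr_gt0.
have rd : r < d.
  rewrite (@le_lt_trans _ _ (d / 2))//; first by rewrite !ge_min lexx orbT.
  by rewrite ltr_pdivrMr// ltr_pMr// ltr1n.
have r1 : r <= 1 by rewrite !ge_min lexx.
have Cr : C * r <= 1 / 4.
  rewrite (@le_trans _ _ ((C + 1) * r))//; first by rewrite ler_wpM2r ?ltW// ltrDl.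
  by rewrite mulrC -ler_pdivlMr// !ge_min lexx orbT.
pose line (x y : R) := x0 + x *: delta_mx 0 0 + y *: delta_mx 0 ord_max.
pose pt (x y : R) := line (clamp r x) (clamp r y).
have norm_line (x y : R) : `|x| <= r -> `|y| <= r -> ball x0 d (line x y).
  move=> xr yr; rewrite -ball_normE/= /line -addrA opprD addNKr normrN.
  apply: le_lt_trans rd; apply: norm_mx_le => [|i j]; first exact: ltW.
  rewrite !mxE !ord1 /=; case: j => [[|[|//]] j2] /=.
    by rewrite mulr1 mulr0 addr0.
  by rewrite mulr1 mulr0 add0r.
have ptP x y := dP _ (norm_line _ _ (clamp_norm x (ltW r0)) (clamp_norm y (ltW r0))).
have Upt x y : U (pt x y) by have [] := ptP x y.
have cpt : continuous (fun z : R * R => pt z.1 z.2).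
  have cc (v : 'rV[R]_2) (pr : R * R -> R) : continuous pr ->
      continuous (fun z => clamp r (pr z) *: v).
    move=> cpr z; apply: cvgZr_tmp; apply: (@continuous_comp _ _ _ pr (clamp r)); first exact: cpr.
    exact: clamp_continuous.
  move=> z; apply: cvgD; last by apply: cc => y; exact: cvg_snd.
  apply: cvgD; first exact: cvg_cst.
  by apply: cc => y; exact: cvg_fst.
have cwpt (A : 'rV[R]_2 -> 'M[R]_N) : smooth_on U A ->
    continuous (fun z : R * R => A (pt z.1 z.2)).
  move=> sA z; apply: (@continuous_comp _ _ _ (fun z : R * R => pt z.1 z.2) A); first exact: cpt.
  exact: (smooth_continuous sA (Upt _ _)).
have wptC (A : 'rV[R]_2 -> 'M[R]_N) x y (v : 'rV[R]_N) : `|A (pt x y)| <= K ->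
    `|v *m A (pt x y)| <= C * `|v|.
  by move=> AK; rewrite (le_trans (mulmx_norm _ _))// ler_wpM2r// /C ler_wpM2l.
have near_clamp (x : R) : `|x| < r -> \forall z \near x, clamp r z = z.
  move=> xr; near=> z; apply: clamp_id; near: z.
  apply: (@cvgr_le R _ (nbhs x) _ (fun z : R => `|z|) `|x|) => //.
  by apply: cvg_norm; exact: cvg_id.
have b0 x y (v : 'rV[R]_N) : `|v *m w 0 (pt x y)| <= C * `|v|.
  by apply: wptC; have [] := ptP x y.
have b1 x y (v : 'rV[R]_N) : `|v *m w ord_max (pt x y)| <= C * `|v|.
  by apply: wptC; have [] := ptP x y.
have bd x y (v : 'rV[R]_N) : `|v *m dw (pt x y)| <= C * `|v|.
  by apply: wptC; have [] := ptP x y.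
have dx (A : 'rV[R]_2 -> 'M[R]_N) (x y : R) : smooth_on U A -> `|x| < r -> `|y| < r ->
    is_derive x 1 (fun x => A (pt x y)) ('D_(delta_mx 0 0) A (pt x y)).
  move=> sA xr yr; have E t : pt t y = x0 + clamp r y *: delta_mx 0 ord_max + clamp r t *: delta_mx 0 0.
    by rewrite /pt /line addrAC.
  apply: (@near_eq_is_derive R R _ (fun t : R => A (x0 + clamp r y *: delta_mx 0 ord_max + t *: delta_mx 0 0))).
    by apply: filterS (near_clamp x xr) => t tE; rewrite E tE.
  rewrite E (clamp_id (ltW xr)); apply: is_derive_line.
  by apply: (smooth_differentiable sA); rewrite -[X in X *: delta_mx 0 0](clamp_id (ltW xr)) -E.
have dy (A : 'rV[R]_2 -> 'M[R]_N) (x y : R) : smooth_on U A -> `|x| < r -> `|y| < r ->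
    is_derive y 1 (fun y => A (pt x y)) ('D_(delta_mx 0 ord_max) A (pt x y)).
  move=> sA xr yr.
  apply: (@near_eq_is_derive R R _ (fun t : R => A (x0 + clamp r x *: delta_mx 0 0 + t *: delta_mx 0 ord_max))).
    by apply: filterS (near_clamp y yr) => t tE; rewrite /pt tE.
  rewrite /pt (clamp_id (ltW yr)); apply: is_derive_line.
  by apply: (smooth_differentiable sA); rewrite -[X in X *: delta_mx 0 ord_max](clamp_id (ltW yr)); exact: Upt.
have dw1 (x y : R) : `|x| < r -> `|y| < r -> is_derive y 1 (fun y => w 0 (pt x y))
    (dw (pt x y) + w 0 (pt x y) *m w ord_max (pt x y) - w ord_max (pt x y) *m w 0 (pt x y)).
  by move=> xr yr; rewrite /dw (flat _ (Upt x y)) addrK; exact: dy (sw 0) xr yr.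
have [P [P0 cP dP']] := flat_system C0 r0 r1 Cr (cwpt _ (sw 0)) (cwpt _ (sw ord_max))
  (cwpt _ sdw) b0 b1 bd (fun x y => dx _ x y (sw ord_max)) dw1 p.
pose c0 (z : 'rV[R]_2) := (z - x0) 0 0; pose c1 (z : 'rV[R]_2) := (z - x0) 0 ord_max.
pose Q z := P (c0 z) (c1 z).
have cr (z : 'rV[R]_2) : ball x0 r z -> `|c0 z| < r /\ `|c1 z| < r.
  rewrite -ball_normE/= distrC => zr.
  by split; apply: le_lt_trans zr; exact: norm_entry_le.
have lineE z : line (c0 z) (c1 z) = z.
  by rewrite /line -addrA -rV2_decomp addrC subrK.
have ptE (z : 'rV[R]_2) : ball x0 r z -> pt (c0 z) (c1 z) = z.
  by move=> /cr[h0 h1]; rewrite /pt !clamp_id ?ltW.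
have dQ i (z : 'rV[R]_2) : ball x0 r z -> is_derive z (delta_mx 0 i) Q (Q z *m w i z).
  move=> zr; have [h0 h1] := cr z zr; have [dP0 dP1] := dP' _ _ h0 h1.
  apply: is_derive_of_line; case: i => [[|[|//]] i2].
    have E : (fun s : R => Q (z + s *: delta_mx 0 (Ordinal i2))) = fun s => P (c0 z + s) (c1 z).
      apply/funext => s; rewrite /Q /c0 /c1 !mxE /= mulr1 mulr0 addr0.
      by rewrite addrAC.
    rewrite E; apply: (@is_derive_translate _ _ (P ^~ (c1 z))); rewrite addr0.
    by move: dP0; rewrite ptE// (_ : 0 = Ordinal i2)//; exact: val_inj.
  have E : (fun s : R => Q (z + s *: delta_mx 0 (Ordinal i2))) = fun s => P (c0 z) (c1 z + s).
    apply/funext => s; rewrite /Q /c0 /c1 !mxE /= mulr1 mulr0 addr0.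
    by rewrite addrAC.
  rewrite E; apply: is_derive_translate; rewrite addr0.
  by move: dP1; rewrite ptE// (_ : ord_max = Ordinal i2)//; exact: val_inj.
have rU : ball x0 r `<=` U.
  by move=> z zr; have [] : U z /\ true by split=> //; have [] := dP z (le_ball (ltW rd) zr).
have cQ : continuous Q.
  have cc i : continuous (fun z : 'rV[R]_2 => (z - x0) 0 i).
    move=> z; apply: (@continuous_comp _ _ _ (fun z : 'rV[R]_2 => z - x0) (fun A : 'rV[R]_2 => A 0 i)).
      exact: (@cvgB _ _ _ (nbhs z) _ id (cst x0) z x0 cvg_id (cvg_cst x0)).
    exact: coord_continuous.
  move=> z; apply: (@continuous_comp _ _ _ (fun z => (c0 z, c1 z)) (fun z : R * R => P z.1 z.2)); last exact: cP.
  apply: (@cvg_pair _ _ _ (nbhs z) (nbhs (c0 z)) (nbhs (c1 z)) _ _ _ c0 c1); exact: cc.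
have diffQ (z : 'rV[R]_2) : ball x0 r z -> differentiable Q z.
  move=> zr.
  have cd i : {for z, continuous (fun z => Q z *m w i z)}.
    apply: mulmx_continuous_at; first exact: cQ.
    exact: (smooth_continuous (sw i) (rU _ zr)).
  exact: (@differentiable_partials N Q (fun i z => Q z *m w i z) (ball x0 r) z (ball_open x0 r) zr dQ cd).
exists (ball x0 r), Q; split.
- exact: ball_open_nbhs.
- exact: rU.
- apply: (@flat_system_smooth _ _ w) => //; first exact: ball_open.
    by move=> i; exact: smooth_subset (sw i).
  by move=> i z zr; have [_ ->] := dQ i z zr.
- by rewrite /Q /c0 /c1 subrr !mxE.
- by move=> i z zr; have [_ ->] := dQ i z zr.
Unshelve. all: by end_near. Qed.

End local_flat_system.

(** * The Levi-Civita connection *)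

Section inner_product.
Context {R : realType} {n : nat}.
Implicit Types (G H : 'M[R]_n) (u v w : 'rV[R]_n).

Lemma innerE G u v : inner G u v = \sum_(j < n) \sum_(l < n) u 0 j * v 0 l * G j l.
Proof.
rewrite /inner mxE exchange_big; apply: eq_bigr => l _ /=.
by rewrite !mxE mulr_suml; apply: eq_bigr => j _; rewrite mulrAC.
Qed.

Lemma innerDl G u v w : inner G (u + v) w = inner G u w + inner G v w.
Proof. by rewrite /inner !mulmxDl mxE. Qed.

Lemma innerDr G u v w : inner G u (v + w) = inner G u v + inner G u w.
Proof. by rewrite /inner linearD mulmxDr mxE. Qed.

Lemma innerZl G a u v : inner G (a *: u) v = a * inner G u v.
Proof. by rewrite /inner -!scalemxAl mxE. Qed.

Lemma innerZr G a u v : inner G u (a *: v) = a * inner G u v.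
Proof. by rewrite /inner linearZ -scalemxAr mxE. Qed.

Lemma innerNl G u v : inner G (- u) v = - inner G u v.
Proof. by rewrite -scaleN1r innerZl mulN1r. Qed.

Lemma innerNr G u v : inner G u (- v) = - inner G u v.
Proof. by rewrite -scaleN1r innerZr mulN1r. Qed.

Lemma innerBl G u v w : inner G (u - v) w = inner G u w - inner G v w.
Proof. by rewrite innerDl innerNl. Qed.

Lemma innerBr G u v w : inner G u (v - w) = inner G u v - inner G u w.
Proof. by rewrite innerDr innerNr. Qed.

Lemma inner0l G v : inner G 0 v = 0.
Proof. by rewrite -(scale0r 0) innerZl mul0r. Qed.

Lemma inner_sym G u v : G^T = G -> inner G u v = inner G v u.
Proof.
move=> sG; rewrite /inner -[in LHS](trmxK (u *m G *m v^T)) mxE.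
by rewrite trmx_mul trmxK trmx_mul sG mulmxA.
Qed.

Definition pos_def G := forall v, v != 0 -> 0 < inner G v v.

Lemma inner_eq0 G v : pos_def G -> inner G v v = 0 -> v = 0.
Proof. by move=> pG v0; apply: contraPeq v0 => /pG; rewrite lt0r => /andP[/eqP]. Qed.

Lemma inner_mxE G u v : inner G u v = (u *m G *m v^T) 0 0.
Proof. by []. Qed.

Lemma inner_mulmx G u v : inner G u v = \sum_(l < n) (u *m G) 0 l * v 0 l.
Proof. by rewrite /inner mxE; apply: eq_bigr => l _; rewrite [v^T _ _]mxE. Qed.

Lemma pos_def_unitmx G : pos_def G -> G \in unitmx.
Proof.
move=> pG; rewrite -row_free_unit -kermx_eq0; apply/rowV0P => v /sub_kermxP vG.
by apply: (inner_eq0 pG); rewrite /inner vG mul0mx mxE.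
Qed.

End inner_product.

Lemma sum3_combine (R : zmodType) n (a b c d : 'I_n -> 'I_n -> 'I_n -> R) :
  \sum_i \sum_j \sum_k (a i j k + b i j k - (c i j k + d i j k)) =
  \sum_i \sum_j \sum_k a i j k + \sum_i \sum_j \sum_k b i j k
  - (\sum_i \sum_j \sum_k c i j k + \sum_i \sum_j \sum_k d i j k).
Proof.
rewrite -!big_split -sumrB; apply: eq_bigr => i _ /=.
rewrite -!big_split -sumrB; apply: eq_bigr => j _ /=.
by rewrite -!big_split -sumrB.
Qed.

Opaque inner derive.

Section connection.
Context {R : realType} {n : nat}.
Variables (g : 'rV[R]_n -> 'M[R]_n) (B : set 'rV[R]_n).

Definition local_metric := [/\ open B, smooth_on B g,
  forall x, B x -> (g x)^T = g x & forall x, B x -> pos_def (g x)].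

Hypothesis hg : local_metric.

Let oB : open B. Proof. by case: hg. Qed.
Let sg : smooth_on B g. Proof. by case: hg. Qed.
Let gT x : B x -> (g x)^T = g x. Proof. by case: hg x. Qed.
Let gpos x : B x -> pos_def (g x). Proof. by case: hg x. Qed.

(** The covariant derivative of the constant field [v] in the direction [u]; [dconnect]
    differentiates only its coefficients. *)
Definition connect x (u v : 'rV[R]_n) : 'rV[R]_n :=
  \row_k \sum_(i < n) \sum_(j < n) christoffel g k i j x * u 0 i * v 0 j.

Definition dconnect x (w u v : 'rV[R]_n) : 'rV[R]_n :=
  \row_k \sum_(i < n) \sum_(j < n) 'D_w (christoffel g k i j) x * u 0 i * v 0 j.

Lemma covariantE (V : normedModType R) (F N : V -> 'rV[R]_n) X x :
  covariant g F N X x = 'D_X N x + connect (F x) ('D_X F x) (N x).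
Proof. by []. Qed.

Lemma connectDl x u v w : connect x (u + v) w = connect x u w + connect x v w.
Proof.
apply/rowP => k; rewrite !mxE -big_split; apply: eq_bigr => i _ /=.
by rewrite -big_split; apply: eq_bigr => j _ /=; rewrite mxE mulrDr mulrDl.
Qed.

Lemma connectDr x u v w : connect x u (v + w) = connect x u v + connect x u w.
Proof.
apply/rowP => k; rewrite !mxE -big_split; apply: eq_bigr => i _ /=.
by rewrite -big_split; apply: eq_bigr => j _ /=; rewrite mxE mulrDr.
Qed.

Lemma connectZl x a u v : connect x (a *: u) v = a *: connect x u v.
Proof.
apply/rowP => k; rewrite !mxE mulr_sumr; apply: eq_bigr => i _ /=.
by rewrite mulr_sumr; apply: eq_bigr => j _ /=; rewrite mxE; ring.
Qed.

Lemma connectZr x a u v : connect x u (a *: v) = a *: connect x u v.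
Proof.
apply/rowP => k; rewrite !mxE mulr_sumr; apply: eq_bigr => i _ /=.
by rewrite mulr_sumr; apply: eq_bigr => j _ /=; rewrite mxE; ring.
Qed.

Lemma connect0l x u : connect x 0 u = 0.
Proof. by rewrite -[X in connect _ X _](scale0r 0) connectZl scale0r. Qed.

Lemma connect0r x u : connect x u 0 = 0.
Proof. by rewrite -[X in connect _ _ X](scale0r 0) connectZr scale0r. Qed.

Lemma connectNr x u v : connect x u (- v) = - connect x u v.
Proof. by rewrite -scaleN1r connectZr scaleN1r. Qed.

Lemma gunit x : B x -> g x \in unitmx.
Proof. by move=> /gpos/pos_def_unitmx. Qed.

Lemma inner_derive x (w u v : 'rV[R]_n) : B x ->
  inner ('D_w g x) u v = \sum_(i < n) \sum_(j < n) \sum_(l < n)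
    w 0 i * u 0 j * v 0 l * 'D_(delta_mx 0 i) (fun y => g y j l) x.
Proof.
move=> Bx; have dg := smooth_differentiable sg Bx.
rewrite derive_rV_sum// innerE.
have E j l : (\sum_(i < n) w 0 i *: 'D_(delta_mx 0 i) g x) j l
    = \sum_(i < n) w 0 i * 'D_(delta_mx 0 i) (fun y => g y j l) x.
  by rewrite summxE; apply: eq_bigr => i _; rewrite mxE derive_entry.
under eq_bigr do under eq_bigr do rewrite E mulr_sumr.
under eq_bigr do rewrite exchange_big.
rewrite exchange_big; apply: eq_bigr => i _; apply: eq_bigr => j _.
by apply: eq_bigr => l _ /=; ring.
Qed.

(** The Koszul formula for constant fields, whose brackets vanish. The symmetry of the connection
    and its compatibility with the metric are both read off it, without returning to the Christoffel
    sums. *)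
Lemma koszul x (w u v : 'rV[R]_n) : B x -> inner (g x) (connect x w u) v =
  2^-1 * (inner ('D_w g x) u v + inner ('D_u g x) w v - inner ('D_v g x) w u).
Proof.
move=> Bx.
pose e l i j := 'D_(delta_mx 0 i) (fun y => g y j l) x
     + 'D_(delta_mx 0 j) (fun y => g y i l) x
     - 'D_(delta_mx 0 l) (fun y => g y i j) x.
pose c : 'rV[R]_n := \row_l (2^-1 * \sum_i \sum_j w 0 i * u 0 j * e l i j).
have connectE : connect x w u = c *m invmx (g x).
  rewrite -[in RHS](gT Bx) -trmx_inv; apply/rowP => k; rewrite !mxE.
  transitivity (\sum_l \sum_i \sum_j 2^-1 * (w 0 i * u 0 j * e l i j) * invmx (g x) k l).
    rewrite [RHS]exchange_big; apply: eq_bigr => i _.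
    rewrite [RHS]exchange_big; apply: eq_bigr => j _ /=.
    rewrite /christoffel mulr_sumr !mulr_suml; apply: eq_bigr => l _.
    by rewrite /e; ring.
  apply: eq_bigr => l _; rewrite !mxE mulr_sumr mulr_suml; apply: eq_bigr => i _.
  by rewrite mulr_sumr mulr_suml.
have -> : inner (g x) (connect x w u) v = \sum_l c 0 l * v 0 l.
  by rewrite connectE inner_mulmx mulmxKV ?gunit.
transitivity (\sum_i \sum_j \sum_l 2^-1 * (w 0 i * u 0 j * e l i j) * v 0 l).
  under eq_bigr => l _ do rewrite mxE mulr_sumr mulr_suml.
  rewrite exchange_big; apply: eq_bigr => i _.
  under eq_bigr => l _ do rewrite mulr_sumr mulr_suml.
  by rewrite exchange_big.
rewrite [X in _ * (X + _ - _)]inner_derive// [X in _ * (_ + X - _)]inner_derive//.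
rewrite [X in _ * (_ - X)]inner_derive//.
rewrite [X in _ + X - _]exchange_big.
have -> : \sum_i \sum_j \sum_l v 0 i * w 0 j * u 0 l * 'D_(delta_mx 0 i) (fun y => g y j l) x
  = \sum_i \sum_j \sum_l v 0 l * w 0 i * u 0 j * 'D_(delta_mx 0 l) (fun y => g y i j) x.
  by rewrite exchange_big; apply: eq_bigr => i _; rewrite exchange_big.
rewrite -big_split -sumrB mulr_sumr; apply: eq_bigr => i _ /=.
rewrite -big_split -sumrB mulr_sumr; apply: eq_bigr => j _ /=.
rewrite -big_split -sumrB mulr_sumr; apply: eq_bigr => l _ /=.
by rewrite /e; ring.
Qed.

Lemma inner_derive_sym x (w u v : 'rV[R]_n) : B x ->
  inner ('D_w g x) u v = inner ('D_w g x) v u.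
Proof.
move=> Bx; apply: inner_sym; have dg := smooth_differentiable sg Bx.
apply/matrixP => i j; rewrite mxE !derive_entry//.
apply: near_eq_derive; apply: open_near oB Bx _ => y By.
by rewrite -[in LHS](gT By) mxE.
Qed.

Lemma connect_sym x u v : B x -> connect x u v = connect x v u.
Proof.
move=> Bx; have symz z : inner (g x) (connect x u v - connect x v u) z = 0.
  rewrite innerBl [X in X - _]koszul// [X in _ - X]koszul//.
  by rewrite [X in _ - _ * (_ - X)]inner_derive_sym// [X in _ - _ * (X - _)]addrC subrr.
exact/subr0_eq/(inner_eq0 (gpos Bx))/symz.
Qed.

Lemma christoffel_sym x k i j : B x -> christoffel g k i j x = christoffel g k j i x.
Proof.
have e a b : christoffel g k a b x = connect x (delta_mx 0 a) (delta_mx 0 b) 0 k.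
  rewrite [RHS]mxE (bigD1 a)//= (bigD1 b)//= ![delta_mx _ _ _ _]mxE !eqxx !mulr1.
  rewrite !big1 ?addr0//.
    move=> c ca; rewrite big1// => d _.
    by rewrite [X in _ * X * _]mxE (negPf ca) mulr0 mul0r.
  by move=> d db; rewrite [X in _ * X]mxE (negPf db) mulr0.
by move=> Bx; rewrite !e connect_sym.
Qed.

Lemma derive_metric x w u v : B x -> inner ('D_w g x) u v =
  inner (g x) (connect x w u) v + inner (g x) u (connect x w v).
Proof.
have half (a b c : R) : a = 2^-1 * (a + b - c) + 2^-1 * (a + c - b) by field.
move=> Bx; rewrite [X in _ = _ + X](inner_sym _ _ (gT Bx)).
rewrite [X in _ = X + _]koszul// [X in _ = _ + X]koszul//.
by rewrite [X in _ + 2^-1 * (X + _ - _)]inner_derive_sym.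
Qed.

Lemma smooth_christoffel k i j : smooth_on B (christoffel g k i j).
Proof.
have de a b c : smooth_on B ('D_(delta_mx 0 a) (fun y => g y b c)).
  by apply: smooth_derive; exact: smooth_entry.
apply: (smoothM oB (smooth_cst oB _)); apply: smooth_sum => // l.
apply: smoothM => //.
  by apply: smooth_entry => //; apply: smooth_invmx => // x; exact: gunit.
by apply: smoothB => //; apply: smoothD.
Qed.

Section smooth_fields.
Context {V : normedModType R} (U : set V) (F A N : V -> 'rV[R]_n).
Hypotheses (oU : open U) (UB : forall x, U x -> B (F x)) (sF : smooth_on U F)
  (sA : smooth_on U A) (sN : smooth_on U N).

Lemma smooth_connect : smooth_on U (fun x => connect (F x) (A x) (N x)).
Proof.
apply: smooth_mx => // a k.
suff : smooth_on U (fun x => \sum_(i < n) \sum_(j < n)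
    christoffel g k i j (F x) * A x 0 i * N x 0 j).
  by apply: smooth_eq => // x _; rewrite mxE.
apply: smooth_sum => // i; apply: smooth_sum => // j.
apply: smoothM => //; last exact: smooth_entry.
apply: smoothM => //; last exact: smooth_entry.
exact: (smooth_comp_scalar oU UB sF (smooth_christoffel k i j)).
Qed.

Lemma smooth_inner : smooth_on U (fun x => inner (g (F x)) (A x) (N x)).
Proof.
suff : smooth_on U (fun x => (A x *m g (F x) *m (N x)^T) 0 0).
  by apply: smooth_eq => // x _; rewrite inner_mxE.
apply: smooth_entry => //; apply: smooth_mulmx => //; last exact: smooth_trmx.
apply: smooth_mulmx => //; exact: (smooth_comp oU oB UB sF sg).
Qed.

End smooth_fields.

Lemma smooth_covariant (V : normedModType R) (U : set V) (F N : V -> 'rV[R]_n) X :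
  open U -> (forall x, U x -> B (F x)) -> smooth_on U F -> smooth_on U N ->
  smooth_on U (covariant g F N X).
Proof.
move=> oU UB sF sN; apply: smoothD => //; first exact: smooth_derive.
by apply: (smooth_connect oU UB sF _ sN); exact: smooth_derive.
Qed.

Section along_a_map.
Context {V : normedModType R}.
Variables (F : V -> 'rV[R]_n) (x : V).
Hypotheses (dF : differentiable F x) (BF : B (F x)).
Implicit Types N A : V -> 'rV[R]_n.

Lemma derive_christoffel_comp k i j X :
  is_derive x X (fun y => christoffel g k i j (F y)) ('D_('D_X F x) (christoffel g k i j) (F x)).
Proof.
have dc := smooth_differentiable (smooth_christoffel k i j) BF.
apply: DeriveDef; last by rewrite -(derive_comp X dF dc).
by apply: diff_derivable; exact: (differentiable_comp dF dc).
Qed.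

Lemma derive_connect A N X : differentiable A x -> differentiable N x ->
  is_derive x X (fun y => connect (F y) (A y) (N y))
   (dconnect (F x) ('D_X F x) (A x) (N x) + connect (F x) ('D_X A x) (N x)
    + connect (F x) (A x) ('D_X N x)).
Proof.
move=> dA dN; apply: is_derive_mx => a k.
have -> : (fun y => connect (F y) (A y) (N y) a k) = \sum_i \sum_j
    ((fun y => christoffel g k i j (F y)) * (fun y => A y 0 i) * (fun y => N y 0 j)).
  apply/funext => y; rewrite mxE fct_sumE; apply: eq_bigr => i _.
  by rewrite fct_sumE.
have de (C : V -> 'rV[R]_n) i : differentiable C x -> is_derive x X (fun y => C y 0 i) ('D_X C x 0 i).
  by move=> dC; apply: is_derive_entry; exact/derivableP/diff_derivable.
have D i j := is_deriveM (is_deriveM (derive_christoffel_comp k i j X) (de A i dA)) (de N j dN).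
have DD := is_derive_sum (fun i => is_derive_sum (D i)).
apply: (is_derive_eq DD); rewrite !mxE -!big_split; apply: eq_bigr => i _ /=.
rewrite -!big_split; apply: eq_bigr => j _ /=.
rewrite [(_ * _ : V -> R) x]/GRing.mul /= /GRing.scale/=; ring.
Qed.

(** Metric compatibility pulled back along [F]: [derive_metric] splits the derivative of the
    coefficients of [g] between the two factors, completing each ordinary derivative to a covariant
    one. *)
Lemma derive_inner A N X : differentiable A x -> differentiable N x ->
  is_derive x X (fun y => inner (g (F y)) (A y) (N y))
    (inner (g (F x)) (covariant g F A X x) (N x)
     + inner (g (F x)) (A x) (covariant g F N X x)).
Proof.
move=> dA dN; have dg := smooth_differentiable sg BF.
have dgF : is_derive x X (g \o F) ('D_('D_X F x) g (F x)).
  apply: DeriveDef; last by rewrite -(derive_comp X dF dg).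
  by apply: diff_derivable; exact: differentiable_comp.
have de (C : V -> 'rV[R]_n) : differentiable C x -> is_derive x X C ('D_X C x).
  by move=> dC; exact/derivableP/diff_derivable.
rewrite (_ : (fun y => _) = \sum_l ((fun y => (A y *m g (F y)) 0 l) * (fun y => N y 0 l))); last first.
  by apply/funext => y; rewrite inner_mulmx fct_sumE.
have D l := is_deriveM (is_derive_entry 0 l (is_derive_mulmx (de A dA) dgF))
  (is_derive_entry 0 l (de N dN)).
apply: (is_derive_eq (is_derive_sum D)).
rewrite !covariantE innerDl innerDr addrACA -(derive_metric _ _ _ BF) !inner_mulmx.
rewrite -!big_split; apply: eq_bigr => l _ /=; rewrite /GRing.scale/=.
have addE (C E : 'rV[R]_n) : (C + E) 0 l = C 0 l + E 0 l by rewrite mxE.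
by rewrite addE; ring.
Qed.

End along_a_map.

Lemma dconnectE x u v w l : B x -> dconnect x u v w 0 l =
  \sum_(i < n) \sum_(j < n) \sum_(k < n)
    u 0 i * v 0 j * w 0 k * 'D_(delta_mx 0 i) (christoffel g l j k) x.
Proof.
move=> Bx; rewrite mxE [RHS]exchange_big; apply: eq_bigr => j _.
rewrite [RHS]exchange_big; apply: eq_bigr => k _ /=.
rewrite derive_rV_sum; last exact: (smooth_differentiable (smooth_christoffel l j k) Bx).
rewrite !mulr_suml; apply: eq_bigr => i _.
by rewrite /GRing.scale/=; ring.
Qed.

Lemma connect_connectE x u v w l : connect x u (connect x v w) 0 l =
  \sum_(i < n) \sum_(j < n) \sum_(k < n) u 0 i * v 0 j * w 0 k *
    \sum_(m < n) christoffel g l i m x * christoffel g m j k x.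
Proof.
rewrite mxE; apply: eq_bigr => i _.
under eq_bigr => m _ do rewrite mxE mulr_sumr.
rewrite exchange_big; apply: eq_bigr => j _ /=.
under eq_bigr => m _ do rewrite mulr_sumr.
rewrite exchange_big; apply: eq_bigr => k _ /=.
by rewrite mulr_sumr; apply: eq_bigr => m _; ring.
Qed.

(** Constant fields commute, so the curvature is the commutator of second covariant derivatives,
    each of which is a [dconnect] plus an iterated [connect]. *)
Lemma curvatureE x u v w : B x -> curvature g x u v w =
  dconnect x u v w + connect x u (connect x v w)
  - (dconnect x v u w + connect x v (connect x u w)).
Proof.
move=> Bx; apply/rowP => l.
have addE (C E : 'rV[R]_n) : (C + E) 0 l = C 0 l + E 0 l by rewrite mxE.
have oppE (C : 'rV[R]_n) : (- C) 0 l = - C 0 l by rewrite mxE.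
rewrite mxE addE oppE !addE !dconnectE// !connect_connectE.
rewrite [X in _ = _ - (X + _)]exchange_big [X in _ = _ - (_ + X)]exchange_big /=.
rewrite -[RHS]sum3_combine; apply: eq_bigr => i _; apply: eq_bigr => j _.
apply: eq_bigr => k _; rewrite /riemann sumrB.
move: ('D_(delta_mx 0 i) _ x) ('D_(delta_mx 0 j) _ x) => a b.
move: (\sum_(m < n) _) (\sum_(m < n) _) => c d.
by ring.
Qed.

Lemma dconnect_sym x u v w : B x -> dconnect x u v w = dconnect x u w v.
Proof.
move=> Bx; apply/rowP => l; rewrite [LHS]mxE [RHS]mxE exchange_big.
apply: eq_bigr => i _; apply: eq_bigr => j _ /=.
have -> : 'D_u (christoffel g l j i) x = 'D_u (christoffel g l i j) x.
  apply: near_eq_derive; apply: open_near oB Bx _ => y By.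
  exact: christoffel_sym.
by rewrite mulrAC.
Qed.

Lemma curvature_antisym x u v w : B x -> curvature g x v u w = - curvature g x u v w.
Proof. by move=> Bx; rewrite [LHS]curvatureE// [in RHS]curvatureE// opprB. Qed.

(** By the symmetry of the connection the twelve terms cancel in pairs. *)
Lemma curvature_bianchi x u v w : B x ->
  curvature g x u v w + curvature g x v w u + curvature g x w u v = 0.
Proof.
move=> Bx; rewrite !curvatureE//.
rewrite (dconnect_sym v w u Bx) (dconnect_sym w u v Bx) (dconnect_sym u w v Bx).
rewrite (connect_sym w u Bx) (connect_sym v w Bx) (connect_sym u v Bx).
apply/rowP => l.
move: (dconnect x u v w) (dconnect x v u w) (dconnect x w v u)
  (connect x u (connect x w v)) (connect x v (connect x u w)) (connect x w (connect x v u)) => a b c d e f.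
by rewrite !mxE; ring.
Qed.

Let differentiable_id (y : 'rV[R]_n) : differentiable id y.
Proof. by have [] := is_diff_id y. Qed.

Let smooth_id : smooth_on B id.
Proof. by apply: (smooth_linear oB (L := idfun)) => x; exact: cvg_id. Qed.

Let deriv_inner_cst u w z y : B y -> 'D_u (fun y => inner (g y) w z) y =
  inner (g y) (connect y u w) z + inner (g y) w (connect y u z).
Proof.
move=> By; have cov (a : 'rV[R]_n) : covariant g id (cst a) u y = connect y u a.
  by rewrite covariantE derive_cst add0r derive_id.
have [_] := @derive_inner _ id y (differentiable_id y) By (cst w) (cst z) u
  (differentiable_cst _ _) (differentiable_cst _ _).
by rewrite !cov.
Qed.

(** For constant w and z the derivatives D_u D_v and D_v D_u of <w, z> agree. Expanded by metric
    compatibility, their mixed terms are symmetric in u and v, and what remains is <R(u, v) w, z> +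
    <w, R(u, v) z> = 0. *)
Lemma curvature_skew x u v w z : B x ->
  inner (g x) (curvature g x u v w) z = - inner (g x) w (curvature g x u v z).
Proof.
move=> Bx; pose S u v w := dconnect x u v w + connect x u (connect x v w).
pose h y := inner (g y) w z.
have D2 a b : 'D_a ('D_b h) x = inner (g x) (S a b w) z + inner (g x) w (S a b z)
    + (inner (g x) (connect x b w) (connect x a z) + inner (g x) (connect x a w) (connect x b z)).
  rewrite (near_eq_derive (g := fun y => inner (g y) (connect y b w) z + inner (g y) w (connect y b z))); last first.
    by apply: open_near oB Bx _ => y By; rewrite deriv_inner_cst.
  have dc t : is_derive x a (fun y => connect y b t) (dconnect x a b t).
    have := @derive_connect _ id x (differentiable_id x) Bx (cst b) (cst t) a
      (differentiable_cst _ _) (differentiable_cst _ _).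
    rewrite derive_id !derive_cst.
    by rewrite /= connect0l connect0r !addr0.
  have diffc t : differentiable (fun y => connect y b t) x.
    have := @smooth_connect _ B id (cst b) (cst t) oB _ smooth_id
      (smooth_cst oB b) (smooth_cst oB t).
    by move=> /(_ (fun y => id)) /smooth_differentiable; exact.
  have cov t : covariant g id (fun y => connect y b t) a x = S a b t.
    by rewrite covariantE derive_id; have [_ ->] := dc t.
  have covc (t : 'rV[R]_n) : covariant g id (cst t) a x = connect x a t.
    by rewrite covariantE derive_cst add0r derive_id.
  have D1 := @derive_inner _ id x (differentiable_id x) Bx (fun y => connect y b w) (cst z) a
    (diffc w) (differentiable_cst _ _).
  have D2 := @derive_inner _ id x (differentiable_id x) Bx (cst w) (fun y => connect y b z) a
    (differentiable_cst _ _) (diffc z).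
  have [_ ->] := is_deriveD D1 D2.
  rewrite !cov !covc.
  move: (inner _ (S a b w) z) (inner _ w (S a b z)) => p q; move: (inner _ _ _) (inner _ _ _) => r s.
  by ring.
have C2 : Ck 2 B h.
  exact: (@smooth_inner _ B id (cst w) (cst z) oB (fun y => id) smooth_id
      (smooth_cst oB w) (smooth_cst oB z) 2).
have := derive_comm_R u v oB Bx C2.
rewrite !D2 !curvatureE// -/(S u v w) -/(S v u w) -/(S u v z) -/(S v u z).
rewrite innerBl innerBr.
move: (inner (g x) (S u v w) z) (inner (g x) w (S u v z)) => p q.
move: (inner (g x) (S v u w) z) (inner (g x) w (S v u z)) => p' q'.
move: (inner (g x) _ _) (inner (g x) _ _) => r s E.
by lra.
Qed.

End connection.

(** Sectional curvatures determine an algebraic curvature tensor. Additivity is assumed in the first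
    slot and carried to the others by the symmetries. *)
Lemma curvature_polarization (V : zmodType) (R : realFieldType)
    (T : V -> V -> V -> V -> R) :
  (forall u v w z, T v u w z = - T u v w z) ->
  (forall u v w z, T u v z w = - T u v w z) ->
  (forall u v w z, T u v w z + T v w u z + T w u v z = 0) ->
  (forall u u' v w z, T (u + u') v w z = T u v w z + T u' v w z) ->
  (forall u v, T u v v u = 0) -> forall u v w z, T u v w z = 0.
Proof.
move=> T12 T34 Tb Tadd Tsec.
(* Pair symmetry, by combining the four cyclic shifts of the Bianchi identity with skew-symmetry. *)
have pair u v w z : T w u v z = T v z w u.
  move: (Tb u v w z) (Tb v w z u) (Tb w z u v) (Tb z u v w).
  move: (T34 u v w z) (T34 v w u z) (T34 w z v u) (T34 z u w v).
  move: (T12 w u z v) (T34 w u v z) (T12 z v u w) (T34 z v w u) (T12 z v w u).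
  by move=> *; lra.
have Tadd3 u v w w' z : T u v (w + w') z = T u v w z + T u v w' z.
  by rewrite (pair v (w + w') u z) Tadd (pair v w u z) (pair v w' u z).
have Tadd2 u v v' w z : T u (v + v') w z = T u v w z + T u v' w z.
  by rewrite (T12 (v + v') u) Tadd opprD -(T12 v u) -(T12 v' u).
have Tadd4 u v w z z' : T u v w (z + z') = T u v w z + T u v w z'.
  by rewrite (T34 u v (z + z') w) Tadd3 opprD -(T34 u v z w) -(T34 u v z' w).
have Tvv u v w : T u v v w = 0.
  have := Tsec (u + w) v; rewrite Tadd !Tadd4 !Tsec.
  by move: (pair v v w u) (T12 u v w v) (T34 u v v w) => *; lra.
(* Polarization makes [T] skew in the middle slots as well, hence alternating; the cyclic identity
   then says 3 T = 0. *)
have T23 u v w z : T u w v z = - T u v w z.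
  by have := Tvv u (v + w) z; rewrite Tadd2 !Tadd3 !Tvv => *; lra.
move=> u v w z.
by move: (Tb u v w z) (T12 v w u z) (T23 v u w z) (T12 u v w z) (T12 u w v z) (T23 u v w z) => *; lra.
Qed.

Section covariant_derivatives.
Context {R : realType} {n : nat}.
Variables (g : 'rV[R]_n -> 'M[R]_n) (B : set 'rV[R]_n).
Hypothesis hg : local_metric g B.

Opaque covariant curvature connect dconnect.

Section along_a_smooth_map.
Context {V : normedModType R}.
Variables (U : set V) (F N : V -> 'rV[R]_n).
Hypotheses (oU : open U) (UB : forall x, U x -> B (F x)) (sF : smooth_on U F)
  (sN : smooth_on U N).

Lemma covariant_torsion X Y x : U x ->
  covariant g F ('D_Y F) X x = covariant g F ('D_X F) Y x.
Proof.
move=> Ux; rewrite !covariantE (connect_sym hg _ _ (UB Ux)).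
by rewrite (derive_comm _ _ oU Ux (sF 2)).
Qed.

(** The second derivatives of [F] and [N] cancel by Schwarz and the mixed first-order terms cancel
    in pairs. So the curvature is the commutator also for fields that live only along the map. *)
Lemma covariant_comm X Y x : U x ->
  covariant g F (covariant g F N Y) X x - covariant g F (covariant g F N X) Y x
  = curvature g (F x) ('D_X F x) ('D_Y F x) (N x).
Proof.
move=> Ux; have BF := UB Ux.
have dF := smooth_differentiable sF Ux; have dN := smooth_differentiable sN Ux.
have dDF Z := smooth_differentiable (smooth_derive Z sF) Ux.
have dDN Z := smooth_differentiable (smooth_derive Z sN) Ux.
have D Z W : 'D_W (covariant g F N Z) x = 'D_W ('D_Z N) x +
   (dconnect g (F x) ('D_W F x) ('D_Z F x) (N x) + connect g (F x) ('D_W ('D_Z F) x) (N x)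
    + connect g (F x) ('D_Z F x) ('D_W N x)).
  have [_ <-] := derive_connect hg dF BF W (dDF Z) dN.
  rewrite -deriveD//; first exact: diff_derivable.
  by have [] := derive_connect hg dF BF W (dDF Z) dN.
have cov2 Z W : covariant g F (covariant g F N Z) W x = 'D_W ('D_Z N) x +
   (dconnect g (F x) ('D_W F x) ('D_Z F x) (N x) + connect g (F x) ('D_W ('D_Z F) x) (N x)
    + connect g (F x) ('D_Z F x) ('D_W N x)) + (connect g (F x) ('D_W F x) ('D_Z N x)
    + connect g (F x) ('D_W F x) (connect g (F x) ('D_Z F x) (N x))).
  by rewrite [LHS]covariantE D [covariant _ _ _ Z x]covariantE connectDr.
have cancel (a c d1 d2 e1 e2 q1 q2 : 'rV[R]_n) :
    a + (d1 + c + e1) + (e2 + q1) - (a + (d2 + c + e2) + (e1 + q2)) = d1 + q1 - (d2 + q2).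
  by apply/rowP => k; rewrite !mxE; ring.
rewrite [X in X - _](cov2 Y X) [X in _ - X](cov2 X Y) [RHS](curvatureE hg _ _ _ BF).
have <- := derive_comm X Y oU Ux (sF 2); have <- := derive_comm X Y oU Ux (sN 2).
exact: cancel.
Qed.

End along_a_smooth_map.
End covariant_derivatives.

Lemma row_free2P (R : fieldType) n (u v : 'rV[R]_n) :
  (forall a b, a *: u + b *: v = 0 -> a = 0 /\ b = 0) <-> row_free (col_mx u v).
Proof.
split=> [free|rf a b ab].
  rewrite -kermx_eq0; apply/rowV0P => w /sub_kermxP.
  rewrite -[w]hsubmxK mul_row_col [lsubmx w]mx11_scalar [rsubmx w]mx11_scalar.
  by rewrite !mul_scalar_mx => /free[-> ->]; rewrite !raddf0 row_mx0.
have /eqP : row_mx a%:M b%:M *m col_mx u v = 0 by rewrite mul_row_col !mul_scalar_mx.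
rewrite mulmx_free_eq0// => /eqP; rewrite -[0]row_mx0 => /eq_row_mx[/matrixP a0 /matrixP b0].
by have := a0 0 0; have := b0 0 0; rewrite !mxE eqxx !mulr1n.
Qed.

Section constant_sectional_curvature.
Context {R : realType} {n : nat}.
Variables (g : 'rV[R]_n -> 'M[R]_n) (B : set 'rV[R]_n) (x : 'rV[R]_n) (c : R).
Hypotheses (hg : local_metric g B) (Bx : B x).

Lemma curvatureDl u u' v w : curvature g x (u + u') v w =
  curvature g x u v w + curvature g x u' v w.
Proof.
Transparent curvature.
apply/rowP => l; rewrite !mxE -big_split; apply: eq_bigr => i _ /=.
rewrite -big_split; apply: eq_bigr => j _ /=.
rewrite -big_split; apply: eq_bigr => k _ /=.
by rewrite mxE !mulrDl.
Qed.

Lemma curvatureZl a u v w : curvature g x (a *: u) v w = a *: curvature g x u v w.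
Proof.
apply/rowP => l; rewrite !mxE mulr_sumr; apply: eq_bigr => i _ /=.
rewrite mulr_sumr; apply: eq_bigr => j _ /=.
by rewrite mulr_sumr; apply: eq_bigr => k _ /=; rewrite mxE !mulrA.
Qed.
Opaque curvature.

Lemma gram_gt0 (u v : 'rV[R]_n) : row_free (col_mx u v) ->
  0 < inner (g x) u u * inner (g x) v v - inner (g x) u v ^+ 2.
Proof.
have [_ _ gT gpos] := hg.
move=> /row_free2P free; have v0 : v != 0.
  apply/eqP => v0; have [|_ /eqP] := free 0 1; first by rewrite v0 scaler0 scale0r addr0.
  by rewrite oner_eq0.
have vv := gpos x Bx v v0.
(* Gram-Schmidt without division: <z, z> is <v, v> times the Gram determinant, and z <> 0 by
   independence. *)
set z := inner (g x) v v *: u - inner (g x) u v *: v.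
have z0 : z != 0.
  apply/eqP => z0; have [|vv0 _] := free (inner (g x) v v) (- inner (g x) u v).
    by rewrite scaleNr.
  by rewrite vv0 ltxx in vv.
have := gpos x Bx z z0.
have -> : inner (g x) z z = inner (g x) v v *
    (inner (g x) u u * inner (g x) v v - inner (g x) u v ^+ 2).
  rewrite /z innerBl !innerBr !innerZl !innerZr (inner_sym v u (gT x Bx)).
  by move: (inner _ u u) (inner _ v v) (inner _ u v) => p q r; ring.
by rewrite pmulr_rgt0.
Qed.

(** The difference of the two sides is again an algebraic curvature tensor. Its sectional values
    vanish by the hypothesis on independent pairs, and by skew-symmetry on dependent ones, about
    which the hypothesis says nothing. *)
Lemma constant_curvatureE :
  (forall u v, row_free (col_mx u v) -> sectional g x u v = c) ->
  forall u v w, curvature g x u v w =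
    c *: (inner (g x) v w *: u - inner (g x) u w *: v).
Proof.
have [_ _ gT gpos] := hg; move=> sec u v w; apply/subr0_eq.
pose T u v w z := inner (g x) (curvature g x u v w) z
  - c * (inner (g x) v w * inner (g x) u z - inner (g x) u w * inner (g x) v z).
have T12 u' v' w' z' : T v' u' w' z' = - T u' v' w' z'.
  rewrite /T [curvature _ _ v' u' w'](curvature_antisym hg _ _ _ Bx) innerNl.
  by move: (inner _ _ _) (inner _ v' w') (inner _ u' z') (inner _ u' w') (inner _ v' z') => *; ring.
have TZ a u' v' w' z' : T (a *: u') v' w' z' = a * T u' v' w' z'.
  rewrite /T curvatureZl !innerZl.
  by move: (inner _ _ _) (inner _ v' w') (inner _ u' z') (inner _ u' w') (inner _ v' z') => *; ring.
have T0 : forall u v w z, T u v w z = 0.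
  apply: curvature_polarization => // {u v w}.
  - move=> u v w z; rewrite /T [X in X - _](curvature_skew hg _ _ _ _ Bx).
    rewrite [inner _ z (curvature _ _ _ _ _)](inner_sym _ _ (gT x Bx)).
    by move: (inner _ _ _) (inner _ v w) (inner _ u z) (inner _ u w) (inner _ v z) => *; ring.
  - move=> u v w z; have := curvature_bianchi hg u v w Bx => /(congr1 (fun r => inner (g x) r z)).
    rewrite !innerDl inner0l /T.
    rewrite (inner_sym w u (gT x Bx)) (inner_sym v u (gT x Bx)) (inner_sym w v (gT x Bx)).
    move: (inner _ (curvature _ _ u v w) z) (inner _ (curvature _ _ v w u) z) (inner _ (curvature _ _ w u v) z) => p q r.
    move=> pqr; rewrite -[RHS]pqr.
    by move: (inner _ v w) (inner _ u z) (inner _ u w) (inner _ v z) (inner _ u v) (inner _ w z) => *; ring.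
  - move=> u u' v w z; rewrite /T curvatureDl !innerDl.
    by move: (inner _ _ _) (inner _ _ _) (inner _ v w) (inner _ u z) (inner _ u' z) (inner _ u w) (inner _ u' w) (inner _ v z) => *; ring.
  move=> u v; have [rf|/negP nrf] := boolP (row_free (col_mx u v)).
    have := sec u v rf; rewrite /sectional => /(canRL (divfK _)).
    rewrite gt_eqF ?gram_gt0// => /(_ isT) E.
    rewrite /T E (inner_sym v u (gT x Bx)).
    by move: (inner _ u u) (inner _ v v) (inner _ u v) => *; ring.
  have Tvv w z : T v v w z = 0.
    by have := T12 v v w z => /eqP; rewrite -addr_eq0 -mulr2n mulrn_eq0 => /eqP.
  have [a [b [ab nab]]] : exists a b, a *: u + b *: v = 0 /\ ~ (a = 0 /\ b = 0).
    apply: contrapT => H; apply: nrf; apply/row_free2P => a b ab.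
    by apply: contrapT => nab; apply: H; exists a, b.
  have [a0|a0] := eqVneq a 0.
    have b0 : b != 0 by apply/eqP => b0; apply: nab.
    have v0 : v = 0 *: u.
      move: ab; rewrite a0 !scale0r add0r => /eqP; rewrite scaler_eq0 (negPf b0).
      by move=> /eqP.
    by rewrite -[LHS]opprK -T12 {1}v0 TZ mul0r oppr0.
  have -> : u = (- (b / a)) *: v.
    apply: (scalerI a0); rewrite scalerA mulrN mulrCA divff// mulr1 scaleNr.
    by apply/eqP; rewrite -addr_eq0 ab.
  by rewrite TZ Tvv mulr0.
apply: (inner_eq0 (gpos x Bx)); set z := (X in inner _ _ X).
by rewrite -[RHS](T0 u v w z) /T {1}/z innerBl innerZl innerBl !innerZl.
Qed.

End constant_sectional_curvature.

(** * Surfaces in a space of constant curvature *)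

Section row_blocks.
Context {R : realType} {V : normedModType R} {m n1 n2 : nat}.

Lemma smooth_row_mx (U : set V) (A : V -> 'M[R]_(m, n1)) (C : V -> 'M[R]_(m, n2)) :
  open U -> smooth_on U A -> smooth_on U C -> smooth_on U (fun x => row_mx (A x) (C x)).
Proof.
move=> oU sA sC; apply: smooth_mx => // i j; case: (split_ordP j) => k ->.
  by apply: smooth_eq (smooth_entry oU i k sA) => // x _; rewrite row_mxEl.
by apply: smooth_eq (smooth_entry oU i k sC) => // x _; rewrite row_mxEr.
Qed.

Lemma is_derive_row_mx (A : V -> 'M[R]_(m, n1)) (C : V -> 'M[R]_(m, n2)) x v A' C' :
  is_derive x v A A' -> is_derive x v C C' ->
  is_derive x v (fun y => row_mx (A y) (C y)) (row_mx A' C').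
Proof.
move=> dA dC; apply: is_derive_mx => i j; case: (split_ordP j) => k ->.
  rewrite row_mxEl (_ : (fun y => _) = fun y => A y i k); first exact: is_derive_entry.
  by apply/funext => y; rewrite row_mxEl.
rewrite row_mxEr (_ : (fun y => _) = fun y => C y i k); first exact: is_derive_entry.
by apply/funext => y; rewrite row_mxEr.
Qed.

Lemma matrix_of_linear (L : 'rV[R]_n1 -> 'rV[R]_n2) :
  (forall u v, L (u + v) = L u + L v) -> (forall a u, L (a *: u) = a *: L u) ->
  forall P, P *m (\matrix_(i, j) L (delta_mx 0 i) 0 j) = L P.
Proof.
move=> LD LZ P; have L0 : L 0 = 0 by rewrite -(scale0r 0) LZ scale0r.
rewrite [in RHS](row_sum_delta P) (big_morph L LD L0) mulmx_sum_row.
apply: eq_bigr => i _; rewrite LZ; congr (_ *: _).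
by apply/rowP => j; rewrite !mxE.
Qed.

Lemma eq_mulmx_rows (A C : 'M[R]_(n1, n2)) : (forall P : 'rV_n1, P *m A = P *m C) -> A = C.
Proof. by move=> AC; apply/row_matrixP => i; rewrite !rowE. Qed.

End row_blocks.

Lemma derive_rV2 (R : realType) (W : normedModType R) (f : 'rV[R]_2 -> W) x X :
  differentiable f x -> 'D_X f x =
    X 0 0 *: 'D_(delta_mx 0 0) f x + X 0 ord_max *: 'D_(delta_mx 0 ord_max) f x.
Proof. by move=> df; rewrite derive_rV_sum// rV2_sum. Qed.

(** * The total system for V and s along a surface *)

Section parallel_sections.
Context {R : realType} {n : nat}.
Variables (g : 'rV[R]_n -> 'M[R]_n) (B : set 'rV[R]_n) (c : R).
Hypothesis hg : local_metric g B.
Hypothesis gc : forall y u v w, B y -> curvature g y u v w =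
    c *: (inner (g y) v w *: u - inner (g y) u w *: v).
Variables (U : set 'rV[R]_2) (F : 'rV[R]_2 -> 'rV[R]_n).
Hypotheses (oU : open U) (UB : forall x, U x -> B (F x)) (sF : smooth_on U F).

(** The pair (V, s) is packed as one row of length n + 1. The first block is the derivative of V,
    with the Christoffel term moved to the right-hand side; the last entry is the derivative of
    s. *)
Let step X x (P : 'rV[R]_(n + 1)) : 'rV[R]_(n + 1) :=
  row_mx (- connect g (F x) ('D_X F x) (lsubmx P) - (c * P 0 (rshift n 0)) *: 'D_X F x)
         (\row_(_ < 1) inner (g (F x)) ('D_X F x) (lsubmx P)).

Let stepD X x P Q : step X x (P + Q) = step X x P + step X x Q.
Proof.
rewrite /step raddfD connectDr mxE mulrDr scalerDl opprD opprD addrACA.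
rewrite [RHS]add_row_mx; congr (row_mx _ _).
by apply/rowP => i; rewrite !mxE innerDr.
Qed.

Let stepZ X x a P : step X x (a *: P) = a *: step X x P.
Proof.
rewrite /step linearZ/= connectZr mxE [RHS]scale_row_mx; congr (row_mx _ _).
  by rewrite scalerBr scalerN scalerA mulrCA.
by apply/rowP => i; rewrite !mxE innerZr.
Qed.

Let step_linear x (P : 'rV[R]_(n + 1)) (p q : R) (a b v : 'rV[R]_n) : v = p *: a + q *: b ->
  row_mx (- connect g (F x) v (lsubmx P) - (c * P 0 (rshift n 0)) *: v)
         (\row_(_ < 1) inner (g (F x)) v (lsubmx P)) =
  p *: row_mx (- connect g (F x) a (lsubmx P) - (c * P 0 (rshift n 0)) *: a)
         (\row_(_ < 1) inner (g (F x)) a (lsubmx P)) +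
  q *: row_mx (- connect g (F x) b (lsubmx P) - (c * P 0 (rshift n 0)) *: b)
         (\row_(_ < 1) inner (g (F x)) b (lsubmx P)).
Proof.
move=> ->; rewrite !scale_row_mx [RHS]add_row_mx; apply: f_equal2.
  rewrite connectDl !connectZl; move: (connect _ _ a _) (connect _ _ b _) => u w.
  by apply/rowP => k; rewrite !mxE; ring.
by apply/rowP => i; rewrite !mxE innerDl !innerZl.
Qed.

Let smooth_step X P : smooth_on U (fun x => step X x P).
Proof.
have sDF := smooth_derive X sF; have [oB _ _ _] := hg.
have sc := smooth_cst oU (lsubmx P).
apply: smooth_row_mx => //.
  apply: smoothB => //; first by apply: smoothN => //; exact: (smooth_connect hg oU UB sF sDF sc).
  by apply: smoothZ => //; exact: smooth_cst.
apply: smooth_mx => // i j; apply: smooth_eq (smooth_inner hg oU UB sF sDF sc) => //.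
by move=> x _; rewrite mxE.
Qed.

Let w (i : 'I_2) x : 'M[R]_(n + 1) :=
  \matrix_(a, b) step (delta_mx 0 i) x (delta_mx 0 a) 0 b.

Let wE i x P : P *m w i x = step (delta_mx 0 i) x P.
Proof. by apply: matrix_of_linear => [P' Q|a P']; [exact: stepD|exact: stepZ]. Qed.

Let smooth_w i : smooth_on U (w i).
Proof.
apply: smooth_mx => // a b.
apply: smooth_eq (smooth_entry oU 0 b (smooth_step (delta_mx 0 i) (delta_mx 0 a))) => //.
by move=> x _; rewrite [RHS]mxE.
Qed.

Let derive_step X Y x P : U x -> 'D_X (fun y => step Y y P) x =
  row_mx (- (dconnect g (F x) ('D_X F x) ('D_Y F x) (lsubmx P)
             + connect g (F x) ('D_X ('D_Y F) x) (lsubmx P))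
          - (c * P 0 (rshift n 0)) *: 'D_X ('D_Y F) x)
    (\row_(_ < 1) (inner (g (F x)) (covariant g F ('D_Y F) X x) (lsubmx P)
       + inner (g (F x)) ('D_Y F x) (connect g (F x) ('D_X F x) (lsubmx P)))).
Proof.
move=> Ux; have BF := UB Ux; have dF := smooth_differentiable sF Ux.
have dDF := smooth_differentiable (smooth_derive Y sF) Ux.
have dc : differentiable (cst (lsubmx P) : 'rV[R]_2 -> 'rV[R]_n) x by exact: differentiable_cst.
have D1 := derive_connect hg dF BF X dDF dc.
rewrite derive_cst connect0r addr0 in D1.
have DDF : is_derive x X ('D_Y F) ('D_X ('D_Y F) x) by exact/derivableP/diff_derivable.
have D2 := derive_inner hg dF BF X dDF dc.
rewrite [X in _ + inner _ _ X]covariantE derive_cst add0r in D2.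
have D3 : is_derive x X (fun y => \row_(_ < 1) inner (g (F y)) ('D_Y F y) (lsubmx P) : 'rV[R]_1)
   (\row_(_ < 1) (inner (g (F x)) (covariant g F ('D_Y F) X x) (lsubmx P)
       + inner (g (F x)) ('D_Y F x) (connect g (F x) ('D_X F x) (lsubmx P)))).
  apply: is_derive_mx => i j; rewrite mxE.
  rewrite (_ : (fun y => _) = fun y => inner (g (F y)) ('D_Y F y) (lsubmx P))//.
  by apply/funext => y; rewrite mxE.
have D4 := is_derive_row_mx (is_deriveB (is_deriveN D1) (is_deriveZ (c * P 0 (rshift n 0)) DDF)) D3.
by have [_ <-] := D4.
Qed.

Let balance (d1 d2 q1 q2 e1 e1' e2 e2' e3 e3' u v : 'rV[R]_n) (a b s : R) :
  e1 = e1' -> e2 = e2' -> e3 = e3' -> d1 + q1 - (d2 + q2) = c *: (b *: u - a *: v) ->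
  - (d1 + e2) - s *: e3 + (q2 + s *: e1 - (c * a) *: v) =
  - (d2 + e2') - s *: e3' + (q1 + s *: e1' - (c * b) *: u).
Proof.
move=> -> -> -> E; have -> : d1 = d2 + q2 - q1 + c *: (b *: u - a *: v).
  by rewrite -E; apply/rowP => k; rewrite !mxE; ring.
by apply/rowP => k; rewrite !mxE; ring.
Qed.

(** In the V block the iterated connection terms differ, up to sign, by R(X, Y) V = c (<Y, V> X -
    <X, V> Y), and the derivative of s supplies exactly c <X, V> Y and c <Y, V> X to cancel it. In
    the s block both sides agree because <X, Y> is symmetric and the connection has no torsion. *)
Let flat_step X Y x P : U x ->
  'D_X (fun y => step Y y P) x + step Y x (step X x P) =
  'D_Y (fun y => step X y P) x + step X x (step Y x P).
Proof.
move=> Ux; have BF := UB Ux; have [_ _ gT _] := hg.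
set V := lsubmx P; set s := c * P 0 (rshift n 0).
have stepr Z : step Z x P 0 (rshift n 0) = inner (g (F x)) ('D_Z F x) V.
  by rewrite /step row_mxEr mxE.
have stepl Z : lsubmx (step Z x P) = - connect g (F x) ('D_Z F x) V - s *: 'D_Z F x.
  by rewrite /step row_mxKl.
pose v Z := 'D_Z F x.
have total Z T : 'D_Z (fun y => step T y P) x + step T x (step Z x P) = row_mx
   (- (dconnect g (F x) (v Z) (v T) V + connect g (F x) ('D_Z ('D_T F) x) V) - s *: 'D_Z ('D_T F) x
    + (connect g (F x) (v T) (connect g (F x) (v Z) V) + s *: connect g (F x) (v T) (v Z)
       - (c * inner (g (F x)) (v Z) V) *: v T))
   (\row_(_ < 1) (inner (g (F x)) (covariant g F ('D_T F) Z x) V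
       - s * inner (g (F x)) (v T) (v Z))).
  rewrite [X in X + _](derive_step Z T P Ux) [X in _ + X]/step stepr stepl.
  rewrite [LHS]add_row_mx; congr (row_mx _ _).
    congr (_ + (_ - _)); rewrite -/(v Z) -/(v T) -opprD connectNr opprK.
    by rewrite connectDr connectZr.
  apply/rowP => i; rewrite !mxE -addrA; congr (_ + _).
  rewrite -/(v Z) -/(v T) innerBr innerNr innerZr.
  by rewrite addrA subrr add0r.
apply: etrans (total X Y) _; apply/esym; apply: etrans (total Y X) _; apply/esym.
apply: f_equal2.
  have := gc (v X) (v Y) V BF; rewrite (curvatureE hg _ _ _ BF).
  have e3 := derive_comm X Y oU Ux (sF 2).
  have e2 : connect g (F x) ('D_X ('D_Y F) x) V = connect g (F x) ('D_Y ('D_X F) x) V by rewrite e3.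
  apply: (balance _ (connect_sym hg (v Y) (v X) BF) e2 e3).
apply/rowP => i; rewrite [LHS]mxE [RHS]mxE.
exact: (f_equal2 (fun p q => inner (g (F x)) p V - s * q)
  (covariant_torsion hg oU UB sF X Y Ux) (inner_sym (v Y) (v X) (gT _ BF))).
Qed.

Lemma parallel_section x0 (V0 : 'rV[R]_n) (s0 : R) : U x0 ->
  exists U' (V : 'rV[R]_2 -> 'rV[R]_n) (s : 'rV[R]_2 -> R),
  [/\ [/\ open_nbhs x0 U', U' `<=` U, V x0 = V0 & s x0 = s0],
      smooth_on U' V, smooth_on U' s &
      forall x X, U' x -> covariant g F V X x = - (c * s x) *: 'D_X F x /\
        'D_X s x = inner (g (F x)) ('D_X F x) (V x)].
Proof.
move=> Ux0.
have flat x : U x -> 'D_(delta_mx 0 0) (w ord_max) x + w 0 x *m w ord_max x =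
    'D_(delta_mx 0 ord_max) (w 0) x + w ord_max x *m w 0 x.
  move=> Ux; apply: eq_mulmx_rows => P.
  have D i Z : P *m 'D_Z (w i) x = 'D_Z (fun y => step (delta_mx 0 i) y P) x.
    have dw : is_derive x Z (w i) ('D_Z (w i) x).
      exact/derivableP/diff_derivable/(smooth_differentiable (smooth_w i)).
    have [_] := is_derive_mulmx (is_derive_cst P x Z) dw.
    rewrite mul0mx add0r => <-; congr ('D_Z _ x).
    by apply/funext => y; rewrite wE.
  have E i j : P *m (w i x *m w j x) = step (delta_mx 0 j) x (step (delta_mx 0 i) x P).
    by rewrite mulmxA !wE.
  rewrite [LHS]mulmxDr [RHS]mulmxDr [X in X + _ = _]D [X in _ + X = _]E.
  rewrite [X in _ = X + _]D [X in _ = _ + X]E.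
  exact: flat_step.
have [U' [P [[oU' U'x0] U'U sP P0 DP]]] := local_flat_system (row_mx V0 (s0%:M : 'M[R]_1)) oU Ux0 smooth_w flat.
have sV : smooth_on U' (fun x => lsubmx (P x)).
  apply: smooth_mx => // i j.
  apply: smooth_eq (smooth_entry oU' i (lshift 1 j) sP) => // x _.
  by rewrite mxE.
have ss : smooth_on U' (fun x => P x 0 (rshift n 0)) by exact: smooth_entry.
have DPX x X : U' x -> 'D_X P x = step X x (P x).
  move=> U'x; have dP := smooth_differentiable sP U'x.
  have dF := smooth_differentiable sF (U'U _ U'x).
  apply: etrans (derive_rV2 X dP) _.
  apply: etrans _ (esym (step_linear x (P x) (derive_rV2 X dF))).
  exact: (f_equal2 (fun p q => X 0 0 *: p + X 0 ord_max *: q)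
    (etrans (DP 0 x U'x) (wE 0 x _)) (etrans (DP ord_max x U'x) (wE ord_max x _))).
exists U', (fun x => lsubmx (P x)), (fun x => P x 0 (rshift n 0)); split=> //.
  split=> //; first by rewrite P0 row_mxKl.
  by rewrite P0 row_mxEr mxE eqxx mulr1n.
move=> x X U'x; have dP := smooth_differentiable sP U'x; split.
  rewrite covariantE.
  have -> : 'D_X (fun x => lsubmx (P x)) x = lsubmx ('D_X P x).
    apply/matrixP => i j; rewrite mxE !derive_entry//.
      by congr ('D_X _ x); apply/funext => y; rewrite mxE.
    exact: (smooth_differentiable sV U'x).
  by rewrite (DPX _ _ U'x) /step row_mxKl addrC addrA subrr add0r scaleNr.
rewrite -derive_entry// (DPX _ _ U'x) /step row_mxEr mxE//.
Qed.

End parallel_sections.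

Section cross_product.
Context {R : comNzRingType}.
Implicit Types u v : 'rV[R]_3.

(** The Euclidean cross product of component vectors; indices are added in 'I_3, that is modulo
    3. *)
Definition cross u v : 'rV[R]_3 :=
  \row_k (u 0 (k + 1) * v 0 (k + 2) - u 0 (k + 2) * v 0 (k + 1)).

Lemma sum_ord3 (f : 'I_3 -> R) : \sum_(k < 3) f k = f 0 + f 1 + f 2.
Proof.
rewrite !big_ord_recl big_ord0 addr0 addrA.
by congr (_ + f _ + f _); exact: val_inj.
Qed.

Let idx : (((0 + 1)%R = 1%R :> 'I_3) * ((1 + 1)%R = 2%R :> 'I_3) *
  ((2 + 1)%R = 0%R :> 'I_3) * ((0 + 2)%R = 2%R :> 'I_3) *
  ((1 + 2)%R = 0%R :> 'I_3) * ((2 + 2)%R = 1%R :> 'I_3))%type.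
Proof. by do !split; exact: val_inj. Qed.

Lemma cross_orthl u v : \sum_(k < 3) u 0 k * cross u v 0 k = 0.
Proof.
by rewrite sum_ord3 !mxE !idx; ring.
Qed.

Lemma cross_orthr u v : \sum_(k < 3) v 0 k * cross u v 0 k = 0.
Proof.
by rewrite sum_ord3 !mxE !idx; ring.
Qed.

Lemma cross_eq0 u v : cross u v = 0 -> forall k, v 0 k *: u = u 0 k *: v.
Proof.
move=> /rowP uv0; have := uv0 0; have := uv0 1; have := uv0 2.
rewrite !mxE !idx => /subr0_eq h2 /subr0_eq h1 /subr0_eq h0.
have ord3 (k : 'I_3) : [\/ k = 0, k = 1 | k = 2].
  by case: k => [[|[|[|//]]] k3]; [constructor 1|constructor 2|constructor 3]; exact: val_inj.
move=> k; apply/rowP => l; rewrite !mxE.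
by have [->|->|->] := ord3 k; have [->|->|->] := ord3 l;
  rewrite ?h0 ?h1 ?h2 1?mulrC// ?h0 ?h1 ?h2 1?mulrC.
Qed.

End cross_product.

Opaque inner derive covariant connect dconnect curvature.

Section covariant_rules.
Context {R : realType} {n : nat} {V : normedModType R}.
Variables (g : 'rV[R]_n -> 'M[R]_n) (F : V -> 'rV[R]_n) (x : V).
Hypothesis dF : differentiable F x.

Lemma derive_linear (W : normedModType R) (f : V -> W) a b X Y :
  differentiable f x -> 'D_(a *: X + b *: Y) f x = a *: 'D_X f x + b *: 'D_Y f x.
Proof. by move=> df; rewrite !deriveE// linearD !linearZ. Qed.

Lemma covariant_linear N a b X Y : differentiable N x ->
  covariant g F N (a *: X + b *: Y) x = a *: covariant g F N X x + b *: covariant g F N Y x.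
Proof.
move=> dN; rewrite [LHS]covariantE [X in _ = _ *: X + _]covariantE.
rewrite [X in _ = _ + _ *: X]covariantE (derive_linear _ _ _ _ dN).
rewrite !scalerDr addrACA; congr (_ + _).
have key w : connect g (F x) (a *: 'D_X F x + b *: 'D_Y F x) w =
    a *: connect g (F x) ('D_X F x) w + b *: connect g (F x) ('D_Y F x) w.
  exact: etrans (connectDl _ _ _ _ _) (f_equal2 _ (connectZl _ _ _ _ _) (connectZl _ _ _ _ _)).
exact: etrans (f_equal (fun u => connect g (F x) u (N x)) (derive_linear _ _ _ _ dF)) (key _).
Qed.

Lemma derive_scale (m : V -> R) (W : V -> 'rV[R]_n) X : differentiable m x ->
  differentiable W x -> 'D_X (fun y => m y *: W y) x = 'D_X m x *: W x + m x *: 'D_X W x.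
Proof.
move=> dm dW; suff [] : is_derive x X (fun y => m y *: W y) ('D_X m x *: W x + m x *: 'D_X W x) by [].
apply: is_derive_mx => i j.
rewrite (_ : (fun y => _) = m * (fun y => W y i j)); last by apply/funext => y; rewrite mxE.
have Dm : is_derive x X m ('D_X m x) by exact/derivableP/diff_derivable.
have DW : is_derive x X (fun y => W y i j) ('D_X W x i j).
  by apply: is_derive_entry; exact/derivableP/diff_derivable.
apply: (is_derive_eq (is_deriveM Dm DW)); rewrite !mxE addrC.
by congr (_ + _); rewrite mulrC.
Qed.

Lemma covariant_scale (m : V -> R) (W : V -> 'rV[R]_n) X : differentiable m x ->
  differentiable W x -> covariant g F (fun y => m y *: W y) X x =
    'D_X m x *: W x + m x *: covariant g F W X x.
Proof.
move=> dm dW; rewrite [LHS]covariantE derive_scale// connectZr -addrA -scalerDr.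
by rewrite [X in _ = _ + _ *: X]covariantE.
Qed.

Lemma covariantB (A C : V -> 'rV[R]_n) X : differentiable A x -> differentiable C x ->
  covariant g F (fun y => A y - C y) X x = covariant g F A X x - covariant g F C X x.
Proof.
move=> dA dC; rewrite [LHS]covariantE [X in _ = X - _]covariantE [X in _ = _ - X]covariantE.
rewrite connectDr connectNr opprD addrACA; congr (_ + _).
by rewrite [LHS]deriveB//; exact: diff_derivable.
Qed.

Lemma near_eq_covariant (A D : V -> 'rV[R]_n) X :
  (\near x, A x = D x) -> covariant g F A X x = covariant g F D X x.
Proof.
move=> AD; rewrite [LHS]covariantE [RHS]covariantE (near_eq_derive _ AD).
by rewrite (nbhs_singleton AD).
Qed.

End covariant_rules.

Lemma ord2P (i : 'I_2) : i = 0 \/ i = ord_max.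
Proof. by case: i => [[|[|//]] i2]; [left|right]; exact: val_inj. Qed.

Lemma eq_rV2 (T : Type) (u v : 'rV[T]_2) :
  u 0 0 = v 0 0 -> u 0 ord_max = v 0 ord_max -> u = v.
Proof.
by move=> e0 e1; apply/rowP => i; have [->|->] := ord2P i.
Qed.

Lemma rV2_decomp_at (R : realType) (i : 'I_2) (v : 'rV[R]_2) :
  v = v 0 i *: delta_mx 0 i + v 0 (rev_ord i) *: delta_mx 0 (rev_ord i).
Proof.
by case: i => [[|[|//]] i2]; apply: eq_rV2; rewrite !mxE /= ?mulr1 ?mulr0 ?addr0 ?add0r;
  congr (v _ _); exact: val_inj.
Qed.

(** Both vectors lie in the kernel of one non-zero linear form on the plane, so their determinant
    vanishes; a non-zero coordinate of [Y] then gives the factor. *)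
Lemma proportional_rV2 (K : fieldType) (a b : K) (T Y : 'rV[K]_2) :
  a != 0 \/ b != 0 -> T 0 0 * a + T 0 ord_max * b = 0 ->
  Y 0 0 * a + Y 0 ord_max * b = 0 -> Y != 0 -> exists k, T = k *: Y.
Proof.
move=> ab Tab Yab Y0.
have det0 : T 0 0 * Y 0 ord_max = T 0 ord_max * Y 0 0.
  move: Tab Yab; move: (T 0 0) (T 0 ord_max) (Y 0 0) (Y 0 ord_max) => p q r s.
  move=> /eqP; rewrite addr_eq0 => /eqP pa /eqP; rewrite addr_eq0 => /eqP ra.
  case: ab => n0; apply: (mulfI n0).
    by rewrite mulrA [a * p]mulrC pa [RHS]mulrCA [a * r]mulrC ra; ring.
  have qb : q * b = - (p * a) by rewrite pa opprK.
  have sb : s * b = - (r * a) by rewrite ra opprK.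
  by rewrite [LHS]mulrCA [b * s]mulrC sb mulrA [b * q]mulrC qb; ring.
have [Y00|Y00] := eqVneq (Y 0 0) 0; last first.
  exists (T 0 0 / Y 0 0); apply: eq_rV2; rewrite mxE ?divfK//.
  by rewrite mulrAC det0 mulfK.
have [Y01|Y01] := eqVneq (Y 0 ord_max) 0.
  by move: Y0; rewrite (_ : Y = 0) ?eqxx//; apply: eq_rV2; rewrite mxE.
exists (T 0 ord_max / Y 0 ord_max); apply: eq_rV2; rewrite mxE ?divfK//.
by rewrite mulrAC -det0 mulfK.
Qed.

Lemma near_derive_neq0 (R : realType) (V : normedModType R) (U : set V)
    (h : V -> R) x0 v : open U -> smooth_on U h -> U x0 -> 'D_v h x0 != 0 ->
  exists2 d, 0 < d & forall x, ball x0 d x -> U x /\ 'D_v h x != 0.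
Proof.
move=> oU sh Ux0 h0.
have : \forall x \near x0, U x /\ 'D_v h x != 0.
  near=> x; split; first by near: x; exact: open_nbhs_nbhs.
  rewrite -normr_gt0; near: x.
  apply: (@cvgr_gt R _ (nbhs x0) _ (fun x => `|'D_v h x|) `|'D_v h x0|).
    by apply: cvg_norm; exact: (smooth_continuous (smooth_derive v sh) Ux0).
  by rewrite normr_gt0.
by move=> /nbhs_ballP[d /= d0 dP]; exists d.
Unshelve. all: by end_near. Qed.

(** * Unit normals, the Codazzi equation and ruling data in the two cases *)

Section surface.
Context {R : realType}.
Variables (g : 'rV[R]_3 -> 'M[R]_3) (B : set 'rV[R]_3) (c : R).
Hypothesis hg : local_metric g B.
Hypothesis gc : forall y u v w, B y -> curvature g y u v w =
    c *: (inner (g y) v w *: u - inner (g y) u w *: v).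
Variables (U : set 'rV[R]_2) (F : 'rV[R]_2 -> 'rV[R]_3).
Hypotheses (oU : open U) (UB : forall x, U x -> B (F x)) (sF : smooth_on U F).
Hypothesis imm : forall x X, U x -> 'D_X F x = 0 -> X = 0.

Let gT x : U x -> (g (F x))^T = g (F x).
Proof. by move=> /UB Bx; have [_ _ h _] := hg; exact: h. Qed.

Let gpos x : U x -> pos_def (g (F x)).
Proof. by move=> /UB Bx; have [_ _ _ h] := hg; exact: h. Qed.

Let dF x : U x -> differentiable F x.
Proof. exact: smooth_differentiable. Qed.

(** The cross product of the coordinate tangents, read as a covector, annihilates the tangent plane.
    The inverse metric turns it into a normal vector, non-zero because the map is an immersion, and
    it remains to normalize. *)
Lemma exists_unit_normal : exists N, smooth_on U N /\ forall x, U x ->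
  inner (g (F x)) (N x) (N x) = 1 /\ forall X, inner (g (F x)) ('D_X F x) (N x) = 0.
Proof.
have [oB sg _ _] := hg.
pose u x := 'D_(delta_mx 0 0) F x; pose v x := 'D_(delta_mx 0 ord_max) F x.
have su : smooth_on U u by exact: smooth_derive.
have sv : smooth_on U v by exact: smooth_derive.
pose M x := cross (u x) (v x) *m invmx (g (F x)).
have sgF : smooth_on U (g \o F) by exact: (smooth_comp oU oB UB sF sg).
have gunit x : U x -> g (F x) \in unitmx by move=> /gpos/pos_def_unitmx.
have sM : smooth_on U M.
  apply: smooth_mulmx => //; last exact: (smooth_invmx oU gunit sgF).
  apply: smooth_mx => // i j.
  have := smoothB oU (smoothM oU (smooth_entry oU 0 (j + 1) su) (smooth_entry oU 0 (j + 2) sv))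
    (smoothM oU (smooth_entry oU 0 (j + 2) su) (smooth_entry oU 0 (j + 1) sv)).
  by apply: smooth_eq => // x _; rewrite [RHS]mxE.
have uE x : 'D_(delta_mx 0 0) F x = u x by [].
have vE x : 'D_(delta_mx 0 ord_max) F x = v x by [].
have innerM x w : U x -> inner (g (F x)) w (M x) = \sum_(k < 3) w 0 k * cross (u x) (v x) 0 k.
  move=> Ux; rewrite inner_sym ?gT// inner_mulmx mulmxKV ?gunit//.
  by apply: eq_bigr => k _; rewrite mulrC.
have tanM x X : U x -> inner (g (F x)) ('D_X F x) (M x) = 0.
  move=> Ux; have key a b : inner (g (F x)) (a *: u x + b *: v x) (M x) = 0.
    have iu := etrans (innerM x (u x) Ux) (cross_orthl _ _).
    have iv := etrans (innerM x (v x) Ux) (cross_orthr _ _).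
    apply: etrans (innerDl _ _ _ _) _; rewrite [X in X + _]innerZl [X in _ + X]innerZl.
    by rewrite iu iv !mulr0 addr0.
  exact: etrans (f_equal (fun w => inner (g (F x)) w (M x)) (derive_rV2 X (dF Ux))) (key _ _).
have M0 x : U x -> M x != 0.
  move=> Ux; apply/eqP => Mx0.
  have cr0 : cross (u x) (v x) = 0.
    by rewrite -[LHS](mulmxKV (gunit x Ux)) -/(M x) Mx0 mul0mx.
  have uv0 k : u x 0 k = 0.
    have := imm (x := x) (X := v x 0 k *: delta_mx 0 0 + (- u x 0 k) *: delta_mx 0 ord_max) Ux.
    rewrite (derive_linear _ _ _ _ (dF Ux)) uE vE (cross_eq0 cr0 k) scaleNr subrr.
    move=> /(_ erefl) /rowP /(_ ord_max); rewrite !mxE /= mulr0 mulr1 add0r.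
    by move=> /eqP; rewrite oppr_eq0 => /eqP.
  have u0 : 'D_(delta_mx 0 0) F x = 0 by apply/rowP => k; rewrite uE uv0 mxE.
  have := imm Ux u0 => /rowP/(_ 0); rewrite !mxE eqxx.
  by move=> /eqP; rewrite oner_eq0.
pose q x := inner (g (F x)) (M x) (M x).
have q0 x : U x -> 0 < q x by move=> Ux; apply: gpos => //; exact: M0.
have sq : smooth_on U q by exact: (smooth_inner hg oU UB sF sM sM).
exists (fun x => (Num.sqrt (q x))^-1 *: M x); split.
  apply: smoothZ => //; apply: smoothV => //; last exact: smooth_sqrt.
  by move=> x Ux; rewrite gt_eqF// sqrtr_gt0 q0.
move=> x Ux; split=> [|X]; last by rewrite innerZr tanM// mulr0.
rewrite innerZl innerZr -/(q x) mulrA -expr2 exprVn sqr_sqrtr ?ltW ?q0//.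
by rewrite mulVf// gt_eqF// q0.
Qed.

Variable N : 'rV[R]_2 -> 'rV[R]_3.
Hypotheses (sN : smooth_on U N)
  (N1 : forall x, U x -> inner (g (F x)) (N x) (N x) = 1)
  (NT : forall x X, U x -> inner (g (F x)) ('D_X F x) (N x) = 0).

Let dN x : U x -> differentiable N x.
Proof. exact: smooth_differentiable. Qed.

(** Differentiating <N, Y> = 0 gives <nabla_X N, Y> = - <N, nabla_X Y>, which is symmetric because
    the connection has no torsion. *)
Lemma shape_selfadjoint x X Y : U x ->
  inner (g (F x)) (covariant g F N X x) ('D_Y F x) =
  inner (g (F x)) (covariant g F N Y x) ('D_X F x).
Proof.
move=> Ux.
have key Z T : inner (g (F x)) (covariant g F N Z x) ('D_T F x) =
    - inner (g (F x)) (covariant g F ('D_T F) Z x) (N x).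
  have dDF := smooth_differentiable (smooth_derive T sF) Ux.
  have [_] := derive_inner hg (dF Ux) (UB Ux) Z dDF (dN Ux).
  have -> : 'D_Z (fun y => inner (g (F y)) ('D_T F y) (N y)) x = 0.
    rewrite (near_eq_derive (g := cst 0)) ?derive_cst//.
    by apply: open_near oU Ux _ => y Uy; rewrite NT.
  move/esym/eqP; rewrite addrC addr_eq0 => /eqP <-.
  by rewrite inner_sym// gT.
apply: etrans (key X Y) _; apply: etrans _ (esym (key Y X)).
exact: (f_equal (fun p => - inner (g (F x)) p (N x)) (covariant_torsion hg oU UB sF X Y Ux)).
Qed.

(** The Codazzi equation: R(X, Y) N = c (<Y, N> X - <X, N> Y), and both products vanish for tangent
    X and Y. *)
Lemma normal_covariant_comm x X Y : U x ->
  covariant g F (covariant g F N Y) X x = covariant g F (covariant g F N X) Y x.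
Proof.
move=> Ux; apply/subr0_eq; apply: etrans (covariant_comm hg oU UB sF sN X Y Ux) _.
rewrite gc; last exact: UB.
by rewrite (NT Y Ux) (NT X Ux) !scale0r subrr scaler0.
Qed.

(* W is tangent to the surface, up to a normal component, and transverse to the
   leaves h = const; along a leaf it stays orthogonal to the leaf, which forces
   the leaf to be a geodesic. *)
Definition ruling_data (O : set 'rV[R]_2) (i : 'I_2) (h : 'rV[R]_2 -> R)
    (W : 'rV[R]_2 -> 'rV[R]_3) : Prop :=
  [/\ smooth_on O h, smooth_on O W, forall x, O x -> 'D_(delta_mx 0 i) h x != 0 &
   forall x, O x -> (exists X, inner (g (F x)) (W x) ('D_X F x) != 0) /\
     forall T, 'D_T h x = 0 -> [/\ inner (g (F x)) (W x) ('D_T F x) = 0,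
       inner (g (F x)) (covariant g F W T x) ('D_T F x) = 0 &
       inner (g (F x)) (covariant g F N T x) ('D_T F x) = 0]].

Lemma planar_ruling_data x0 : U x0 -> (forall x X, U x -> covariant g F N X x = 0) ->
  exists O i h W, [/\ open_nbhs x0 O, O `<=` U & ruling_data O i h W].
Proof.
move=> Ux0 flat; set e0 : 'rV[R]_2 := delta_mx 0 0.
(* The initial values are (d_0 F, 0) here and (0, 1) for the second solution: h then vanishes at
   [x0] with gradient d_0 F, and its denominator [s2] is non-zero nearby. *)
have [U1 [V1 [s1 [[[oU1 U1x0] U1U V10 s10] sV1 ss1 P1]]]] :=
  parallel_section hg gc oU UB sF ('D_e0 F x0) 0 Ux0.
have [U2 [V2 [s2 [[[oU2 U2x0] U2U V20 s20] sV2 ss2 P2]]]] :=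
  parallel_section hg gc oU UB sF 0 1 Ux0.
have near2 : \forall x \near x0, [/\ U1 x, U2 x & s2 x != 0].
  near=> x; split; [by near: x; exact: open_nbhs_nbhs|by near: x; exact: open_nbhs_nbhs|].
  rewrite gt_eqF//; near: x; apply: (@cvgr_gt R _ (nbhs x0) _ s2 (s2 x0)).
    exact: (smooth_continuous ss2 U2x0).
  by rewrite s20.
have /nbhs_ballP[d /= d0 dP] := near2.
have oO := @ball_open _ _ x0 d.
have sub1 : ball x0 d `<=` U1 by move=> x /dP[].
have sub2 : ball x0 d `<=` U2 by move=> x /dP[].
pose h x := s1 x * (s2 x)^-1.
have sh : smooth_on (ball x0 d) h.
  apply: smoothM => //; first exact: smooth_subset ss1.
  by apply: smoothV => //; [by move=> x /dP[]|exact: smooth_subset ss2].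
pose W x := V1 x - h x *: V2 x.
have sW : smooth_on (ball x0 d) W.
  apply: smoothB => //; first exact: smooth_subset sV1.
  by apply: smoothZ => //; exact: smooth_subset sV2.
have hs x : ball x0 d x -> h x * s2 x = s1 x.
  by move=> /dP[_ _ s0]; rewrite /h -mulrA mulVf// mulr1.
(* <W, dF(X)> = ds1(X) - h ds2(X) = s2 dh(X): a vector is tangent to a level curve exactly when its
   image is orthogonal to W. *)
have DW x X : ball x0 d x -> inner (g (F x)) (W x) ('D_X F x) = 'D_X h x * s2 x.
  move=> xd; have Ux := U1U _ (sub1 _ xd).
  have dh := smooth_differentiable sh xd; have ds2 := smooth_differentiable ss2 (sub2 _ xd).
  have E : 'D_X s1 x = h x * 'D_X s2 x + s2 x * 'D_X h x.
    rewrite (near_eq_derive (g := fun y => h y * s2 y)); last first.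
      by apply: open_near oO xd _ => y yd; rewrite hs.
    by rewrite [LHS]deriveM//; exact: diff_derivable.
  have [_ D1] := P1 x X (sub1 _ xd); have [_ D2] := P2 x X (sub2 _ xd).
  rewrite inner_sym ?gT// innerBr innerZr -D1 -D2 E.
  by rewrite addrC addrA addNr add0r mulrC.
have Wx0 : 'D_e0 h x0 != 0.
  have xd : ball x0 d x0 by exact: ballxx.
  have : inner (g (F x0)) (W x0) ('D_e0 F x0) != 0.
    rewrite /W V20 scaler0 subr0 V10 gt_eqF//; apply: gpos => //.
    apply/eqP => /(imm Ux0) /rowP/(_ 0); rewrite !mxE eqxx => /eqP.
    by rewrite oner_eq0.
  by rewrite DW// mulf_eq0 negb_or => /andP[].
have [d' d'0 d'P] := near_derive_neq0 oO sh (ballxx _ d0) Wx0.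
exists (ball x0 d'), 0, h, W; split.
- exact: ball_open_nbhs.
- by move=> x /d'P[/sub1/U1U].
split.
- by apply: smooth_subset sh => x /d'P[].
- by apply: smooth_subset sW => x /d'P[].
- by move=> x /d'P[].
move=> x /d'P[xd hx]; have [U1x U2x s2x] := dP x xd; have Ux := U1U _ U1x; split.
  by exists e0; rewrite DW// mulf_neq0.
move=> T hT; have W1 : inner (g (F x)) (W x) ('D_T F x) = 0 by rewrite DW// hT mul0r.
split=> //; last by rewrite flat// inner0l.
have dV1 := smooth_differentiable sV1 U1x; have dV2 := smooth_differentiable sV2 U2x.
have dh := smooth_differentiable sh xd.
have dhV2 : differentiable (fun y => h y *: V2 y) x.
  have : smooth_on (ball x0 d) (fun y => h y *: V2 y).
    by apply: smoothZ => //; exact: smooth_subset sV2.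
  by move=> /smooth_differentiable; exact.
(* With dh(T) = 0 this derivative is - c (s1 - h s2) dF(T), and s1 = h s2. *)
have -> : covariant g F W T x = 0.
  rewrite (covariantB g F _ dV1 dhV2) (covariant_scale g F _ dh dV2) hT.
  have [-> _] := P1 x T U1x; have [-> _] := P2 x T U2x.
  rewrite scale0r add0r scalerA -scalerBl -(hs _ xd).
  by rewrite mulrN opprK mulrCA addNr scale0r.
by rewrite inner0l.
Unshelve. all: by end_near. Qed.

Lemma parabolic_ruling_data x0 X0 : U x0 ->
  (forall x, U x -> exists2 A : 'M[R]_2, \det A = 0 &
    forall X, 'D_(X *m A) F x = - covariant g F N X x) ->
  covariant g F N X0 x0 != 0 ->
  exists O i h W, [/\ open_nbhs x0 O, O `<=` U & ruling_data O i h W].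
Proof.
move=> Ux0 shape NX0.
have [U1 [V [s [[[oU1 U1x0] U1U Vx0 _] sV ss P]]]] :=
  parallel_section hg gc oU UB sF (covariant g F N X0 x0) 0 Ux0.
have sN1 := smooth_subset U1U sN; have sF1 := smooth_subset U1U sF.
have UB1 x : U1 x -> B (F x) by move=> /U1U/UB.
pose h x := inner (g (F x)) (N x) (V x).
have sh : smooth_on U1 h by exact: (smooth_inner hg oU1 UB1 sF1 sN1 sV).
(* The other term, <N, nabla_X V> = - c s <N, dF(X)>, vanishes because N is normal. *)
have Dh x X : U1 x -> 'D_X h x = inner (g (F x)) (covariant g F N X x) (V x).
  move=> U1x; have Ux := U1U _ U1x; have dV := smooth_differentiable sV U1x.
  have [_ ->] := derive_inner hg (dF Ux) (UB Ux) X (dN Ux) dV.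
  have [-> _] := P x X U1x; rewrite innerZr.
  by rewrite [inner _ (N x) _](inner_sym _ _ (gT Ux)) (NT X Ux) mulr0 addr0.
have [i hi] : exists i, 'D_(delta_mx 0 i) h x0 != 0.
  have : 'D_X0 h x0 != 0.
    by rewrite (Dh _ _ U1x0) Vx0 gt_eqF//; exact: (gpos Ux0).
  rewrite (derive_rV2 X0 (smooth_differentiable sh U1x0)) => h0.
  have [E|] := eqVneq ('D_(delta_mx 0 0) h x0) 0; last by exists 0.
  exists ord_max; apply: contraNneq h0 => E1.
  by rewrite E E1 !scaler0 addr0.
have [d d0 dP] := near_derive_neq0 oU1 sh U1x0 hi.
pose O := ball x0 d; have oO : open O by exact: ball_open.
have OU1 : O `<=` U1 by move=> x /dP[].
have OU : O `<=` U by move=> x /OU1/U1U.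
(* The vanishing determinant gives Y <> 0 with Y A = 0, hence nabla_Y N = 0 and dh(Y) = 0. As dh
   does not vanish on [O], its kernel is the line spanned by Y. *)
have kerh x T : O x -> 'D_T h x = 0 -> covariant g F N T x = 0.
  move=> Ox hT; have [U1x hx] := dP x Ox; have Ux := U1U _ U1x.
  have dh := smooth_differentiable sh U1x.
  have [A /eqP/det0P[Y Y0 YA] AP] := shape x Ux.
  have NY : covariant g F N Y x = 0.
    apply/eqP; rewrite -oppr_eq0 -AP YA; apply/eqP.
    by have := derive_linear 0 0 0 0 (dF Ux); rewrite !scale0r !addr0.
  have hY : 'D_Y h x = 0 by rewrite (Dh _ _ U1x) NY inner0l.
  have [k ->] : exists k, T = k *: Y + 0 *: Y.
    have [hT' hY'] := (hT, hY).
    rewrite (derive_rV2 _ dh) in hT'; rewrite (derive_rV2 _ dh) in hY'.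
    have [|k ->] := proportional_rV2 _ hT' hY' Y0; last by exists k; rewrite scale0r addr0.
    by case: (ord2P i) => ei; [left|right]; rewrite -ei.
  by rewrite (covariant_linear g (dF Ux) _ _ _ _ (dN Ux)) NY !scaler0 addr0.
pose e : 'rV[R]_2 := delta_mx 0 i; pose f : 'rV[R]_2 := delta_mx 0 (rev_ord i).
pose W := covariant g F N e.
have sW : smooth_on U W by exact: (smooth_covariant hg _ oU UB sF sN).
have W0 x : O x -> W x != 0.
  move=> Ox; have [U1x hx] := dP x Ox; apply: contraNneq hx => Wx.
  by rewrite (Dh _ _ U1x) -/(W x) Wx inner0l.
(* The vector f - m e lies in the kernel of dh, so nabla_f N = m nabla_e N = m W. *)
pose m x := 'D_f h x * ('D_e h x)^-1.
have sm : smooth_on O m.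
  apply: smoothM => //; first by apply: smooth_derive; exact: smooth_subset sh.
  apply: smoothV => //; first by move=> x /dP[].
  by apply: smooth_derive; exact: smooth_subset sh.
have Nf x : O x -> covariant g F N f x = m x *: W x.
  move=> Ox; have [U1x hx] := dP x Ox; have Ux := U1U _ U1x.
  have : covariant g F N (1 *: f + (- m x) *: e) x = 0.
    apply: kerh => //; rewrite (derive_linear _ _ _ _ (smooth_differentiable sh U1x)).
    by rewrite scale1r scaleNr /m /GRing.scale/= divfK// subrr.
  rewrite (covariant_linear g (dF Ux) _ _ _ _ (dN Ux)) scale1r scaleNr.
  by move=> /subr0_eq.
exists O, i, h, W; split=> //; first exact: ball_open_nbhs.
split.
- exact: smooth_subset sh.
- exact: smooth_subset sW.
- by move=> x /dP[].
move=> x Ox; have Ux := OU _ Ox; have [U1x hx] := dP x Ox; split.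
  (* Here dF(e A) = - W, so the product is - <W, W>, which is non-zero. *)
  have [A _ AP] := shape x Ux; exists (e *m A).
  by rewrite AP innerNr oppr_eq0 gt_eqF//; apply: (gpos Ux); exact: W0.
move=> T hT; have NT0 := kerh x T Ox hT.
have W1 : inner (g (F x)) (W x) ('D_T F x) = 0.
  by rewrite /W (shape_selfadjoint _ _ Ux) NT0 inner0l.
split; [exact: W1| |by rewrite NT0 inner0l].
have TE : T = T 0 i *: e + T 0 (rev_ord i) *: f := rV2_decomp_at i T.
have ab : T 0 i = - (T 0 (rev_ord i) * m x).
  have := derive_linear (T 0 i) (T 0 (rev_ord i)) e f (smooth_differentiable sh U1x).
  rewrite -TE hT => /esym/eqP; rewrite addr_eq0 => /eqP E.
  by apply: (mulIf hx); rewrite mulNr -mulrA divfK.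
move: (T 0 i) (T 0 (rev_ord i)) TE ab => a b TE ab.
have dm := smooth_differentiable sm Ox; have dW := smooth_differentiable sW Ux.
(* By Codazzi nabla_f W is nabla_e of nabla_f N = m W, so only nabla_e W occurs on the right. *)
have Wf : covariant g F W f x = 'D_e m x *: W x + m x *: covariant g F W e x.
  apply: etrans (normal_covariant_comm _ _ Ux) _.
  apply: etrans (near_eq_covariant _ _ (D := fun y => m y *: W y) _ _) _.
    by apply: open_near oO Ox _ => y Oy; exact: Nf.
  exact: covariant_scale.
(* As T = b (f - m e), the two terms with nabla_e W cancel and a multiple of W remains, which is
   orthogonal to dF(T) by [W1]. *)
have -> : covariant g F W T x = (b * 'D_e m x) *: W x.
  have cancel (p q : 'rV[R]_3) (d' m' : R) :
      - (b * m') *: q + b *: (d' *: p + m' *: q) = (b * d') *: p.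
    by apply/rowP => k; rewrite !mxE; ring.
  apply: etrans (f_equal (fun Z => covariant g F W Z x) TE) _.
  apply: etrans (covariant_linear g (dF Ux) a b e f dW) _.
  by rewrite Wf ab; exact: cancel.
by rewrite innerZl W1 mulr0.
Qed.

End surface.

(** * Flow boxes and arclength *)

Section inverse_function.
Context {R : realType}.

Lemma mean_value_line (V : normedModType R) (h : V -> R) (y u : V) (a b : R) :
  a <= b -> (forall t, a <= t <= b -> differentiable h (y + t *: u)) ->
  exists2 t, a <= t <= b &
    h (y + b *: u) - h (y + a *: u) = 'D_u h (y + t *: u) * (b - a).
Proof.
move=> ab dh.
have di t : a <= t <= b -> is_derive t 1 (fun s => h (y + s *: u)) ('D_u h (y + t *: u)).
  by move=> tab; apply: is_derive_line; exact: dh.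
have [t|t|t tab ->] := @MVT_segment R (fun s => h (y + s *: u)) (fun t => 'D_u h (y + t *: u)) a b ab.
- by rewrite in_itv/= => /andP[/ltW at_ /ltW tb]; apply: di; rewrite at_.
- apply: derivable_within_continuous => {}t; rewrite in_itv/= => tab.
  by have [] := di t tab.
- by exists t => //; move: tab; rewrite in_itv.
Qed.

Lemma smooth_jacobian n m (U : set 'rV[R]_n) (H : 'rV[R]_n -> 'rV[R]_m) :
  open U -> smooth_on U H -> smooth_on U (jacobian H).
Proof.
move=> oU sH; apply: smooth_mx => // i j.
apply: smooth_eq (smooth_entry oU 0 j (smooth_derive (delta_mx 0 i) sH)) => // x.
rewrite inE => Ux; rewrite deriveEjacobian; last exact: (smooth_differentiable sH).
by rewrite -rowE mxE.
Qed.

(** The Jacobian is invertible, so the error of G is the inverse Jacobian applied to the error of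
    [H] at G y. The Lipschitz bound makes an error small relative to G z - G y small relative to z -
    y. *)
Lemma lipschitz_inverse_diff n (H G : 'rV[R]_n -> 'rV[R]_n) (D : set 'rV[R]_n) y (L : R) :
  open D -> D y -> (forall z, D z -> H (G z) = z) ->
  (forall z, D z -> `|G z - G y| <= L * `|z - y|) ->
  differentiable H (G y) -> jacobian H (G y) \in unitmx ->
  is_diff y G (mulmxr (invmx (jacobian H (G y)))).
Proof.
move=> oD Dy HG GL dH Ju; set J := jacobian H (G y) in Ju *.
have L0 : 0 <= `|L| + 1 by rewrite addr_ge0.
have cG : {for y, continuous G}.
  apply/(@cvgrPdist_le _ _ _ (nbhs y)) => e e0.
  have eL : 0 < e / (`|L| + 1) by rewrite divr_gt0// ltr_wpDl.
  have near_y := @cvgr_dist_le _ _ _ (nbhs y) _ id y cvg_id _ eL.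
  have nearD : \forall z \near y, D z by exact: (open_near oD Dy (fun _ => id)).
  near=> z; have Dz : D z by near: z.
  have zy : `|y - z| <= e / (`|L| + 1) by near: z; exact: near_y.
  rewrite distrC (le_trans (GL z Dz))//.
  rewrite (@le_trans _ _ ((`|L| + 1) * `|z - y|))//.
    by rewrite ler_wpM2r// (le_trans (ler_norm _))// lerDl.
  by rewrite mulrC -ler_pdivlMr ?ltr_wpDl// distrC.
apply: is_diff_norm.
  apply: (@mulmx_continuous R 1 n n _ id (cst (invmx J))); last exact: cst_continuous.
  by move=> z; exact: cvg_id.
move=> e e0; set K := n%:R * `|invmx J| * (`|L| + 1) + 1.
have K0 : 0 < K by rewrite ltr_wpDl// !mulr_ge0.
have eK : 0 < e / K by rewrite divr_gt0.
have /(_ _ eK) nearH := @diff_norm_le _ _ _ H (G y) ^~ dH.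
near=> z; have Dz : D z by near: z; exact: open_nbhs_nbhs.
have HGz : `|H (G z) - H (G y) - 'd H (G y) (G z - G y)| <= e / K * `|G z - G y|.
  by near: z; exact: (cG _ nearH).
have dHE w : 'd H (G y) w = w *m J by rewrite /J /jacobian mul_rV_lin1.
rewrite !HG// dHE in HGz.
rewrite /= -[G z - G y](mulmxK Ju) -mulmxBl.
rewrite (le_trans (mulmx_norm _ _))// distrC.
rewrite (@le_trans _ _ (n%:R * `|invmx J| * (e / K * ((`|L| + 1) * `|z - y|))))//.
  apply: ler_wpM2l; first by rewrite mulr_ge0.
  rewrite (le_trans HGz)// ler_wpM2l ?(ltW eK)//.
  rewrite (le_trans (GL z Dz))// ler_wpM2r//.
  by rewrite (le_trans (ler_norm _))// lerDl.
rewrite [leLHS](_ : _ = e * `|z - y| * ((n%:R * `|invmx J| * (`|L| + 1)) / K)); last by ring.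
rewrite ler_piMr ?mulr_ge0 ?(ltW e0)// ler_pdivrMr// mul1r.
by rewrite /K lerDl.
Unshelve. all: by end_near. Qed.

(** Bootstrap on the formula for DG, the inverse of DH composed with G. The inverse and its
    Lipschitz bound enter as hypotheses since the flow box produces both by elementary means. *)
Lemma smooth_inverse n (U D : set 'rV[R]_n) (H G : 'rV[R]_n -> 'rV[R]_n) (L : R) :
  open U -> open D -> smooth_on U H -> (forall x, U x -> jacobian H x \in unitmx) ->
  (forall y, D y -> U (G y) /\ H (G y) = y) ->
  (forall y z, D y -> D z -> `|G z - G y| <= L * `|z - y|) -> smooth_on D G.
Proof.
move=> oU oD sH Ju GD GL.
have sJ : smooth_on U (fun x => invmx (jacobian H x)).
  by apply: smooth_invmx => //; exact: smooth_jacobian.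
have dG y : D y -> is_diff y G (mulmxr (invmx (jacobian H (G y)))).
  move=> Dy; have [UGy _] := GD y Dy.
  apply: (@lipschitz_inverse_diff _ _ _ D _ L) => //.
  - by move=> z /GD[].
  - by move=> z Dz; exact: GL.
  - exact: (smooth_differentiable sH).
  - exact: Ju.
elim=> [|k IH].
  by move=> y /dG[/differentiable_continuous].
split=> [y /dG[]//|v].
suff : Ck k D (fun y => v *m invmx (jacobian H (G y))).
  apply: Ck_eq => // y; rewrite inE => /dG[dGy dE].
  by rewrite deriveE// dE.
apply: Ck_mx => // a b.
apply: (@Ck_eq _ _ _ _ _ (fun y => \sum_l v a l * invmx (jacobian H (G y)) l b)) => //.
  by move=> y _; rewrite mxE.
apply: Ck_sum => // l; apply: Ck_mul => //; first exact: Ck_cst.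
apply: (@Ck_comp _ _ _ k D U G (fun x => invmx (jacobian H x) l b)) => //.
  by move=> y /GD[].
exact: Ck_entry.
Qed.

End inverse_function.

Section flow_box.
Context {R : realType}.

Lemma line_lipschitz (V : normedModType R) (h : V -> R) (y u : V) (r q : R) :
  (forall t, `|t| <= r -> differentiable h (y + t *: u)) ->
  (forall t, `|t| <= r -> `|'D_u h (y + t *: u)| <= q) ->
  forall a b, `|a| <= r -> `|b| <= r ->
    `|h (y + b *: u) - h (y + a *: u)| <= q * `|b - a|.
Proof.
move=> dh Dq.
have key a b : a <= b -> `|a| <= r -> `|b| <= r ->
    `|h (y + b *: u) - h (y + a *: u)| <= q * `|b - a|.
  move=> ab ar br.
  have inr t : a <= t <= b -> `|t| <= r by move: ar br; rewrite !ler_norml; lra.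
  have [|t tab ->] := @mean_value_line _ _ h y u a b ab.
    by move=> t /inr; exact: dh.
  by rewrite normrM ler_wpM2r// Dq// inr.
move=> a b ar br; have [ab|/ltW ba] := leP a b; first exact: key.
by rewrite distrC [`|b - a|]distrC; exact: key.
Qed.

Lemma line_expanding (V : normedModType R) (h : V -> R) (y u : V) (r m : R) :
  (forall t, `|t| <= r -> differentiable h (y + t *: u)) ->
  (forall t, `|t| <= r -> m <= 'D_u h (y + t *: u)) ->
  forall a b, `|a| <= r -> `|b| <= r -> a <= b ->
    m * (b - a) <= h (y + b *: u) - h (y + a *: u).
Proof.
move=> dh Dm a b ar br ab.
have inr t : a <= t <= b -> `|t| <= r by move: ar br; rewrite !ler_norml; lra.
have [|t tab ->] := @mean_value_line _ _ h y u a b ab.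
  by move=> t /inr; exact: dh.
by rewrite ler_wpM2r ?subr_ge0// Dm// inr.
Qed.

(** The new coordinates are multiples of h - h(x0) and of the coordinate other than i. As h
    increases in the direction i, the intermediate value theorem on each line gives the inverse and
    monotonicity its Lipschitz bound. The image is the square of radius 2, twice the final chart,
    which leaves every leaf room beyond its ends. *)
Lemma flow_box_pos (O : set 'rV[R]_2) (h : 'rV[R]_2 -> R) (i : 'I_2) (x0 : 'rV[R]_2) :
  open_nbhs x0 O -> smooth_on O h -> 0 < 'D_(delta_mx 0 i) h x0 ->
  exists (Om : set 'rV[R]_2) (H G : 'rV[R]_2 -> 'rV[R]_2) (k : R),
  [/\ open_nbhs x0 Om /\ Om `<=` O, smooth_on Om H /\ smooth_on (ball 0 2) G,
      forall x, Om x -> ball 0 2 (H x) /\ G (H x) = x,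
      forall y, ball 0 2 y -> Om (G y) /\ H (G y) = y &
      [/\ k != 0, H x0 = 0 & forall x, (H x) 0 0 = k * (h x - h x0)]].
Proof.
move=> [oO Ox0] sh; set j := rev_ord i.
set ei : 'rV[R]_2 := delta_mx 0 i; set ej : 'rV[R]_2 := delta_mx 0 j.
move=> Dh0; set m := 'D_ei h x0 / 2; pose q := `|'D_ej h x0| + 1.
have m0 : 0 < m by rewrite divr_gt0.
have q0 : 0 < q by rewrite ltr_wpDl.
have [r r0 rP] : exists2 r, 0 < r & forall x, `|x0 - x| < r ->
    [/\ O x, m <= 'D_ei h x & `|'D_ej h x| <= q].
  have ci := smooth_continuous (smooth_derive ei sh) Ox0.
  have cj := smooth_continuous (smooth_derive ej sh) Ox0.
  have mlt : m < 'D_ei h x0 by rewrite /m; lra.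
  have ni := @cvgr_ge R _ (nbhs x0) _ ('D_ei h) _ ci _ mlt.
  have nj := @cvgr_dist_le _ _ _ (nbhs x0) _ ('D_ej h) _ cj _ ltr01.
  have nO : \forall x \near x0, O x by exact: (open_near oO Ox0 (fun _ => id)).
  have /nbhs_ballP[r r0 rP] : \forall x \near x0, [/\ O x, m <= 'D_ei h x & `|'D_ej h x| <= q].
    near=> x; split; [by near: x|by near: x; exact: ni|].
    have : `|'D_ej h x0 - 'D_ej h x| <= 1 by near: x; exact: nj.
    move=> d; rewrite -[X in `|X|](subrK ('D_ej h x0)) (le_trans (ler_normD _ _))//.
    by rewrite addrC lerD2l distrC.
  by exists r => // x xr; apply: rP; rewrite -ball_normE.
pose rho := r / 2; have rho0 : 0 < rho by rewrite divr_gt0.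
pose pt s t := x0 + t *: ej + s *: ei.
have normd (a : 'I_2) (s : R) : `|s *: (delta_mx 0 a : 'rV[R]_2)| <= `|s|.
  by rewrite normrZ ler_piMr// norm_delta_mx.
have ptE x : x = pt ((x - x0) 0 i) ((x - x0) 0 j).
  rewrite /pt -addrA [X in x0 + X]addrC -rV2_decomp_at; first by rewrite addrC subrK.
have ij : i != j by rewrite /j; have [->|->] := ord2P i.
have ijP k : k = i \/ k = j.
  by rewrite /j; have [->|->] := ord2P k; have [->|->] := ord2P i;
    [left|right|right|left]; apply: val_inj.
have pti s t : (pt s t - x0) 0 i = s.
  rewrite !mxE !eqxx/= !(eq_refl, negbTE ij)/=; ring.
have ptj s t : (pt s t - x0) 0 j = t.
  rewrite !mxE !eqxx/= (eq_sym j i) (negbTE ij)/=; ring.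
have pt_in s t : `|s| <= rho -> `|t| <= rho -> `|x0 - pt s t| < r.
  move=> sr tr; rewrite distrC (@le_lt_trans _ _ rho)//; last by rewrite /rho; lra.
  apply: norm_mx_le; first exact: ltW.
  move=> a b; rewrite (ord1 a).
  by case: (ijP b) => ->; rewrite ?pti ?ptj.
have pt_O s t : `|s| <= rho -> `|t| <= rho -> O (pt s t).
  by move=> sr tr; have [] := rP _ (pt_in _ _ sr tr).
have dh s t : `|s| <= rho -> `|t| <= rho -> differentiable h (pt s t).
  by move=> sr tr; apply: (smooth_differentiable sh); exact: pt_O.
have stepj s t t' : `|s| <= rho -> `|t| <= rho -> `|t'| <= rho ->
    `|h (pt s t') - h (pt s t)| <= q * `|t' - t|.
  move=> sr tr tr'; have E z : pt s z = x0 + s *: ei + z *: ej by rewrite /pt addrAC.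
  rewrite !E; apply: (@line_lipschitz _ h _ ej rho) => // z zr; rewrite -E; first exact: dh.
  by have [] := rP _ (pt_in _ _ sr zr).
have stepi s s' t : `|s| <= rho -> `|s'| <= rho -> `|t| <= rho -> s <= s' ->
    m * (s' - s) <= h (pt s' t) - h (pt s t).
  move=> sr sr' tr ss'; apply: (@line_expanding _ h _ ei rho) => // z zr; first exact: dh.
  by have [] := rP _ (pt_in _ _ zr tr).
have estimate s t s' t' : `|s| <= rho -> `|t| <= rho -> `|s'| <= rho -> `|t'| <= rho ->
    m * `|s' - s| <= `|h (pt s' t') - h (pt s t)| + q * `|t' - t|.
  move=> sr tr sr' tr'.
  have A1 : m * `|s' - s| <= `|h (pt s' t') - h (pt s t')|.
    have [ss'|/ltW ss'] := leP s s'.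
      by rewrite [`|s' - s|]ger0_norm ?subr_ge0// (le_trans _ (ler_norm _))//; exact: stepi.
    rewrite [`|s' - s|]distrC [leRHS]distrC [`|s - s'|]ger0_norm ?subr_ge0//.
    by rewrite (le_trans _ (ler_norm _))//; exact: stepi.
  have A2 := stepj s t t' sr tr tr'; have A3 := ler_distD (h (pt s t)) (h (pt s' t')) (h (pt s t')).
  rewrite [X in _ <= _ + X]distrC in A3.
  by rewrite (le_trans A1)// (le_trans A3)// lerD2l.
(* From s = 0 to s = rho or s = - rho the function h changes by at least m rho, while moving by |t|
   < delta changes it by at most m rho / 4. Every value within m rho / 2 of h(x0) is thus strictly
   bracketed. *)
pose delta := Num.min rho (m * rho / (4 * q)); pose eps := m * rho / 2.
have delta0 : 0 < delta by rewrite lt_min rho0 divr_gt0 ?mulr_gt0.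
have eps0 : 0 < eps by rewrite divr_gt0 ?mulr_gt0.
have delta_rho : delta <= rho by rewrite ge_min lexx.
have delta_q : q * delta <= m * rho / 4.
  have : delta <= m * rho / (4 * q) by rewrite ge_min lexx orbT.
  by rewrite ler_pdivlMr ?mulr_gt0// => d; lra.
have pt00 : pt 0 0 = x0 by rewrite /pt !scale0r !addr0.
have r00 : `|0 : R| <= rho by rewrite normr0 ltW.
have surj u t : `|u| < eps -> `|t| < delta ->
    exists2 s, `|s| < rho & h (pt s t) - h x0 = u.
  move=> ue td; have tr : `|t| <= rho by rewrite (le_trans (ltW td)).
  have := stepj 0 0 t r00 r00 tr; rewrite pt00 subr0 => h0.
  have {h0} : `|h (pt 0 t) - h x0| <= m * rho / 4.
    by rewrite (le_trans h0)// (le_trans _ delta_q)// ler_wpM2l ?(ltW q0) ?(ltW td).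
  rewrite ler_norml => h0.
  have rr : `|rho| <= rho by rewrite gtr0_norm.
  have rr' : `|- rho| <= rho by rewrite normrN gtr0_norm.
  have := stepi 0 rho t r00 rr tr (ltW rho0); rewrite subr0 => hp.
  have := stepi (- rho) 0 t rr' r00 tr; rewrite oppr_le0 ltW// sub0r opprK => /(_ isT) hm.
  have mr : 0 < m * rho by rewrite mulr_gt0.
  move: ue; rewrite ltr_norml /eps => ue.
  have [|||s] := @IVT R (fun s => h (pt s t)) (- rho) rho (h x0 + u).
  - by lra.
  - apply: continuous_in_subspaceT => s; rewrite inE/= in_itv/= => sr.
    have dhs : differentiable h (pt s t) by apply: dh => //; rewrite ler_norml.
    have [ds _] := is_derive_line dhs.
    by apply: differentiable_continuous; exact/derivable1_diffP.
  - by rewrite ge_min le_max; lra.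
  rewrite in_itv/= => sr hs; exists s; last by rewrite hs; ring.
  rewrite ltr_norml !lt_neqAle; case/andP: sr => -> ->; rewrite !andbT.
  apply/andP; split; apply/eqP => sE; first by rewrite -sE in hs; lra.
  by rewrite sE in hs; lra.
pose Om := [set x : 'rV[R]_2 | [/\ `|(x - x0) 0 i| < rho, `|(x - x0) 0 j| < delta &
  `|h x - h x0| < eps]].
have OmO : Om `<=` O.
  by move=> x [xi xj _]; rewrite (ptE x); apply: pt_O; rewrite ?(le_trans (ltW xj))// ltW.
have sT k : smooth_on setT (fun x : 'rV[R]_2 => (x - x0) 0 k).
  apply: smooth_entry; first exact: openT.
  apply: (@smoothB _ _ _ openT _ id (cst x0)); last exact: (smooth_cst openT).
  by apply: (smooth_linear openT (L := idfun)) => x; exact: cvg_id.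
have oOm : open Om.
  rewrite openE => x Omx; have [xi xj xh] := Omx.
  have ck k := smooth_continuous (sT k) (I : setT x).
  have ch := smooth_continuous sh (OmO _ Omx).
  have ck' k : (fun y : 'rV[R]_2 => `|(y - x0) 0 k|) @ x --> `|(x - x0) 0 k|.
    exact: (@cvg_norm _ _ _ (nbhs x) _ (fun y : 'rV[R]_2 => (y - x0) 0 k) _ (ck k)).
  have ch' : (fun y => `|h y - h x0|) @ x --> `|h x - h x0|.
    apply: (@cvg_norm _ _ _ (nbhs x) _ (fun y => h y - h x0)).
    by apply: cvgB; [exact: ch|exact: cvg_cst].
  have n1 := @cvgr_lt R _ (nbhs x) _ _ _ (ck' i) _ xi.
  have n2 := @cvgr_lt R _ (nbhs x) _ _ _ (ck' j) _ xj.
  have n3 := @cvgr_lt R _ (nbhs x) _ _ _ ch' _ xh.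
  near=> y; split; [near: y; exact: n1|near: y; exact: n2|near: y; exact: n3].
have Om0 : Om x0 by split; rewrite subrr ?mxE normr0.
pose H (x : 'rV[R]_2) : 'rV[R]_2 :=
  \row_k if k == 0 then 2 / eps * (h x - h x0) else 2 / delta * (x - x0) 0 j.
have H0E x : (H x) 0 0 = 2 / eps * (h x - h x0) by rewrite mxE.
have H1E x : (H x) 0 ord_max = 2 / delta * (x - x0) 0 j by rewrite mxE.
have k0 : 2 / eps != 0 by rewrite mulf_neq0 ?invr_eq0 ?gt_eqF.
have kd0 : 2 / delta != 0 by rewrite mulf_neq0 ?invr_eq0 ?gt_eqF.
have ballP (y : 'rV[R]_2) : ball 0 2 y <-> `|y 0 0| < 2 /\ `|y 0 ord_max| < 2.
  rewrite -ball_normE /= sub0r normrN; split=> [yb|[y0 y1]].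
    by split; apply: le_lt_trans yb; exact: norm_entry_le.
  rewrite (@le_lt_trans _ _ (Num.max `|y 0 0| `|y 0 ord_max|))//; last by rewrite gt_max y0.
  apply: norm_mx_le; first by rewrite le_max normr_ge0.
  move=> a b; rewrite (ord1 a); have [->|->] := ord2P b; by rewrite le_max lexx ?orbT.
have scale2 (d z : R) : 0 < d -> (`|2 / d * z| < 2) = (`|z| < d).
  move=> d0; rewrite normrM gtr0_norm ?divr_gt0// mulrAC ltr_pdivrMr// ltr_pM2l//.
have unscale (d z : R) : 0 < d -> 2 / d * (d / 2 * z) = z.
  by move=> d0; field; rewrite gt_eqF.
have HB x : Om x -> ball 0 2 (H x).
  by move=> [xi xj xh]; apply/ballP; rewrite H0E H1E !scale2.
have Hsurj y : ball 0 2 y -> exists2 x, Om x & H x = y.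
  move=> /ballP[y0 y1].
  have [|| s sr hs] := surj (eps / 2 * y 0 0) (delta / 2 * y 0 ord_max).
  - by rewrite -scale2// unscale.
  - by rewrite -scale2// unscale.
  exists (pt s (delta / 2 * y 0 ord_max)).
    by split; rewrite ?pti ?ptj ?hs// -scale2// unscale.
  by apply: eq_rV2; rewrite ?H0E ?H1E ?hs ?ptj unscale.
have d20 : 0 < delta / 2 by rewrite divr_gt0.
have e20 : 0 < eps / 2 by rewrite divr_gt0.
(* The displacements of h and of x_j are read off the two coordinates of [H]; [estimate] then bounds
   the displacement in the direction i. *)
have Hest x x' : Om x -> Om x' ->
    `|x' - x| <= ((eps / 2 + q * (delta / 2)) / m + delta / 2) * `|H x' - H x|.
  move=> Omx Omx'; set n := `|H x' - H x|; have n0 : 0 <= n by rewrite normr_ge0.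
  have [xi xj _] := Omx; have [xi' xj' _] := Omx'.
  have subE k : (H x' - H x) 0 k = (H x') 0 k - (H x) 0 k by rewrite !mxE.
  have dj : `|(x' - x0) 0 j - (x - x0) 0 j| <= delta / 2 * n.
    rewrite (_ : _ - _ = delta / 2 * (H x' - H x) 0 ord_max); last first.
      by rewrite subE !H1E -mulrBr mulrA; field; rewrite gt_eqF.
    by rewrite normrM (gtr0_norm d20) ler_wpM2l ?norm_entry_le// ltW.
  have dh0 : `|h x' - h x| <= eps / 2 * n.
    rewrite (_ : _ - _ = eps / 2 * (H x' - H x) 0 0); last first.
      by rewrite subE !H0E -mulrBr mulrA; field; rewrite gt_eqF.
    by rewrite normrM (gtr0_norm e20) ler_wpM2l ?norm_entry_le// ltW.
  have := estimate ((x - x0) 0 i) ((x - x0) 0 j) ((x' - x0) 0 i) ((x' - x0) 0 j).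
  have le_rho (z : R) : `|z| < delta -> `|z| <= rho by move=> /ltW zd; exact: le_trans zd delta_rho.
  rewrite -!ptE => /(_ (ltW xi) (le_rho _ xj) (ltW xi') (le_rho _ xj')) est.
  have di : `|(x' - x0) 0 i - (x - x0) 0 i| <= (eps / 2 + q * (delta / 2)) / m * n.
    rewrite mulrAC ler_pdivlMr// [leLHS]mulrC (le_trans est)//.
    rewrite [leRHS]mulrDl; apply: lerD => //.
    by rewrite -mulrA; apply: ler_wpM2l => //; exact: ltW.
  have sub k : (x' - x) 0 k = (x' - x0) 0 k - (x - x0) 0 k by rewrite !mxE; ring.
  rewrite mulrDl; apply: norm_mx_le.
    by rewrite addr_ge0 ?(le_trans _ di) ?(le_trans _ dj).
  move=> a b; rewrite (ord1 a); case: (ijP b) => ->; rewrite sub.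
    by rewrite (le_trans di)// lerDl (le_trans _ dj).
  by rewrite (le_trans dj)// lerDr (le_trans _ di).
have inj x x' : Om x -> Om x' -> H x = H x' -> x = x'.
  move=> Omx Omx' HH; have := Hest _ _ Omx Omx'; rewrite HH subrr normr0 mulr0.
  by rewrite normr_le0 subr_eq0 => /eqP.
pose G (y : 'rV[R]_2) : 'rV[R]_2 := xget x0 [set x | Om x /\ H x = y].
have GP y : ball 0 2 y -> Om (G y) /\ H (G y) = y.
  by move=> /Hsurj[x Omx Hx]; rewrite /G; case: xgetP => [z _ //|/(_ x)/(_ (conj Omx Hx))].
have sH : smooth_on Om H.
  apply: smooth_mx => // a b; rewrite (ord1 a); have [->|->] := ord2P b.
    apply: (smooth_eq oOm (fun x _ => esym (H0E x))); apply: smoothM => //; first exact: smooth_cst.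
    by apply: smoothB => //; [exact: smooth_subset sh|exact: smooth_cst].
  apply: (smooth_eq oOm (fun x _ => esym (H1E x))); apply: smoothM => //; first exact: smooth_cst.
  exact: smooth_subset (sT j).
(* A kernel vector has zero j-component and satisfies dh = 0; as the i-th partial of h is positive,
   its i-component vanishes too. *)
have JH x : Om x -> jacobian H x \in unitmx.
  move=> Omx; rewrite -row_free_unit; apply: inj_row_free => X.
  have dH := smooth_differentiable sH Omx.
  have dhx : differentiable h x by apply: (smooth_differentiable sh); exact: OmO.
  rewrite -deriveEjacobian// => DX.
  have E1 : 'D_X H x 0 ord_max = 2 / delta * X 0 j.
    rewrite derive_entry// (funext H1E : (fun y => H y 0 ord_max) = _).
    have di : is_derive x X (fun y : 'rV[R]_2 => y - x0) (X - 0) by apply: is_deriveB.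
    have := is_derive_entry 0 j di; rewrite subr0 => /(is_deriveZ (2 / delta))[_].
    exact.
  have E0 : 'D_X H x 0 0 = 2 / eps * 'D_X h x.
    rewrite derive_entry// (funext H0E : (fun y => H y 0 0) = _).
    have dh1 : is_derive x X h ('D_X h x) by apply: DeriveDef => //; exact: diff_derivable.
    have di : is_derive x X (fun y : 'rV[R]_2 => h y - h x0) ('D_X h x - 0) by apply: is_deriveB.
    by move: di; rewrite subr0 => /(is_deriveZ (2 / eps))[_]; exact.
  have Xj : X 0 j = 0.
    by move/eqP: E1; rewrite DX mxE eq_sym mulf_eq0 (negbTE kd0) => /eqP.
  have : 'D_X h x = 0.
    by move/eqP: E0; rewrite DX mxE eq_sym mulf_eq0 (negbTE k0) => /eqP.
  rewrite (rV2_decomp_at i X) Xj scale0r addr0 => /eqP.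
  rewrite deriveE// linearZ -deriveE// scaler_eq0 => /orP[/eqP->|]; first by rewrite scale0r.
  have [xi xj _] := Omx.
  have xr : `|x0 - x| < r.
    by rewrite (ptE x); apply: pt_in; [exact: ltW|rewrite (le_trans (ltW xj))].
  by have [_ mD _] := rP _ xr; rewrite gt_eqF// (lt_le_trans m0).
exists Om, H, G, (2 / eps); split=> //.
- split=> //; apply: (smooth_inverse oOm _ sH JH GP); first exact: ball_open.
  by move=> y z /GP[Omy Hy] /GP[Omz Hz]; rewrite -{2}Hy -{2}Hz; exact: Hest.
- move=> x Omx; split; first exact: HB.
  by have [Om1 H1] := GP _ (HB _ Omx); exact: inj.
- split=> //; apply: eq_rV2; first by rewrite H0E mxE subrr mulr0.
  by rewrite H1E !mxE subrr mulr0.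
Unshelve. all: by end_near. Qed.

(** A negative derivative is treated by passing to - h, and the sign goes into [k]. *)
Lemma flow_box (O : set 'rV[R]_2) (h : 'rV[R]_2 -> R) (i : 'I_2) (x0 : 'rV[R]_2) :
  open_nbhs x0 O -> smooth_on O h -> 'D_(delta_mx 0 i) h x0 != 0 ->
  exists (Om : set 'rV[R]_2) (H G : 'rV[R]_2 -> 'rV[R]_2) (k : R),
  [/\ open_nbhs x0 Om /\ Om `<=` O, smooth_on Om H /\ smooth_on (ball 0 2) G,
      forall x, Om x -> ball 0 2 (H x) /\ G (H x) = x,
      forall y, ball 0 2 y -> Om (G y) /\ H (G y) = y &
      [/\ k != 0, H x0 = 0 & forall x, (H x) 0 0 = k * (h x - h x0)]].
Proof.
move=> Ox0 sh; rewrite neq_lt => /orP[Dh|]; last exact: flow_box_pos Ox0 sh.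
have [oO Ox] := Ox0.
have Dh' : 0 < 'D_(delta_mx 0 i) (fun x => - h x) x0.
  rewrite (@deriveN _ _ _ h) ?oppr_gt0//.
  by apply: diff_derivable; exact: smooth_differentiable sh Ox.
have [Om [H [G [k [P1 P2 P3 P4 [k0 H0 Hk]]]]]] := flow_box_pos Ox0 (smoothN oO sh) Dh'.
exists Om, H, G, (- k); split=> //; split=> //; first by rewrite oppr_eq0.
by move=> x; rewrite Hk; ring.
Qed.

(** Differentiating H (G y) = y in the last direction e gives DH(T) = e for T = D_e G. The first
    component says k dh(T) = 0, and T = 0 would force e = 0. *)
Lemma flow_box_tangent (Om D : set 'rV[R]_2) (h : 'rV[R]_2 -> R)
    (H G : 'rV[R]_2 -> 'rV[R]_2) (k c : R) : open Om -> open D ->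
  smooth_on Om H -> smooth_on Om h -> smooth_on D G ->
  (forall y, D y -> Om (G y) /\ H (G y) = y) ->
  k != 0 -> (forall x, (H x) 0 0 = k * (h x - c)) ->
  forall y, D y -> 'D_('D_(delta_mx 0 ord_max) G y) h (G y) = 0 /\
    'D_(delta_mx 0 ord_max) G y != 0.
Proof.
move=> oOm oD sH sh sG GD k0 Hk y Dy; set e : 'rV[R]_2 := delta_mx 0 ord_max.
have [Oy HGy] := GD y Dy.
have dG := smooth_differentiable sG Dy; have dH := smooth_differentiable sH Oy.
have dh := smooth_differentiable sh Oy.
have HE : 'D_('D_e G y) H (G y) = e.
  rewrite -derive_comp// (@near_eq_derive _ _ _ _ id); first by rewrite derive_id.
  by apply: (open_near oD Dy) => z /GD[].
split; last first.
  apply/eqP => T0; move: HE; rewrite T0 deriveE// linear0 => /matrixP/(_ 0 ord_max).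
  by rewrite !mxE !eqxx => /esym/eqP; rewrite oner_eq0.
have := congr1 (fun v : 'rV[R]_2 => v 0 0) HE; rewrite /= derive_entry//.
rewrite (funext Hk : (fun y => H y 0 0) = _) mxE.
have dh1 : is_derive (G y) ('D_e G y) h ('D_('D_e G y) h (G y)).
  by apply: DeriveDef => //; exact: diff_derivable.
have di : is_derive (G y) ('D_e G y) (fun y : 'rV[R]_2 => h y - c) ('D_('D_e G y) h (G y) - 0).
  by apply: is_deriveB.
have [_ ->] := is_deriveZ k di.
by rewrite subr0 => /eqP; rewrite scaler_eq0 (negbTE k0) => /eqP.
Qed.

End flow_box.

Section arclength.
Context {R : realType}.

Lemma open_norm_lt (r : R) : open [set t : R | `|t| < r].
Proof.
rewrite (_ : [set t | _] = ball 0 r); first exact: ball_open.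
by apply/seteqP; split=> t; rewrite -ball_normE /= sub0r normrN.
Qed.

Lemma exists_increasing_primitive (v : R -> R) : continuous v -> (forall t, 0 < v t) ->
  exists F : R -> R, (forall t : R, is_derive t 1 F (v t)) /\ {mono F : x y / x < y}.
Proof.
move=> cv v0; pose f t : 'rV[R]_1 := \row_(_ < 1) v t.
have cf : continuous f.
  move=> t; apply/cvgrPdist_le => e e0; near=> s.
  apply: norm_mx_le; first exact: ltW.
  by move=> i j; rewrite !mxE; near: s; move: e e0; apply/cvgrPdist_le; exact: cv.
pose F t := primitive f t 0 0.
have dF (t : R) : is_derive t 1 F (v t).
  have := is_derive_entry 0 0 (is_derive_primitive t cf).
  by rewrite mxE.
exists F; split=> //.
have dsF (t : R) : differentiable F t by have [dt _] := dF t; exact/derivable1_diffP.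
have incr (x y : R) : x < y -> F x < F y.
  move=> xy; have [|t _ FE] := @MVT_segment R F v x y (ltW xy).
    by apply: continuous_subspaceT => t; exact: differentiable_continuous.
  by rewrite -subr_gt0 FE mulr_gt0// subr_gt0.
exact: leW_mono (le_mono incr).
Unshelve. all: by end_near. Qed.

(* Smoothness comes from bootstrapping [tau' = 1 / v (tau)]. *)
Lemma arclength_parameter (v : R -> R) : smooth_on [set t | `|t| < 2] v ->
  (forall t, `|t| < 2 -> 0 < v t) ->
  exists (I : set R) (tau : R -> R), [/\ open I, is_interval I, smooth_on I tau,
    tau @` I = [set t | `|t| < 1] & forall r, I r -> 'D_1 tau r = (v (tau r))^-1].
Proof.
move=> sv v0; set D := [set t : R | `|t| < 2] in sv *.
have oD : open D by exact: open_norm_lt.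
have c1 (t : R) : `|clamp 1 t| < 2.
  by rewrite (le_lt_trans (clamp_norm _ ler01))// ltr1n.
(* The clamped speed is continuous and positive on the whole line and equals [v] on [- 1, 1]; its
   primitive is therefore a global increasing function that measures arclength there. *)
have cw : continuous (v \o clamp 1).
  move=> t; apply: continuous_comp; first exact: clamp_continuous.
  exact: (smooth_continuous sv (c1 t : D _)).
have [s [ds smono]] := exists_increasing_primitive cw (fun t => v0 _ (c1 t)).
have sc (t : R) : {for t, continuous s}.
  by have [dt _] := ds t; apply: differentiable_continuous; exact/derivable1_diffP.
have sinj : injective s.
  move=> x y sxy; apply/eqP; rewrite eq_le.
  by rewrite leNgt -smono sxy ltxx/= leNgt -smono sxy ltxx.
pose I : set R := [set` `]s (-1), s 1[].
pose tau r : R := xget 0 [set t | s t = r].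
have tauP (r : R) : I r -> s (tau r) = r /\ `|tau r| < 1.
  rewrite /I/= in_itv/= => /andP[rl ru].
  have [|||t _ st] := @IVT R s (-1) 1 r; first by lra.
  - exact: continuous_subspaceT.
  - by rewrite ge_min le_max (ltW rl) (ltW ru) orbT.
  have tE : s (tau r) = r.
    by rewrite /tau; case: xgetP => [z _ //|/(_ t)].
  by split; [exact: tE|rewrite ltr_norml -(smono (-1)) -(smono _ 1) tE rl ru].
have tauK (t : R) : tau (s t) = t.
  by rewrite /tau; case: xgetP => [z _ /sinj->|/(_ t)/(_ erefl)].
have oI : open I by exact: interval_open.
have dtau (r : R) : I r -> is_derive r 1 tau (v (tau r))^-1.
  move=> Ir; have [sr tr] := tauP r Ir; rewrite -{1}sr.
  have -> : v (tau r) = (v \o clamp 1) (tau r) by rewrite /= clamp_id// ltW.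
  apply: is_derive_inverse; [near=> z; exact: tauK|near=> z; exact: sc|].
  by rewrite gt_eqF// v0.
have ctau (r : R) : I r -> {for r, continuous tau}.
  by move=> /dtau[dt _]; apply: differentiable_continuous; exact/derivable1_diffP.
exists I, tau; split; first exact: oI.
- exact: interval_is_interval.
- elim=> [|k IH]; first by move=> r; exact: ctau.
  split=> [r /dtau[dt _]|a]; first exact/derivable1_diffP.
  have vtau : Ck k I (fun r => a * (v (tau r))^-1).
    apply: Ck_mul => //; first exact: Ck_cst.
    apply: Ck_inv => //.
      by move=> r /tauP[_ tr]; rewrite gt_eqF// v0// (lt_trans tr)// ltr1n.
    apply: (Ck_comp_R oI _ IH (sv k)).
    by move=> r /tauP[_ tr]; rewrite /D /= (lt_trans tr)// ltr1n.
  apply: Ck_eq vtau => // r; rewrite inE => Ir.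
  have [dt <-] := dtau r Ir; have dd : differentiable tau r by exact/derivable1_diffP.
  rewrite (deriveE _ dd) (deriveE a dd) -[LHS]/(a *: ('d tau r 1 : R)).
  by rewrite -linearZ; apply: (f_equal ('d tau r)); exact: mulr1.
- apply/seteqP; split=> [_ [r /tauP[_ tr] <-]//|t /= t1]; exists (s t) => //.
  by move: t1; rewrite /I/= in_itv/= !smono ltr_norml.
- by move=> r /dtau[].
Unshelve. all: by end_near. Qed.

End arclength.

(** Three independent rows span the space, so A is itself a combination of T, N and W, and <A, A> =
    0 follows. *)
Lemma span3_orthogonal (R : realType) (G : 'M[R]_3) (T N W A : 'rV[R]_3) : pos_def G ->
  (forall a b d, a *: T + (b *: N + d *: W) = 0 -> [/\ a = 0, b = 0 & d = 0]) ->
  inner G A T = 0 -> inner G A N = 0 -> inner G A W = 0 -> A = 0.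
Proof.
move=> pG free AT AN AW; apply: (inner_eq0 pG).
pose M : 'M[R]_(1 + (1 + 1), 3) := col_mx T (col_mx N W).
have ME (X : 'rV[R]_(1 + (1 + 1))) : X *m M = X 0 (lshift _ 0) *: T +
    (X 0 (rshift _ (lshift _ 0)) *: N + X 0 (rshift _ (rshift _ 0)) *: W).
  rewrite -[in LHS](hsubmxK X) mul_row_col -[rsubmx X]hsubmxK mul_row_col.
  have sc (B : 'M[R]_1) (Z : 'rV[R]_3) : B *m Z = B 0 0 *: Z.
    by rewrite [in LHS](mx11_scalar B) mul_scalar_mx.
  by rewrite !sc !mxE.
have rM : row_free M.
  apply: inj_row_free => X; rewrite ME => /free[X0 X1 X2]; apply/rowP => k; rewrite [RHS]mxE.
  case: (splitP k) => [j jk|j jk].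
    by rewrite -X0; congr (X 0 _); apply: val_inj; rewrite /= jk (ord1 j).
  case: (splitP j) => [l jl|l jl].
    by rewrite -X1; congr (X 0 _); apply: val_inj; rewrite /= jk jl (ord1 l).
  by rewrite -X2; congr (X 0 _); apply: val_inj; rewrite /= jk jl (ord1 l).
have : (A <= M)%MS by apply: submx_full; rewrite -col_leq_rank; move: rM; rewrite /row_free => /eqP->.
move=> /submxP[X AE]; rewrite [X in inner G _ X]AE ME !innerDr !innerZr AT AN AW.
by rewrite !mulr0 !addr0.
Qed.

Section curves.
Context {R : realType} {n : nat} {V : normedModType R}.
Variables (g : 'rV[R]_n -> 'M[R]_n) (F : 'rV[R]_2 -> 'rV[R]_n) (c : V -> 'rV[R]_2) (x X : V).

Lemma covariant_comp (W : 'rV[R]_2 -> 'rV[R]_n) : differentiable c x ->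
  differentiable F (c x) -> differentiable W (c x) ->
  covariant g (F \o c) (W \o c) X x = covariant g F W ('D_X c x) (c x).
Proof.
move=> dc dF dW; rewrite [LHS]covariantE [RHS]covariantE.
by rewrite (derive_comp _ dc dW) (derive_comp _ dc dF).
Qed.

End curves.

(** * Level curves as geodesics *)

Section leaves.
Context {R : realType}.
Variables (g : 'rV[R]_3 -> 'M[R]_3) (B : set 'rV[R]_3).
Hypothesis hg : local_metric g B.
Variables (U : set 'rV[R]_2) (F : 'rV[R]_2 -> 'rV[R]_3).
Hypotheses (oU : open U) (UB : forall x, U x -> B (F x)) (sF : smooth_on U F).
Hypothesis imm : forall x X, U x -> 'D_X F x = 0 -> X = 0.
Variable N : 'rV[R]_2 -> 'rV[R]_3.
Hypotheses (sN : smooth_on U N)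
  (N1 : forall x, U x -> inner (g (F x)) (N x) (N x) = 1)
  (NT : forall x X, U x -> inner (g (F x)) ('D_X F x) (N x) = 0).
Variables (O : set 'rV[R]_2) (i : 'I_2) (h : 'rV[R]_2 -> R) (W : 'rV[R]_2 -> 'rV[R]_3).
Hypotheses (OU : O `<=` U) (rd : ruling_data g F N O i h W).

Let gT x : U x -> (g (F x))^T = g (F x).
Proof. by move=> /UB Bx; have [_ _ k _] := hg; exact: k. Qed.

Let gpos x : U x -> pos_def (g (F x)).
Proof. by move=> /UB Bx; have [_ _ _ k] := hg; exact: k. Qed.

(* The acceleration is orthogonal to the velocity, to [N] and to [W], which are
   independent. *)
Lemma unit_speed_leaf_geodesic (I : set R) (c : R -> 'rV[R]_2) : open I ->
  smooth_on I c -> (forall r, I r -> O (c r)) ->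
  (forall r, I r -> 'D_('D_1 c r) h (c r) = 0) ->
  (forall r, I r -> inner (g (F (c r))) ('D_1 (F \o c) r) ('D_1 (F \o c) r) = 1) ->
  forall r, I r -> covariant g (F \o c) ('D_1 (F \o c)) 1 r = 0.
Proof.
move=> oI sc cO ch c1 r Ir; have [_ sW _ rdO] := rd.
have Uc s (Is : I s) := OU (cO s Is).
have [oB _ _ _] := hg.
have sFc : smooth_on I (F \o c) by apply: smooth_comp oU Uc sc sF.
set T := 'D_1 (F \o c); set A := covariant g (F \o c) T 1 r.
have sT : smooth_on I T by exact: smooth_derive.
have dc s (Is : I s) := smooth_differentiable sc Is.
have dF s (Is : I s) : differentiable F (c s) := smooth_differentiable sF (Uc s Is).
have dFc s (Is : I s) := smooth_differentiable sFc Is.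
have dT s (Is : I s) := smooth_differentiable sT Is.
have dN : differentiable N (c r) := smooth_differentiable sN (Uc r Ir).
have dW : differentiable W (c r) := smooth_differentiable sW (cO r Ir).
have TE s (Is : I s) : T s = 'D_('D_1 c s) F (c s).
  by rewrite /T (derive_comp _ (dc s Is) (dF s Is)).
have [[X WX] rdT] := rdO _ (cO r Ir); have [WT WW NN] := rdT _ (ch r Ir).
have gTr := gT (Uc r Ir); have gpr := gpos (Uc r Ir).
have cst_deriv (f : R -> R) k d : (forall s, I s -> f s = k) -> is_derive r 1 f d -> d = 0.
  move=> fk [_ <-]; rewrite (@near_eq_derive _ _ _ _ (cst k)) ?derive_cst//.
  exact: (open_near oI Ir fk).
(* Each of the three relations comes from differentiating an identity along the curve: <T, T> = 1,
   then <T, N> = 0 and <T, W> = 0, where the clauses of [ruling_data] on nabla_T N and nabla_T W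
   remove the second term. *)
have AT : inner (g (F (c r))) A (T r) = 0.
  have := cst_deriv _ _ _ c1 (derive_inner hg (dFc r Ir) (UB (Uc r Ir)) _ (dT r Ir) (dT r Ir)).
  rewrite (inner_sym (T r) _ gTr) -/A => E.
  by apply/eqP; move/eqP: E; rewrite -mulr2n mulrn_eq0.
have AN : inner (g (F (c r))) A (N (c r)) = 0.
  have dNc : differentiable (N \o c) r by apply: differentiable_comp; [exact: dc|].
  have NT0 s : I s -> inner (g ((F \o c) s)) (T s) ((N \o c) s) = 0.
    by move=> Is; rewrite (TE s Is); exact: NT (Uc s Is).
  have := cst_deriv _ _ _ NT0 (derive_inner hg (dFc r Ir) (UB (Uc r Ir)) _ (dT r Ir) dNc).
  rewrite (covariant_comp g _ (dc r Ir) (dF r Ir) dN) -/A.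
  rewrite (inner_sym (T r) _ gTr) TE// NN addr0; exact.
have AW : inner (g (F (c r))) A (W (c r)) = 0.
  have dWc : differentiable (W \o c) r by apply: differentiable_comp; [exact: dc|].
  have WT0 s : I s -> inner (g ((F \o c) s)) (T s) ((W \o c) s) = 0.
    move=> Is; rewrite (TE s Is) (inner_sym _ _ (gT (Uc s Is))).
    by have [_ /(_ _ (ch s Is))[]] := rdO _ (cO s Is).
  have := cst_deriv _ _ _ WT0 (derive_inner hg (dFc r Ir) (UB (Uc r Ir)) _ (dT r Ir) dWc).
  rewrite (covariant_comp g _ (dc r Ir) (dF r Ir) dW) -/A.
  rewrite (inner_sym (T r) _ gTr) TE// WW addr0; exact.
apply: (span3_orthogonal gpr _ AT AN AW) => a b d E.
have NTr Y := NT Y (Uc r Ir); have N1r := N1 (Uc r Ir).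
have pair v : a * inner (g (F (c r))) (T r) v + (b * inner (g (F (c r))) (N (c r)) v
    + d * inner (g (F (c r))) (W (c r)) v) = 0.
  by rewrite -!innerZl -!innerDl E inner0l.
have TN : inner (g (F (c r))) (T r) (N (c r)) = 0 by rewrite TE.
have WT' : inner (g (F (c r))) (W (c r)) (T r) = 0 by rewrite TE.
have TX : inner (g (F (c r))) (T r) (T r) = 1 := c1 r Ir.
(* The order matters: W may have a normal component, so its coefficient d is eliminated through a
   tangent vector not orthogonal to W before pairing with N. *)
have a0 : a = 0.
  by have := pair (T r); rewrite TX WT' (inner_sym _ _ gTr) TN !mulr0 mulr1 !addr0.
have d0 : d = 0.
  have := pair ('D_X F (c r)); rewrite a0 mul0r add0r.
  rewrite [X in b * X](inner_sym _ _ gTr) NTr mulr0 add0r => /eqP.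
  by rewrite mulf_eq0 (negbTE WX) orbF => /eqP.
by split=> //; have := pair (N (c r)); rewrite a0 d0 !mul0r N1r mulr1 add0r addr0.
Qed.

(** The curve is given on |t| < 2 and used on |t| < 1: the margin keeps its speed smooth and
    positive up to both ends, as the arclength reparametrization requires. Rescaling the velocity
    keeps it in the kernel of dh. *)
Lemma leaf_geodesic (gam : R -> 'rV[R]_2) : smooth_on [set t | `|t| < 2] gam ->
  (forall t : R, `|t| < 2 -> [/\ O (gam t), 'D_1 gam t != 0 & 'D_('D_1 gam t) h (gam t) = 0]) ->
  exists (I : set R) (tau : R -> R), [/\ open I, is_interval I,
    tau @` I = [set t | `|t| < 1], smooth_on I tau &
    forall r, I r -> covariant g (F \o (gam \o tau)) ('D_1 (F \o (gam \o tau))) 1 r = 0].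
Proof.
set D := [set t : R | `|t| < 2] => sgam gamP.
have oD : open D by exact: open_norm_lt.
have [oB _ _ _] := hg.
have Ug t (Dt : D t) : U (gam t) by have [/OU] := gamP t Dt.
have sFg : smooth_on D (F \o gam) by apply: smooth_comp oU Ug sgam sF.
have dg t (Dt : D t) := smooth_differentiable sgam Dt.
have dF t (Dt : D t) : differentiable F (gam t) := smooth_differentiable sF (Ug t Dt).
pose q t := inner (g ((F \o gam) t)) ('D_1 (F \o gam) t) ('D_1 (F \o gam) t).
have sq : smooth_on D q.
  apply: (smooth_inner hg oD _ sFg) => //; last exact: smooth_derive.
  - by move=> t Dt; exact: UB (Ug t Dt).
  - exact: smooth_derive.
have q0 t : D t -> 0 < q t.
  move=> Dt; apply: (gpos (Ug t Dt)); rewrite (derive_comp _ (dg t Dt) (dF t Dt)).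
  by apply/eqP => /(imm (Ug t Dt)) /eqP; have [_ /negbTE ->] := gamP t Dt.
have [I [tau [oI iI stau tauI dtau]]] := arclength_parameter (smooth_sqrt oD q0 sq)
  (fun t Dt => etrans (sqrtr_gt0 _) (q0 t Dt)).
have tauD r : I r -> D (tau r).
  move=> Ir; have : [set t : R | `|t| < 1] (tau r) by rewrite -tauI; exists r.
  by move=> /= t1; rewrite /D /= (lt_trans t1)// ltr1n.
exists I, tau; split=> //.
have sc : smooth_on I (gam \o tau) by apply: smooth_comp_curve oD tauD stau sgam.
have dt r (Ir : I r) := smooth_differentiable stau Ir.
have dc r : I r -> 'D_1 (gam \o tau) r = (Num.sqrt (q (tau r)))^-1 *: 'D_1 gam (tau r).
  by move=> Ir; rewrite (derive_comp_R _ (dt r Ir) (dg _ (tauD r Ir))) dtau.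
apply: (unit_speed_leaf_geodesic oI sc) => r Ir.
- by have [] := gamP _ (tauD r Ir).
- have [Og _ hg0] := gamP _ (tauD r Ir); have [sh _ _ _] := rd.
  rewrite dc// deriveE; last exact: smooth_differentiable sh Og.
  rewrite linearZ -deriveE; last exact: smooth_differentiable sh Og.
  by rewrite hg0; exact: mulr0.
- have TE : 'D_1 (F \o (gam \o tau)) r = (Num.sqrt (q (tau r)))^-1 *: 'D_1 (F \o gam) (tau r).
    rewrite -[F \o _]/((F \o gam) \o tau).
    rewrite (derive_comp_R _ (dt r Ir)) ?dtau//.
    exact: smooth_differentiable sFg (tauD r Ir).
  rewrite TE innerZl innerZr mulrA -invfM -expr2 sqr_sqrtr ?(ltW (q0 _ (tauD r Ir)))//.
  by rewrite mulVf// gt_eqF// (q0 _ (tauD r Ir)).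
Qed.

End leaves.

(** * Charts and foliations *)

Section horizontal_lines.
Context {R : realType}.

Definition row2 (u t : R) : 'rV[R]_2 := \row_k if k == 0 then u else t.

Lemma row2_ball (u t r : R) : 0 < r -> `|u| < r -> `|t| < r -> ball 0 r (row2 u t).
Proof.
move=> r0 ur tr; rewrite -ball_normE /= sub0r normrN.
apply: (@le_lt_trans _ _ (Num.max `|u| `|t|)); last by rewrite gt_max ur.
apply: norm_mx_le; first by rewrite le_max normr_ge0.
by move=> i j; rewrite mxE; case: ifP => _; rewrite le_max lexx ?orbT.
Qed.

Lemma row2_line (u t : R) : row2 u t = row2 u 0 + t *: delta_mx 0 ord_max.
Proof. by apply: eq_rV2; rewrite !mxE/= ?mulr0 ?mulr1 ?addr0 ?add0r. Qed.

Lemma smooth_row2 (U : set R) u : open U -> smooth_on U (row2 u).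
Proof.
move=> oU; apply: smooth_mx => // i k; case: (ord2P k) => ->.
  by apply: (smooth_eq oU _ (smooth_cst oU u)) => t _; rewrite mxE.
apply: (smooth_eq oU (h := idfun)) => [t _|]; first by rewrite mxE.
by apply: (smooth_linear oU (L := idfun)) => t; exact: cvg_id.
Qed.

End horizontal_lines.

Section charts.
Context {R : realType} {n : nat}.

Lemma open_preimage_on (T T' : topologicalType) (f : T -> T') (D : set T) (A : set T') :
  open D -> (forall x, D x -> {for x, continuous f}) -> open A -> open (D `&` f @^-1` A).
Proof.
move=> oD cf oA; rewrite openE => x [Dx Ax].
apply: filterI; first by exact: open_nbhs_nbhs (conj oD Dx).
by apply: (cf x Dx); exact: open_nbhs_nbhs.
Qed.

Lemma open_chart_image (M : topologicalType) (a : chart R n M) (A : set M) :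
  open A -> open (a @` (cdom a `&` A)).
Proof.
move=> oA.
have -> : a @` (cdom a `&` A) = cimg a `&` cinv a @^-1` A.
  apply/seteqP; split=> [_ [p [ap Ap] <-]|_ [[p ap <-]]].
    by split; [exists p|rewrite /preimage /= (cmapK ap)].
  by rewrite /preimage /= (cmapK ap) => Ap; exists p.
apply: open_preimage_on => //; first exact: open_cimg.
exact: cinv_continuous.
Qed.

Lemma compose_chart (M : topologicalType) (a : chart R n M) (Om D : set 'rV[R]_n)
    (H G : 'rV[R]_n -> 'rV[R]_n) : open Om -> open D -> Om `<=` cimg a ->
  (forall x, Om x -> {for x, continuous H}) -> (forall y, D y -> {for y, continuous G}) ->
  (forall x, Om x -> D (H x) /\ G (H x) = x) -> (forall y, D y -> Om (G y) /\ H (G y) = y) ->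
  exists h : chart R n M, [/\ cdom h = cdom a `&` a @^-1` Om, (h : M -> _) = H \o a,
    cinv h = cinv a \o G & cimg h = D].
Proof.
move=> oOm oD Oma cH cG HP GP.
have iE : (H \o a) @` (cdom a `&` a @^-1` Om) = D.
  apply/seteqP; split=> [_ [p [ap Op] <-]|y Dy]; first by have [] := HP _ Op.
  have [OGy HGy] := GP y Dy; have [p ap pE] := Oma _ OGy.
  by exists p; [split=> //; rewrite /preimage /= pE|rewrite /= pE].
have odom : open (cdom a `&` a @^-1` Om).
  by apply: open_preimage_on => //; [exact: open_cdom|exact: cmap_continuous].
have himg : open ((H \o a) @` (cdom a `&` a @^-1` Om)) by rewrite iE.
have hK p : (cdom a `&` a @^-1` Om) p -> (cinv a \o G) ((H \o a) p) = p.
  by move=> [ap Op] /=; have [_ ->] := HP _ Op; rewrite cmapK.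
have hc p : (cdom a `&` a @^-1` Om) p -> {for p, continuous (H \o a)}.
  by move=> [ap Op]; apply: continuous_comp; [exact: cmap_continuous|exact: cH].
have hi y : ((H \o a) @` (cdom a `&` a @^-1` Om)) y -> {for y, continuous (cinv a \o G)}.
  rewrite iE => Dy; apply: continuous_comp; first exact: cG.
  by apply: cinv_continuous; have [/Oma] := GP y Dy.
by exists (Chart odom himg hK hc hi).
Qed.

(** A transition with any chart of the atlas factors through the smooth transition with [a],
    followed by [H] or preceded by [G]. *)
Lemma admissible_compose (M : manifold R n) (a h : chart R n M) (Om D : set 'rV[R]_n)
    (H G : 'rV[R]_n -> 'rV[R]_n) : atlas M a -> open Om -> open D ->
  (forall x, Om x -> G (H x) = x) -> smooth_on Om H -> smooth_on D G ->
  cdom h = cdom a `&` a @^-1` Om -> (h : M -> _) = H \o a ->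
  cinv h = cinv a \o G -> cimg h = D -> admissible_chart h.
Proof.
move=> Aa oOm oD GH sH sG hdom hmap hinv himg b Ab; split.
- have oT : open (b @` (cdom b `&` cdom h)) by apply: open_chart_image; exact: open_cdom.
  have st := atlas_smooth Ab Aa.
  rewrite /smooth_transition hmap -compA.
  apply: (smooth_comp oT oOm _ _ sH).
    by move=> _ [p [bp hp] <-] /=; rewrite (cmapK bp); move: hp; rewrite hdom => -[].
  apply: smooth_subset st => _ [p [bp hp] <-]; exists p => //.
  by split=> //; move: hp; rewrite hdom => -[].
- have oT : open (h @` (cdom h `&` cdom b)) by apply: open_chart_image; exact: open_cdom.
  have oB : open (a @` (cdom a `&` cdom b)) by apply: open_chart_image; exact: open_cdom.
  rewrite /smooth_transition hinv compA.
  apply: (smooth_comp oT oB _ _ (atlas_smooth Aa Ab)).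
    move=> _ [p [hp bp] <-]; rewrite hmap /=; move: hp; rewrite hdom => -[ap Op].
    by rewrite GH//; exists p.
  by apply: smooth_subset sG => _ [p [hp bp] <-]; rewrite -himg; exists p.
Qed.

End charts.

Section chart_foliation.
Context {R : realType} {S : manifold R 2}.
Variable h : chart R 2 S.
Hypotheses (ah : admissible_chart h) (himg : cimg h = ball 0 1).

Definition leaf (u : R) : set S := [set s | cdom h s /\ h s 0 0 = u].

Lemma leafE u : `|u| < 1 -> leaf u = (cinv h \o row2 u) @` [set t | `|t| < 1].
Proof.
move=> u1; apply/seteqP; split=> [s [hs su]|_ [t t1 <-]] /=.
  have : cimg h (h s) by exists s.
  rewrite himg -ball_normE /= sub0r normrN => hs1.
  exists (h s 0 ord_max); first exact: le_lt_trans (norm_entry_le _ _ _) hs1.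
  rewrite (_ : row2 _ _ = h s) ?cmapK//.
  by apply: eq_rV2; rewrite mxE.
have : cimg h (row2 u t) by rewrite himg; exact: row2_ball.
by move=> [s hs E]; rewrite -E (cmapK hs); split=> //; rewrite E mxE.
Qed.

(** The single chart [h] serves around every point. Each leaf is one coordinate segment, connected
    as the image of an interval, and so is its own only connected component. *)
Lemma chart_foliation :
  foliation (cdom h) [set L | exists2 u : R, `|u| < 1 & L = leaf u].
Proof.
have leaf_connected u : `|u| < 1 -> connected (leaf u).
  move=> u1; rewrite leafE//; apply: connected_continuous_connected.
    by apply/connected_intervalP => x y /=; rewrite !ltr_norml => x1 y1 z xyz; rewrite /= ltr_norml; lra.
  apply: continuous_in_subspaceT => t; rewrite inE /= => t1.
  apply: continuous_comp; first exact: (smooth_continuous (smooth_row2 u openT)).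
  by apply: cinv_continuous; rewrite -/(cimg h) himg; exact: row2_ball.
split.
- apply/seteqP; split=> [s [L [u _ ->] []]//|s hs].
  have : cimg h (h s) by exists s.
  rewrite himg -ball_normE /= sub0r normrN => hs1.
  exists (leaf (h s 0 0)) => //; exists (h s 0 0) => //.
  exact: le_lt_trans (norm_entry_le _ _ _) hs1.
- move=> _ [u u1 ->]; split; last exact: leaf_connected.
  by rewrite leafE//; exists ((cinv h \o row2 u) 0); exists 0 => //=; rewrite normr0.
- by move=> _ _ [u u1 ->] [u' u1' ->] [s [[_ <-] [_ <-]]].
- move=> q hq; exists h; split=> // _ r [u u1 ->] [[hr ru] _].
  have -> : leaf u `&` cdom h = leaf u by apply/seteqP; split=> s; [case|move=> []].
  by rewrite connected_component_id//; [rewrite ru|exact: leaf_connected].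
Qed.

End chart_foliation.

(** * From ruling data in coordinates to a ruled neighborhood *)

Section surface_in_charts.
Context {R : realType} {S : manifold R 2} {M : manifold R 3}.
Variables (g : metric M) (f : S -> M).
Hypothesis imf : immersion f.
Variables (a : chart R 2 S) (b : chart R 3 M).
Hypotheses (Aa : atlas S a) (Ab : atlas M b).

Let F := in_charts f a b.
Let U := charts_dom f a b.

Lemma chart_metric : local_metric (gmx g b) (cimg b).
Proof.
split; [exact: open_cimg|exact: gmx_smooth|by move=> x; exact: gmx_sym|].
by move=> x bx v; exact: gmx_pos.
Qed.

Lemma chart_curvature c : constant_curvature g c -> forall y u v w, cimg b y ->
  curvature (gmx g b) y u v w =
  c *: (inner (gmx g b y) v w *: u - inner (gmx g b y) u w *: v).
Proof.
move=> gc y u v w by_; apply: (constant_curvatureE chart_metric by_).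
by move: by_ => [q bq <-] {}u {}v uv; exact: gc.
Qed.

(** The factor [V] allows the chart domain to be cut down to the interior of the set of planar
    points; the whole space gives [charts_dom]. *)
Lemma open_charts_dom (V : set S) : open V -> open (a @` (cdom a `&` (f @^-1` cdom b `&` V))).
Proof.
move=> oV; apply: open_chart_image; apply: openI => //.
by have [cf _] := imf; move/continuousP: cf; apply; exact: open_cdom.
Qed.

Lemma in_charts_cimg x : U x -> cimg b (F x).
Proof.
move=> [p [ap bp] <-]; rewrite /F /in_charts /= (cmapK ap).
by exists (f p).
Qed.

Lemma smooth_in_charts : smooth_on U F.
Proof. by have [_ h] := imf; have [] := h a b Aa Ab. Qed.

Lemma in_charts_immersion x X : U x -> 'D_X F x = 0 -> X = 0.
Proof.
move=> Ux; have [_ h] := imf; have [_ /(_ x Ux) rF] := h a b Aa Ab.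
rewrite deriveEjacobian; last exact: smooth_differentiable smooth_in_charts Ux.
by move/eqP; rewrite mulmx_free_eq0// => /eqP.
Qed.

Section ruling.
Variables (p0 : S) (N : 'rV[R]_2 -> 'rV[R]_3) (O : set 'rV[R]_2) (i : 'I_2)
  (h : 'rV[R]_2 -> R) (W : 'rV[R]_2 -> 'rV[R]_3).
Hypotheses (ap0 : cdom a p0) (sN : smooth_on U N)
  (N1 : forall x, U x -> inner (gmx g b (F x)) (N x) (N x) = 1)
  (NT : forall x X, U x -> inner (gmx g b (F x)) ('D_X F x) (N x) = 0)
  (Op0 : open_nbhs (a p0) O) (OU : O `<=` U) (rd : ruling_data (gmx g b) F N O i h W).

Lemma ruled_of_ruling_data : exists2 V : set S, open_nbhs p0 V & ruled g f V.
Proof.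
have oU : open U.
  have := open_charts_dom openT; rewrite setIT; exact.
have [oO Oa] := Op0; have [sh _ dh _] := rd.
have [Om [H [G [k [[[oOm Omp] OmO] [sH sG] HP GP [k0 H0 Hk]]]]]] :=
  flow_box Op0 sh (dh _ Oa).
have Oma : Om `<=` cimg a by move=> x /OmO/OU[p [ap _] <-]; exists p.
have cH x (Ox : Om x) := smooth_continuous sH Ox.
have b12 : ball (0 : 'rV[R]_2) 1 `<=` ball 0 2 by apply: le_ball; rewrite ler1n.
(* The chart is restricted to the unit square, as [foliation] asks, while [G] stays available on the
   square of radius 2 to extend the leaves beyond their ends. *)
pose Om1 := Om `&` H @^-1` ball 0 1.
have oOm1 : open Om1 by apply: open_preimage_on => //; exact: ball_open.
have Om1P x : Om1 x -> ball 0 1 (H x) /\ G (H x) = x.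
  by move=> [Ox Hx]; have [_ ->] := HP x Ox.
have G1P y : ball 0 1 y -> Om1 (G y) /\ H (G y) = y.
  move=> y1; have [OGy HGy] := GP y (b12 _ y1); split=> //; split=> //.
  by rewrite /preimage /= HGy.
have o1 : open (ball (0 : 'rV[R]_2) (1 : R)) by exact: ball_open.
have o2 : open (ball (0 : 'rV[R]_2) (2 : R)) by exact: ball_open.
have sG1 : smooth_on (ball 0 1) G := smooth_subset b12 sG.
have sH1 : smooth_on Om1 H by apply: smooth_subset sH => x [].
have [hc [hdom hmap hinv himg]] : exists hc : chart R 2 S, [/\ cdom hc = cdom a `&` a @^-1` Om1,
    (hc : S -> _) = H \o a, cinv hc = cinv a \o G & cimg hc = ball 0 1].
  apply: compose_chart => //; first by move=> x [/Oma].
  - by move=> x [/cH].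
  - by move=> y y1; exact: smooth_continuous sG1 y1.
have ah : admissible_chart hc.
  apply: (admissible_compose Aa oOm1 o1 _ sH1 sG1 hdom hmap hinv himg).
  by move=> x /Om1P[].
exists (cdom hc).
  split; first exact: open_cdom.
  by rewrite hdom; split=> //; split=> //; rewrite /preimage /= H0; exact: ballxx.
exists [set L | exists2 u : R, `|u| < 1 & L = leaf hc u].
split; first exact: chart_foliation.
move=> _ [u u1 ->]; pose gam := G \o row2 u.
pose D := [set t : R | `|t| < 2].
have Drow t : D t -> ball 0 2 (row2 u t).
  by move=> Dt; apply: row2_ball => //; rewrite (lt_trans u1)// ltr1n.
have oD : open D by exact: open_norm_lt.
have sr := smooth_row2 u oD.
have sgam : smooth_on D gam := smooth_comp oD o2 Drow sr sG.
have gamP (t : R) : D t -> [/\ O (gam t), 'D_1 gam t != 0 & 'D_('D_1 gam t) h (gam t) = 0].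
  move=> Dt; have dG := smooth_differentiable sG (Drow t Dt).
  have -> : 'D_1 gam t = 'D_(delta_mx 0 ord_max) G (row2 u t).
    rewrite /gam (funext (fun t => f_equal G (row2_line u t)) : _ \o _ = _) [in RHS]row2_line.
    by rewrite row2_line in dG; have [_ ->] := is_derive_line dG.
  have [Ogam _] := GP _ (Drow t Dt).
  have [Th T0] := flow_box_tangent oOm o2 sH (smooth_subset OmO sh) sG GP k0 Hk (Drow t Dt).
  by split=> //; exact: OmO.
have [I [tau [oI iI tauI stau geo]]] := leaf_geodesic chart_metric oU
  in_charts_cimg smooth_in_charts in_charts_immersion sN N1 NT OU rd sgam gamP.
have tauD r : I r -> D (tau r).
  move=> Ir; have : [set t : R | `|t| < 1] (tau r) by rewrite -tauI; exists r.
  by move=> /= t1; rewrite /D /= (lt_trans t1)// ltr1n.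
have sc : smooth_on I (gam \o tau) := smooth_comp_curve oI oD tauD stau sgam.
have Uc r : I r -> U ((gam \o tau) r).
  by move=> Ir; have [/OU] := gamP _ (tauD r Ir).
have cc r : I r -> {for r, continuous (cinv a \o (gam \o tau))}.
  move=> Ir; apply: continuous_comp; first exact: smooth_continuous sc Ir.
  by apply: cinv_continuous; have [p [ap _] <-] := Uc r Ir; exists p.
exists I, (cinv a \o (gam \o tau)); split=> //.
  by rewrite leafE// -tauI hinv -[RHS]image_comp -[in RHS](image_comp tau gam) (image_comp gam).
have [cf _] := imf.
split=> r Ir; first by apply: continuous_comp; [exact: cc|exact: cf].
exists b; split=> //.
- have [p [ap bp] pE] := Uc r Ir.
  by rewrite -[(f \o _) r]/(f (cinv a ((gam \o tau) r))) -pE (cmapK ap).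
- exists I; first by [].
  have sF := smooth_in_charts; have := smooth_comp oI oU Uc sc sF; exact.
- exact: geo.
Qed.

End ruling.
End surface_in_charts.

Lemma det_char_poly (K : fieldType) (A : 'M[K]_2) k1 k2 :
  char_poly A = ('X - k1%:P) * ('X - k2%:P) -> \det A = k1 * k2.
Proof.
move=> E; have := char_poly_det A; rewrite E -horner_coef0 !hornerE.
by rewrite sqrrN expr1n mul1r mulrNN.
Qed.

(** Cayley-Hamilton. Zero eigenvalues alone only make A nilpotent; self-adjointness is brought in
    separately to conclude that A vanishes. *)
Lemma char_poly_sqr (K : fieldType) (A : 'M[K]_2) :
  char_poly A = ('X - 0%:P) * ('X - 0%:P) -> A *m A = 0.
Proof.
move=> E; have := Cayley_Hamilton A; rewrite E subr0 rmorphM /= horner_mx_X.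
exact.
Qed.

Lemma char_poly_eq0 (K : fieldType) k1 k2 :
  char_poly (0 : 'M[K]_2) = ('X - k1%:P) * ('X - k2%:P) -> k1 = 0 /\ k2 = 0.
Proof.
have -> : char_poly (0 : 'M[K]_2) = 'X ^+ 2.
  by rewrite /char_poly /char_poly_mx map_mx0 subr0 det_scalar.
move=> E; split; apply/eqP.
  by have := f_equal (fun p => p.[k1]) E; rewrite !hornerE subrr mul0r => /eqP; rewrite expf_eq0.
by have := f_equal (fun p => p.[k2]) E; rewrite !hornerE subrr mulr0 => /eqP; rewrite expf_eq0.
Qed.

Theorem theorem2 (R : realType) (M : manifold R 3) (g : metric M)
    (S : manifold R 2) (f : S -> M) (p0 : S) :
  space_form g ->
  immersion f ->
  (forall p, extrinsic_curvature g f p 0) ->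
  parabolic g f p0 \/ interior [set p | planar g f p] p0 ->
  exists2 U : set S, open_nbhs p0 U & ruled g f U.
Proof.
move=> [c gc] imf K0 p0P.
have [a Aa ap0] := atlas_cover p0; have [b Ab bp0] := atlas_cover (f p0).
set F := in_charts f a b; set U := charts_dom f a b.
have hg := chart_metric g Ab; have gcurv := chart_curvature Ab gc.
have oU : open U by have := @open_charts_dom _ _ _ _ imf a b _ openT; rewrite setIT; exact.
have UB x : U x -> cimg b (F x) by exact: in_charts_cimg.
have sF : smooth_on U F := smooth_in_charts imf Aa Ab.
have imm x X : U x -> 'D_X F x = 0 -> X = 0 by exact: in_charts_immersion.
have Uap0 : U (a p0) by exists p0.
have [N [sN NP]] := exists_unit_normal hg oU UB sF imm.
have N1 x : U x -> inner (gmx g b (F x)) (N x) (N x) = 1 by move=> /NP[].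
have NT x X : U x -> inner (gmx g b (F x)) ('D_X F x) (N x) = 0 by move=> /NP[_]; exact.
(* The curvature hypotheses quantify over all unit normals near a point; at every point they are
   applied to the one field [N] built on the whole chart domain. *)
have un p : cdom a p -> cdom b (f p) -> unit_normal g f a b N p.
  by move=> ap bp; split=> //; exists U; split=> //; split=> //; exists p.
suff: exists O i h W,
    [/\ open_nbhs (a p0) O, O `<=` U & ruling_data (gmx g b) F N O i h W].
  move=> [Q [i [h [W [Op0 OU rd]]]]]; exact: (ruled_of_ruling_data imf Aa Ab ap0 sN N1 NT Op0 OU rd).
have [par|pla] := p0P.
- have shape x : U x -> exists2 A : 'M[R]_2, \det A = 0 &
      forall X, 'D_(X *m A) F x = - covariant (gmx g b) F N X x.
    move=> [p [ap bp] <-]; have [k1 [k2 [[A sA cA] k12]]] := K0 p a b N (un p ap bp).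
    by exists A => //; rewrite (det_char_poly cA) -k12.
  have [k1 [k2 [[A sA cA] k12]]] := par a b N (un p0 ap0 bp0).
  (* If nabla_X N vanished for all X, injectivity of dF would give A = 0 and both principal
     curvatures would be zero, against the exclusive or. *)
  have [X0 X0P] : exists X0, covariant (gmx g b) F N X0 (a p0) != 0.
    apply: contrapT => noX; suff A0 : A = 0.
      by move: k12; rewrite A0 in cA; have [-> ->] := char_poly_eq0 cA; rewrite eqxx.
    have XA (X : 'rV[R]_2) : X *m A = 0.
      apply: (imm _ _ Uap0); rewrite sA; apply/eqP; rewrite oppr_eq0.
      by apply/negP => /negP cX; apply: noX; exists X.
    by apply/row_matrixP => j; rewrite rowE XA row0.
  exact: (parabolic_ruling_data hg gcurv oU UB sF sN NT Uap0 shape X0P).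
- pose V := [set p | planar g f p]°.
  pose U1 := a @` (cdom a `&` (f @^-1` cdom b `&` V)).
  have oU1 : open U1 by apply: open_charts_dom => //; exact: open_interior.
  have U1U : U1 `<=` U by move=> _ [p [ap [bp _]] <-]; exists p.
  have U1p0 : U1 (a p0) by exists p0.
  (* The shape operator is self-adjoint and squares to zero: <A X, A X> = <X, A (A X)> = 0, so it
     vanishes and N is parallel. *)
  have N0 x X : U1 x -> covariant (gmx g b) F N X x = 0.
    move=> U1x; have Ux := U1U _ U1x; have [p [ap [bp Vp]] px] := U1x.
    have [A sA cA] := interior_subset Vp a b N (un p ap bp); rewrite /shape_operator px in sA.
    have pos : pos_def (gmx g b (F x)) by have [_ _ _] := hg; apply; exact: UB.
    suff v0 : 'D_(X *m A) F x = 0 by apply/eqP; rewrite -oppr_eq0 -sA v0.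
    apply: (inner_eq0 pos); rewrite [X in inner _ X _]sA innerNl.
    rewrite (shape_selfadjoint hg oU UB sF sN NT X (X *m A) Ux) -innerNl -sA.
    rewrite -mulmxA (char_poly_sqr cA) mulmx0.
    by rewrite deriveE ?linear0 ?inner0l//; exact: smooth_differentiable sF Ux.
  have [Q [i [h [W [Op0 OU1 rd]]]]] := planar_ruling_data hg gcurv oU1
    (fun x Ux => UB x (U1U x Ux)) (smooth_subset U1U sF)
    (fun x X Ux => imm x X (U1U x Ux)) U1p0 N0.
  by exists Q, i, h, W; split=> // x /OU1/U1U.
Qed.
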